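(* Let $n\ge2$, let $\mathcal{D}$ be the diagrammatic category of Soergel bimodules for the type $B_n$ Coxeter system with the realisation given in the context, and let $\mathscr{B}$ be the additive monoidal category of $(\mathscr{B}_n,\mathscr{B}_n)$-bimodules generated by the $\mathcal{U}_j$. Then $G:\mathcal{D}\to\mathscr{B}$ is a well-defined monoidal functor, where on objects $G$ sends the empty sequence in $S$ to the monoidal identity $\mathscr{B}_n$, $s_j$ to $\mathcal{U}_j$, and a sequence $s_{i_1}s_{i_2}\cdots s_{i_k}$ of length $k\ge2$ to $G(s_{i_1}\cdots s_{i_{k-1}})\otimes_{\mathscr{B}_n}G(s_{i_k})$ (with coherence isomorphisms $G(\underline w)\otimes G(\underline w')\cong G(\underline{ww'})$ given by associators and unitors), and on generating morphisms $G$ is given by: for the colour $s_j$, the enddot $B_{s_j}\to\mathbf{1}$ goes to $(-1)^{j+1}\beta_j$; the startdot $\mathbf{1}\to B_{s_j}$ goes to $\gamma_j$; the splitting trivalent vertex $B_{s_j}\to B_{s_j}B_{s_j}$ goes to $(-1)^{j+1}\alpha_j$; the merging trivalent vertex $B_{s_j}B_{s_j}\to B_{s_j}$ goes to $\delta_j$; the box labelled $\alpha_{s_j}$ goes to $\epsilon_j$; and every $2m_{st}$-valent vertex goes to $0$.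
   Context: **The algebra and bimodules.** Let $Q_n$ be the quiver with vertices $1,\dots,n$, arrows $(j|j+1):j\to j+1$, $(j+1|j):j+1\to j$, and loops $ie_j$ at $j$ ($2\le j\le n$). Paths are concatenated left to right and $e_j$ is the constant path. $\mathscr{B}_n$ is $\mathbb{R}Q_n$ modulo: $(j|j-1)(j-1|j)=(j|j+1)(j+1|j)$, $(j-1|j)(j|j+1)=0=(j+1|j)(j|j-1)$ for $2\le j\le n-1$; $(ie_j)^2=-e_j$ ($j\ge2$); $(ie_{j-1})(j-1|j)=(j-1|j)(ie_j)$, $(ie_j)(j|j-1)=(j|j-1)(ie_{j-1})$ ($j\ge3$); $(1|2)(ie_2)(2|1)=0$; $(ie_2)X_2=X_2(ie_2)$, where $X_1=(1|2)(2|1)$, $X_j=(j|j-1)(j-1|j)$ for $j\ge2$. Path-length grading: arrows $(j|j\pm1)$ have degree 1, $e_j$ and $ie_j$ degree 0; the shift $(1)$ lowers degrees by 1. $\mathbb{F}_1=\mathbb{R}$, $\mathbb{F}_j=\mathbb{C}$ ($j\ge2$); $P_j=\mathscr{B}_ne_j$, ${}_jP=e_j\mathscr{B}_n$ with $i\in\mathbb{C}$ acting through $ie_j$; $\mathcal{U}_j=P_j\otimes_{\mathbb{F}_j}{}_jP(1)$. $\mathscr{B}$ is the additive monoidal subcategory of $(\mathscr{B}_n,\mathscr{B}_n)$-bimodules generated by the $\mathcal{U}_j$, $1\le j\le n$ (and grading shifts), with bimodule homomorphisms of all degrees. Bimodule maps: $\beta_j:\mathcal{U}_j\to\mathscr{B}_n$,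 $e_j\otimes e_j\mapsto e_j$ (degree 1). $\gamma_j:\mathscr{B}_n\to\mathcal{U}_j$ (degree 1) with $\gamma_1(1)=X_1\otimes e_1+e_1\otimes X_1+(2|1)\otimes(1|2)+(-ie_2)(2|1)\otimes(1|2)(ie_2)$; $\gamma_j(1)=X_j\otimes e_j+e_j\otimes X_j+(j-1|j)\otimes(j|j-1)+(j+1|j)\otimes(j|j+1)$ for $1<j<n$; $\gamma_n(1)=X_n\otimes e_n+e_n\otimes X_n+(n-1|n)\otimes(n|n-1)$. $\alpha_j:\mathcal{U}_j\to\mathcal{U}_j\otimes_{\mathscr{B}_n}\mathcal{U}_j$, $e_j\otimes e_j\mapsto e_j\otimes e_j\otimes e_j\otimes e_j$ (degree $-1$). $\delta_j:\mathcal{U}_j\otimes_{\mathscr{B}_n}\mathcal{U}_j\to\mathcal{U}_j$ (degree $-1$), $e_j\otimes X_j\otimes e_j\otimes e_j\mapsto e_j\otimes e_j$, $e_j\otimes e_j\otimes e_j\otimes e_j\mapsto0$. $\epsilon_j:\mathscr{B}_n\to\mathscr{B}_n$ (degree 2) with $\epsilon_1(1)=2X_1+2X_2$; $\epsilon_j(1)=(-1)^{j+1}(2X_j+X_{j-1}+X_{j+1})$ for $1<j<n$; $\epsilon_n(1)=(-1)^{n+1}(2X_n+X_{n-1})$. **The category $\mathcal{D}$.** $S=\{s_1,\dots,s_n\}$, $m_{s_1s_2}=4$, $m_{s_js_{j+1}}=3$ for $j\ge2$, other $m_{st}=2$. Realisation over $\mathbb{R}$: $\mathfrak{h}=\bigoplus\mathbb{R}\alpha_s^\vee$,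 $\langle\alpha_s^\vee,\alpha_t\rangle=a_{s,t}$ with $a_{s,s}=2$, $a_{s_2,s_1}=-2$, $a_{s_1,s_2}=-1$, $a_{s,t}=-1$ if $m_{st}=3$, $0$ if $m_{st}=2$. $R=\mathrm{Sym}(\mathfrak{h}^* )$ with $\deg\mathfrak{h}^*=2$, $s(f)$ the reflection action, $\partial_s(f)=(f-s(f))/\alpha_s$. $\mathcal{D}$ is the Elias–Williamson diagrammatic Hecke category of this realisation: the $\mathbb{R}$-linear strict monoidal category with objects finite sequences in $S$ (denoted $B_{\underline w}$) and morphisms spanned by isotopy classes of $S$-coloured planar graphs in the strip (bottom boundary the source, top the target) built from univalent vertices (dots), trivalent vertices of one colour, $2m_{st}$-valent vertices with alternating colours $s,t$, and boxes labelled by homogeneous $f\in R$ in regions, modulo: (a) the barbell (startdot followed by enddot of colour $s$) equals $\alpha_s$; polynomial forcing: $f$ to the left of an $s$-strand equals $s(f)$ to its right plus the broken strand (enddot, then startdot) with $\partial_s(f)$ in between; (b) the needle relation (a trivalent vertex with its other two ends joined is $0$) and the relations making $B_s$ a Frobenius object (associativity, coassociativity, unit and counit by dots, self-biadjointness and cyclicity); (c) two-colour associativity (a trivalent vertex slides through a $2m_{st}$-valent vertex) and the dot-crossing relation expressing a $2m_{st}$-valent vertex with a dot on one strand via the two-coloured Jones–Wenzl morphism $JW_{m_{st}-1}$ (two-coloured Temperley–Lieb circles evaluated to $a_{s,t}$, $a_{t,s}$), for $m_{st}=2,3,4$; (d) the three-colour (Zamolodzhikov) relations for rank-three finite parabolic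 subsystems of types $A_1\times I_2(m)$ ($m=2,3,4$), $A_3$, $B_3$, all of whose terms contain $2m_{st}$-valent vertices. *)

(* Defs.v *)
From HB Require Import structures.
From mathcomp Require Import all_boot all_order all_algebra.
From mathcomp Require Import boolp functions reals.
From mathcomp Require Import mpoly complex.

Set Implicit Arguments.
Unset Strict Implicit.
Unset Printing Implicit Defensive.

Import Order.TTheory GRing.Theory Num.Theory.

Local Open Scope ring_scope.
Local Open Scope quotient_scope.

(* Tensor products, the algebra and the morphism spaces of the diagrammatic   *)
(* category are all given by generators and relations.  lmpres packages a     *)
(* type of formal expressions with a congruence making it an R-module, and    *)
(* lmq is the quotient module.                                                *)
Record lmpres (R : pzRingType) := LMPres {
  pcar : Type;
  peq : pcar -> pcar -> Prop;
  pzero : pcar;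
  padd : pcar -> pcar -> pcar;
  pscale : R -> pcar -> pcar;
  peq_refl : forall x, peq x x;
  peq_sym : forall x y, peq x y -> peq y x;
  peq_trans : forall x y z, peq x y -> peq y z -> peq x z;
  peq_add : forall x x' y y', peq x x' -> peq y y' -> peq (padd x y) (padd x' y');
  peq_scale : forall a x x', peq x x' -> peq (pscale a x) (pscale a x');
  paddA : forall x y z, peq (padd x (padd y z)) (padd (padd x y) z);
  paddC : forall x y, peq (padd x y) (padd y x);
  padd0 : forall x, peq (padd pzero x) x;
  pscaleA : forall a b x, peq (pscale a (pscale b x)) (pscale (a * b) x);
  pscale1 : forall x, peq (pscale 1 x) x;
  pscaleDr : forall a x y, peq (pscale a (padd x y)) (padd (pscale a x) (pscale a y));
  pscaleDl : forall a b x, peq (pscale (a + b) x) (padd (pscale a x) (pscale b x));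
  pscale0 : forall x, peq (pscale 0 x) pzero }.

Section PresentedModule.
Variables (R : pzRingType) (P : lmpres R).

Definition peqb : rel {classic pcar P} := fun x y => `[< @peq R P x y >].

Lemma peqb_equiv : equiv_class_of peqb.
Proof.
split=> [x|x y|y x z].
- exact/asboolP/peq_refl.
- by apply/asboolP/asboolP; apply: peq_sym.
- by move=> /asboolP xy /asboolP yz; apply/asboolP/(peq_trans xy yz).
Qed.

Canonical peqb_rel := EquivRelPack peqb_equiv.

Definition lmq : Type := {eq_quot peqb_rel}.
HB.instance Definition _ := Choice.on lmq.

Definition lmpi (x : pcar P) : lmq := \pi_({eq_quot peqb_rel}) (x : {classic pcar P}).
Definition lmrepr (q : lmq) : pcar P := repr (q : {eq_quot peqb_rel}).

Lemma lmpiK q : lmpi (lmrepr q) = q. Proof. exact: reprK. Qed.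

Lemma lmpiP x y : lmpi x = lmpi y <-> peq x y.
Proof.
split; first by move/eqmodP/asboolP.
by move=> xy; apply/eqmodP/asboolP.
Qed.

Lemma lmreprK x : peq (lmrepr (lmpi x)) x.
Proof. by apply/lmpiP; rewrite lmpiK. Qed.

Lemma lmq_ind (K : lmq -> Prop) : (forall x, K (lmpi x)) -> forall q, K q.
Proof. by move=> Kpi q; rewrite -(lmpiK q). Qed.

Definition lmadd (p q : lmq) : lmq := lmpi (padd (lmrepr p) (lmrepr q)).
Definition lmscale (a : R) (q : lmq) : lmq := lmpi (pscale a (lmrepr q)).

Lemma lmaddE x y : lmadd (lmpi x) (lmpi y) = lmpi (padd x y).
Proof. by apply/lmpiP/peq_add; apply: lmreprK. Qed.

Lemma lmscaleE a x : lmscale a (lmpi x) = lmpi (pscale a x).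
Proof. by apply/lmpiP/peq_scale/lmreprK. Qed.

Let addA : associative lmadd.
Proof.
elim/lmq_ind=> x; elim/lmq_ind=> y; elim/lmq_ind=> z.
by rewrite !lmaddE; apply/lmpiP/paddA.
Qed.
Let addC : commutative lmadd.
Proof.
by elim/lmq_ind=> x; elim/lmq_ind=> y; rewrite !lmaddE; apply/lmpiP/paddC.
Qed.
Let add0 : left_id (lmpi (pzero P)) lmadd.
Proof. by elim/lmq_ind=> x; rewrite lmaddE; apply/lmpiP/padd0. Qed.
Let addN : left_inverse (lmpi (pzero P)) (lmscale (-1)) lmadd.
Proof.
elim/lmq_ind=> x; rewrite lmscaleE lmaddE; apply/lmpiP.
have e : peq (padd (pscale (-1) x) (pscale 1 x)) (pscale (-1 + 1) x).
  exact/peq_sym/pscaleDl.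
rewrite addNr in e.
apply: peq_trans (peq_trans e (pscale0 x)).
by apply: peq_add (peq_refl _) _; apply/peq_sym/pscale1.
Qed.

HB.instance Definition _ := GRing.isZmodule.Build lmq addA addC add0 addN.

Let scA a b q : lmscale a (lmscale b q) = lmscale (a * b) q.
Proof. by elim/lmq_ind: q => x; rewrite !lmscaleE; apply/lmpiP/pscaleA. Qed.
Let sc1 : left_id 1 lmscale.
Proof. by elim/lmq_ind=> x; rewrite lmscaleE; apply/lmpiP/pscale1. Qed.
Let scDr : right_distributive lmscale +%R.
Proof.
move=> a; elim/lmq_ind=> x; elim/lmq_ind=> y.
by rewrite [_ + _]lmaddE !lmscaleE [RHS]lmaddE; apply/lmpiP/pscaleDr.
Qed.
Let scDl q : {morph lmscale^~ q : a b / a + b}.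
Proof.
elim/lmq_ind: q => x a b.
by rewrite !lmscaleE [RHS]lmaddE; apply/lmpiP/pscaleDl.
Qed.

HB.instance Definition _ := GRing.Zmodule_isLmodule.Build R lmq scA sc1 scDr scDl.

Lemma lmpi0 : lmpi (pzero P) = 0. Proof. by []. Qed.
Lemma lmpiD x y : lmpi (padd x y) = lmpi x + lmpi y.
Proof. by rewrite [RHS]lmaddE. Qed.
Lemma lmpiZ a x : lmpi (pscale a x) = a *: lmpi x.
Proof. by rewrite [RHS]lmscaleE. Qed.

End PresentedModule.

Record lmoncat (R : pzRingType) := LMonCat {
  ob :> Type;
  mor : ob -> ob -> lmodType R;
  idm : forall x, mor x x;
  mcomp : forall x y z, mor y z -> mor x y -> mor x z;
  mone : ob;
  mtens : ob -> ob -> ob;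
  tensm : forall x y x' y', mor x y -> mor x' y' -> mor (mtens x x') (mtens y y');
  massoc : forall x y z, mor (mtens (mtens x y) z) (mtens x (mtens y z));
  miassoc : forall x y z, mor (mtens x (mtens y z)) (mtens (mtens x y) z);
  mlunit : forall x, mor (mtens mone x) x;
  milunit : forall x, mor x (mtens mone x);
  mrunit : forall x, mor (mtens x mone) x;
  mirunit : forall x, mor x (mtens x mone);
  comp_lin_l : forall x y z a (g g' : mor y z) (f : mor x y),
    mcomp (a *: g + g') f = a *: mcomp g f + mcomp g' f;
  comp_lin_r : forall x y z a (g : mor y z) (f f' : mor x y),
    mcomp g (a *: f + f') = a *: mcomp g f + mcomp g f';
  compA : forall x y z t (h : mor z t) (g : mor y z) (f : mor x y),
    mcomp h (mcomp g f) = mcomp (mcomp h g) f;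
  comp1m : forall x y (f : mor x y), mcomp (idm y) f = f;
  compm1 : forall x y (f : mor x y), mcomp f (idm x) = f;
  tensm_lin_l : forall x y x' y' a (f f' : mor x y) (g : mor x' y'),
    tensm (a *: f + f') g = a *: tensm f g + tensm f' g;
  tensm_lin_r : forall x y x' y' a (f : mor x y) (g g' : mor x' y'),
    tensm f (a *: g + g') = a *: tensm f g + tensm f g';
  tensm_id : forall x y, tensm (idm x) (idm y) = idm (mtens x y);
  tensm_comp : forall x y z x' y' z' (g : mor y z) (f : mor x y)
      (g' : mor y' z') (f' : mor x' y'),
    tensm (mcomp g f) (mcomp g' f') = mcomp (tensm g g') (tensm f f');
  massocK : forall x y z, mcomp (miassoc x y z) (massoc x y z) = idm _;
  miassocK : forall x y z, mcomp (massoc x y z) (miassoc x y z) = idm _;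
  mlunitK : forall x, mcomp (milunit x) (mlunit x) = idm _;
  milunitK : forall x, mcomp (mlunit x) (milunit x) = idm _;
  mrunitK : forall x, mcomp (mirunit x) (mrunit x) = idm _;
  mirunitK : forall x, mcomp (mrunit x) (mirunit x) = idm _;
  massoc_nat : forall x y z x' y' z' (f : mor x x') (g : mor y y') (h : mor z z'),
    mcomp (massoc x' y' z') (tensm (tensm f g) h)
    = mcomp (tensm f (tensm g h)) (massoc x y z);
  mlunit_nat : forall x y (f : mor x y),
    mcomp (mlunit y) (tensm (idm mone) f) = mcomp f (mlunit x);
  mrunit_nat : forall x y (f : mor x y),
    mcomp (mrunit y) (tensm f (idm mone)) = mcomp f (mrunit x);
  mtriangle : forall x y,
    mcomp (tensm (idm x) (mlunit y)) (massoc x mone y) = tensm (mrunit x) (idm y);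
  mpentagon : forall x y z t,
    mcomp (massoc x y (mtens z t)) (massoc (mtens x y) z t)
    = mcomp (tensm (idm x) (massoc y z t))
        (mcomp (massoc x (mtens y z) t) (tensm (massoc x y z) (idm t))) }.

Definition is_iso (R : pzRingType) (C : lmoncat R) (x y : C) (f : mor x y) : Prop :=
  exists g : mor y x, mcomp g f = idm x /\ mcomp f g = idm y.

(* F on objects, Fm on morphisms, with coherence isomorphisms eps and mu.     *)
Record is_monoidal_functor (R : pzRingType) (C D : lmoncat R) (F : C -> D)
    (Fm : forall x y : C, mor x y -> mor (F x) (F y))
    (eps : mor (mone D) (F (mone C)))
    (mu : forall x y : C, mor (mtens (F x) (F y)) (F (mtens x y))) : Prop :=
  IsMonoidalFunctor {
  mf_lin : forall x y a (f g : mor x y), Fm _ _ (a *: f + g) = a *: Fm _ _ f + Fm _ _ g;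
  mf_id : forall x, Fm _ _ (idm x) = idm (F x);
  mf_comp : forall x y z (g : mor y z) (f : mor x y),
    Fm _ _ (mcomp g f) = mcomp (Fm _ _ g) (Fm _ _ f);
  mf_eps_iso : is_iso eps;
  mf_mu_iso : forall x y, is_iso (mu x y);
  mf_mu_nat : forall x y x' y' (f : mor x y) (g : mor x' y'),
    mcomp (mu y y') (tensm (Fm _ _ f) (Fm _ _ g)) = mcomp (Fm _ _ (tensm f g)) (mu x x');
  mf_assoc : forall x y z,
    mcomp (mu x (mtens y z)) (mcomp (tensm (idm (F x)) (mu y z)) (massoc (F x) (F y) (F z)))
    = mcomp (Fm _ _ (massoc x y z)) (mcomp (mu (mtens x y) z) (tensm (mu x y) (idm (F z))));
  mf_lunit : forall x,
    mcomp (Fm _ _ (mlunit x)) (mcomp (mu (mone C) x) (tensm eps (idm (F x)))) = mlunit (F x);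
  mf_runit : forall x,
    mcomp (Fm _ _ (mrunit x)) (mcomp (mu x (mone C)) (tensm (idm (F x)) eps)) = mrunit (F x) }.

(* Generators carry the labels of the quiver vertices, 1, ..., n.  They are   *)
(* indexed by all of nat; those which are not in the quiver are set to 0 by   *)
(* the relations r_vtx, r_arr and r_loop below.                               *)
Inductive qgen := Qvtx of nat | Qarr of nat & nat | Qloop of nat.

Section ZigzagTerms.
Variables (R : realType) (n : nat).

Inductive aterm :=
  | Azero | Aone | Agen of qgen
  | Aadd of aterm & aterm | Ascale of R & aterm | Amul of aterm & aterm.

Local Notation "0" := Azero.
Local Notation "1" := Aone.
Local Notation "x + y" := (Aadd x y).
Local Notation "x * y" := (Amul x y).
Local Notation "a *: x" := (Ascale a x).
Local Notation te j := (Agen (Qvtx j)).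
Local Notation ta j k := (Agen (Qarr j k)).
Local Notation tie j := (Agen (Qloop j)).

Definition is_vertex (j : nat) : bool := (1 <= j <= n)%N.
Definition is_arrow (j k : nat) : bool :=
  [&& is_vertex j, is_vertex k & (k == j.+1) || (j == k.+1)].
Definition is_loop (j : nat) : bool := (2 <= j <= n)%N.

Definition tX (j : nat) : aterm :=
  if j == 1%N then ta 1 2 * ta 2 1 else ta j j.-1 * ta j.-1 j.

Reserved Notation "x ≈ y" (at level 70).
Inductive aeq : aterm -> aterm -> Prop :=
  | a_refl x : x ≈ x
  | a_sym x y : x ≈ y -> y ≈ x
  | a_trans x y z : x ≈ y -> y ≈ z -> x ≈ z
  | a_add x x' y y' : x ≈ x' -> y ≈ y' -> x + y ≈ x' + y'
  | a_scale a x x' : x ≈ x' -> a *: x ≈ a *: x'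
  | a_mul x x' y y' : x ≈ x' -> y ≈ y' -> x * y ≈ x' * y'
  | a_addA x y z : x + (y + z) ≈ (x + y) + z
  | a_addC x y : x + y ≈ y + x
  | a_add0 x : 0 + x ≈ x
  | a_scaleA a b x : a *: (b *: x) ≈ (a * b)%R *: x
  | a_scale1 x : 1%R *: x ≈ x
  | a_scaleDr a x y : a *: (x + y) ≈ a *: x + a *: y
  | a_scaleDl a b x : (a + b)%R *: x ≈ a *: x + b *: x
  | a_scale0 x : 0%R *: x ≈ 0
  | a_mulA x y z : x * (y * z) ≈ (x * y) * z
  | a_mul1l x : 1 * x ≈ x
  | a_mul1r x : x * 1 ≈ x
  | a_mulDl x y z : (x + y) * z ≈ x * z + y * z
  | a_mulDr x y z : x * (y + z) ≈ x * y + x * z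
  | a_mulZl a x y : (a *: x) * y ≈ a *: (x * y)
  | a_mulZr a x y : x * (a *: y) ≈ a *: (x * y)
  | r_vtx j : ~~ is_vertex j -> te j ≈ 0
  | r_arr j k : ~~ is_arrow j k -> ta j k ≈ 0
  | r_loop j : ~~ is_loop j -> tie j ≈ 0
  | r_one : 1 ≈ foldr Aadd 0 [seq te j | j <- iota 1 n]
  | r_vtx_idem j : te j * te j ≈ te j
  | r_vtx_orth j k : j != k -> te j * te k ≈ 0
  | r_arr_src j k : te j * ta j k ≈ ta j k
  | r_arr_tgt j k : ta j k * te k ≈ ta j k
  | r_loop_src j : te j * tie j ≈ tie j
  | r_loop_tgt j : tie j * te j ≈ tie j
  | r_zigzag j : (2 <= j <= n.-1)%N -> ta j j.-1 * ta j.-1 j ≈ ta j j.+1 * ta j.+1 j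
  | r_up j : (2 <= j <= n.-1)%N -> ta j.-1 j * ta j j.+1 ≈ 0
  | r_down j : (2 <= j <= n.-1)%N -> ta j.+1 j * ta j j.-1 ≈ 0
  | r_i2 j : (2 <= j <= n)%N -> tie j * tie j ≈ (-1)%R *: te j
  | r_i_up j : (3 <= j <= n)%N -> tie j.-1 * ta j.-1 j ≈ ta j.-1 j * tie j
  | r_i_down j : (3 <= j <= n)%N -> tie j * ta j j.-1 ≈ ta j j.-1 * tie j.-1
  | r_i_one : ta 1 2 * tie 2 * ta 2 1 ≈ 0
  | r_i_X : tie 2 * tX 2 ≈ tX 2 * tie 2
where "x ≈ y" := (aeq x y).

End ZigzagTerms.

Section Zigzag.
Variables (R : realType) (n : nat).

Definition apres : lmpres R :=
  @LMPres R (aterm R) (aeq n) (Azero R) (@Aadd R) (@Ascale R)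
    (@a_refl R n) (@a_sym R n) (@a_trans R n) (@a_add R n) (@a_scale R n)
    (@a_addA R n) (@a_addC R n) (@a_add0 R n) (@a_scaleA R n) (@a_scale1 R n)
    (@a_scaleDr R n) (@a_scaleDl R n) (@a_scale0 R n).

Definition zigzag : Type := lmq apres.
HB.instance Definition _ := GRing.Lmodule.on zigzag.

Definition zmul (x y : zigzag) : zigzag :=
  lmpi (P := apres) (Amul (lmrepr x) (lmrepr y)).

Lemma zmulE (x y : aterm R) :
  zmul (lmpi (P := apres) x) (lmpi (P := apres) y) = lmpi (P := apres) (Amul x y).
Proof. by apply/lmpiP/a_mul; apply: (@lmreprK _ apres). Qed.

Let mulA : associative zmul.
Proof.
elim/(@lmq_ind _ apres)=> x; elim/(@lmq_ind _ apres)=> y; elim/(@lmq_ind _ apres)=> z.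
by rewrite !zmulE; apply/(@lmpiP _ apres)/a_mulA.
Qed.
Let mul1 : left_id (lmpi (P := apres) (Aone R)) zmul.
Proof.
by elim/(@lmq_ind _ apres)=> x; rewrite zmulE; apply/(@lmpiP _ apres)/a_mul1l.
Qed.
Let mulr1 : right_id (lmpi (P := apres) (Aone R)) zmul.
Proof.
by elim/(@lmq_ind _ apres)=> x; rewrite zmulE; apply/(@lmpiP _ apres)/a_mul1r.
Qed.
Let mulDl : left_distributive zmul +%R.
Proof.
elim/(@lmq_ind _ apres)=> x; elim/(@lmq_ind _ apres)=> y; elim/(@lmq_ind _ apres)=> z.
by rewrite -lmpiD !zmulE -lmpiD; apply/(@lmpiP _ apres)/a_mulDl.
Qed.
Let mulDr : right_distributive zmul +%R.
Proof.
elim/(@lmq_ind _ apres)=> x; elim/(@lmq_ind _ apres)=> y; elim/(@lmq_ind _ apres)=> z.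
by rewrite -lmpiD !zmulE -lmpiD; apply/(@lmpiP _ apres)/a_mulDr.
Qed.

HB.instance Definition _ :=
  GRing.Zmodule_isPzRing.Build zigzag mulA mul1 mulr1 mulDl mulDr.

Lemma zscaleAl (a : R) (x y : zigzag) : (a *: x) * y = a *: (x * y).
Proof.
elim/(@lmq_ind _ apres): x => x; elim/(@lmq_ind _ apres): y => y.
by rewrite -lmpiZ [LHS]zmulE [X in _ *: X]zmulE -lmpiZ; apply/(@lmpiP _ apres)/a_mulZl.
Qed.

Lemma zscaleAr (a : R) (x y : zigzag) : x * (a *: y) = a *: (x * y).
Proof.
elim/(@lmq_ind _ apres): x => x; elim/(@lmq_ind _ apres): y => y.
by rewrite -lmpiZ [LHS]zmulE [X in _ *: X]zmulE -lmpiZ; apply/(@lmpiP _ apres)/a_mulZr.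
Qed.

Definition zgen (g : qgen) : zigzag := lmpi (P := apres) (Agen R g).
Definition ze (j : nat) : zigzag := zgen (Qvtx j).
Definition za (j k : nat) : zigzag := zgen (Qarr j k).
Definition zi (j : nat) : zigzag := zgen (Qloop j).
Definition zX (j : nat) : zigzag :=
  if j == 1%N then za 1 2 * za 2 1 else za j j.-1 * za j.-1 j.

Lemma zeK j : ze j * ze j = ze j.
Proof. by rewrite [LHS]zmulE; apply/(@lmpiP _ apres)/r_vtx_idem. Qed.

Lemma ze_zi j : ze j * zi j = zi j.
Proof. by rewrite [LHS]zmulE; apply/(@lmpiP _ apres)/r_loop_src. Qed.

Lemma zi_ze j : zi j * ze j = zi j.
Proof. by rewrite [LHS]zmulE; apply/(@lmpiP _ apres)/r_loop_tgt. Qed.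

(* The homogeneous parts for the path-length grading. *)
Inductive zdeg : int -> zigzag -> Prop :=
  | zdeg0 d : zdeg d 0
  | zdegD d x y : zdeg d x -> zdeg d y -> zdeg d (x + y)
  | zdegZ d a x : zdeg d x -> zdeg d (a *: x)
  | zdegM d d' x y : zdeg d x -> zdeg d' y -> zdeg (d + d') (x * y)
  | zdeg_1 : zdeg 0 1
  | zdeg_e j : zdeg 0 (ze j)
  | zdeg_i j : zdeg 0 (zi j)
  | zdeg_a j k : zdeg 1 (za j k).

End Zigzag.

(* The tensor product over K, for right and left actions rK and lK of K.      *)
Section TensorTerms.
Variables (R : pzRingType) (K : Type) (M N : lmodType R).
Variables (rK : M -> K -> M) (lK : K -> N -> N).

Inductive tterm := Tzero | Tpure of M & N | Tadd of tterm & tterm | Tscale of R & tterm.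

Reserved Notation "x ≈ y" (at level 70).
Inductive teq : tterm -> tterm -> Prop :=
  | t_refl x : x ≈ x
  | t_sym x y : x ≈ y -> y ≈ x
  | t_trans x y z : x ≈ y -> y ≈ z -> x ≈ z
  | t_add x x' y y' : x ≈ x' -> y ≈ y' -> Tadd x y ≈ Tadd x' y'
  | t_scale a x x' : x ≈ x' -> Tscale a x ≈ Tscale a x'
  | t_addA x y z : Tadd x (Tadd y z) ≈ Tadd (Tadd x y) z
  | t_addC x y : Tadd x y ≈ Tadd y x
  | t_add0 x : Tadd Tzero x ≈ x
  | t_scaleA a b x : Tscale a (Tscale b x) ≈ Tscale (a * b) x
  | t_scale1 x : Tscale 1 x ≈ x
  | t_scaleDr a x y : Tscale a (Tadd x y) ≈ Tadd (Tscale a x) (Tscale a y)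
  | t_scaleDl a b x : Tscale (a + b) x ≈ Tadd (Tscale a x) (Tscale b x)
  | t_scale0 x : Tscale 0 x ≈ Tzero
  | t_Dl m m' n : Tpure (m + m') n ≈ Tadd (Tpure m n) (Tpure m' n)
  | t_Dr m n n' : Tpure m (n + n') ≈ Tadd (Tpure m n) (Tpure m n')
  | t_Zl a m n : Tpure (a *: m) n ≈ Tscale a (Tpure m n)
  | t_Zr a m n : Tpure m (a *: n) ≈ Tscale a (Tpure m n)
  | t_bal m k n : Tpure (rK m k) n ≈ Tpure m (lK k n)
where "x ≈ y" := (teq x y).

Definition tpres : lmpres R :=
  @LMPres R tterm teq Tzero Tadd Tscale
    t_refl t_sym t_trans t_add t_scale t_addA t_addC t_add0 t_scaleA t_scale1
    t_scaleDr t_scaleDl t_scale0.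

Definition tensor : Type := lmq tpres.
HB.instance Definition _ := GRing.Lmodule.on tensor.

Definition tpure (m : M) (n : N) : tensor := lmpi (P := tpres) (Tpure m n).

Lemma tpureDl m m' n : tpure (m + m') n = tpure m n + tpure m' n.
Proof. by rewrite /tpure -lmpiD; apply/(@lmpiP _ tpres)/t_Dl. Qed.
Lemma tpureDr m n n' : tpure m (n + n') = tpure m n + tpure m n'.
Proof. by rewrite /tpure -lmpiD; apply/(@lmpiP _ tpres)/t_Dr. Qed.
Lemma tpureZl a m n : tpure (a *: m) n = a *: tpure m n.
Proof. by rewrite /tpure -lmpiZ; apply/(@lmpiP _ tpres)/t_Zl. Qed.
Lemma tpureZr a m n : tpure m (a *: n) = a *: tpure m n.
Proof. by rewrite /tpure -lmpiZ; apply/(@lmpiP _ tpres)/t_Zr. Qed.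
Lemma tpure_bal m k n : tpure (rK m k) n = tpure m (lK k n).
Proof. by apply/(@lmpiP _ tpres)/t_bal. Qed.

Lemma tensor_ind (Q : tensor -> Prop) :
  (forall m n, Q (tpure m n)) -> (forall x y, Q x -> Q y -> Q (x + y)) ->
  forall x, Q x.
Proof.
move=> Qp QD; suff QZ x a : Q (a *: x) by move=> x; rewrite -[x]scale1r.
elim/(@lmq_ind _ tpres): x a; elim=> [|m n|x IHx y IHy|b x IHx] a.
- rewrite -/(lmpi (P := tpres) (pzero tpres)) lmpi0 scaler0.
  by rewrite -(scale0r (tpure 0 0)) -tpureZl.
- by rewrite -/(tpure m n) -tpureZl.
- by rewrite (lmpiD (P := tpres)) scalerDr; apply: QD.
- by rewrite (lmpiZ (P := tpres)) scalerA.
Qed.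

Section Lift.
Variables (V : lmodType R) (h : M -> N -> V).

Record balanced : Prop := Balanced {
  bal_Dl : forall m m' n, h (m + m') n = h m n + h m' n;
  bal_Dr : forall m n n', h m (n + n') = h m n + h m n';
  bal_Zl : forall a m n, h (a *: m) n = a *: h m n;
  bal_Zr : forall a m n, h m (a *: n) = a *: h m n;
  bal_K : forall m k n, h (rK m k) n = h m (lK k n) }.

Fixpoint teval (x : tterm) : V :=
  match x with
  | Tzero => 0
  | Tpure m n => h m n
  | Tadd x y => teval x + teval y
  | Tscale a x => a *: teval x
  end.

(* The linear map with tpure m n |-> h m n; meaningful when h is balanced.    *)
Definition tlift (x : tensor) : V := teval (lmrepr (P := tpres) x).

Hypothesis hP : balanced.

Lemma teval_eq x y : teq x y -> teval x = teval y.
Proof.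
elim=> //=; try by move=> *; congruence.
- by move=> *; rewrite addrA.
- by move=> *; rewrite addrC.
- by move=> *; rewrite add0r.
- by move=> *; rewrite scalerA.
- by move=> *; rewrite scale1r.
- by move=> *; rewrite scalerDr.
- by move=> *; rewrite scalerDl.
- by move=> *; rewrite scale0r.
- exact: bal_Dl.
- exact: bal_Dr.
- exact: bal_Zl.
- exact: bal_Zr.
- exact: bal_K.
Qed.

Lemma tlift_pi x : tlift (lmpi (P := tpres) x) = teval x.
Proof. exact/teval_eq/(@lmreprK _ tpres). Qed.

Lemma tliftE m n : tlift (tpure m n) = h m n.
Proof. by rewrite tlift_pi. Qed.

Lemma tliftD x y : tlift (x + y) = tlift x + tlift y.
Proof.
elim/(@lmq_ind _ tpres): x => x; elim/(@lmq_ind _ tpres): y => y.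
by rewrite -lmpiD !tlift_pi.
Qed.

Lemma tliftZ a x : tlift (a *: x) = a *: tlift x.
Proof. by elim/(@lmq_ind _ tpres): x => x; rewrite -lmpiZ !tlift_pi. Qed.

End Lift.
End TensorTerms.

Arguments tlift {R K M N rK lK V}.
Arguments tpure {R K M N rK lK}.

Section Bimodules.
Variables (R : realType) (n : nat).
Local Notation A := (zigzag R n).

Record is_lact (M : lmodType R) (act : A -> M -> M) : Prop := IsLact {
  lactDl : forall a b x, act (a + b) x = act a x + act b x;
  lactDr : forall a x y, act a (x + y) = act a x + act a y;
  lactZl : forall c a x, act (c *: a) x = c *: act a x;
  lactZr : forall c a x, act a (c *: x) = c *: act a x;
  lactM : forall a b x, act (a * b) x = act a (act b x);
  lact1 : forall x, act 1 x = x }.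

Record is_ract (M : lmodType R) (act : M -> A -> M) : Prop := IsRact {
  ractDl : forall x y a, act (x + y) a = act x a + act y a;
  ractDr : forall x a b, act x (a + b) = act x a + act x b;
  ractZl : forall c x a, act (c *: x) a = c *: act x a;
  ractZr : forall c x a, act x (c *: a) = c *: act x a;
  ractM : forall x a b, act x (a * b) = act (act x a) b;
  ract1 : forall x, act x 1 = x }.

Lemma lact0 (M : lmodType R) (act : A -> M -> M) : is_lact act -> forall a, act a 0 = 0.
Proof. by move=> actP a; rewrite -{1}(scale0r (0 : M)) lactZr // scale0r. Qed.
Lemma ract0 (M : lmodType R) (act : M -> A -> M) : is_ract act -> forall a, act 0 a = 0.
Proof. by move=> actP a; rewrite -{1}(scale0r (0 : M)) ractZl // scale0r. Qed.

(* bdeg d is the homogeneous part of degree d.  That the parts are in direct  *)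
(* sum and span is not made an axiom: it holds for the regular bimodule and   *)
(* the U_j, and is inherited by all the objects of the category built below.  *)
Record gbimod := GBimod {
  bcar :> lmodType R;
  bl : A -> bcar -> bcar;
  br : bcar -> A -> bcar;
  bdeg : int -> bcar -> Prop;
  blP : is_lact bl;
  brP : is_ract br;
  blr : forall a x b, br (bl a x) b = bl a (br x b);
  bdeg0 : forall d, bdeg d 0;
  bdegD : forall d x y, bdeg d x -> bdeg d y -> bdeg d (x + y);
  bdegZ : forall d c x, bdeg d x -> bdeg d (c *: x);
  bdegl : forall i j a x, zdeg i a -> bdeg j x -> bdeg (i + j) (bl a x);
  bdegr : forall i j x a, bdeg i x -> zdeg j a -> bdeg (i + j) (br x a) }.

Lemma lact_mul : is_lact (fun a x : A => a * x).
Proof.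
split=> *; rewrite ?mulrDl ?mulrDr ?zscaleAl ?zscaleAr ?mulrA ?mul1r //.
Qed.
Lemma ract_mul : is_ract (fun x a : A => x * a).
Proof.
split=> *; rewrite ?mulrDl ?mulrDr ?zscaleAl ?zscaleAr ?mulrA ?mulr1 //.
Qed.

Definition bregular : gbimod.
Proof.
refine (@GBimod A (fun a x => a * x) (fun x a => x * a) (@zdeg R n)
  lact_mul ract_mul _ _ _ _ _ _).
- by move=> a x b; rewrite mulrA.
- exact: zdeg0.
- exact: zdegD.
- exact: zdegZ.
- exact: zdegM.
- exact: zdegM.
Defined.

Definition bshift (k : int) (M : gbimod) : gbimod.
Proof.
refine (@GBimod M (@bl M) (@br M) (fun d => bdeg (d + k)) (blP M) (brP M) (@blr M)
  _ _ _ _ _).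
- by move=> d; apply: bdeg0.
- by move=> d x y; apply: bdegD.
- by move=> d c x; apply: bdegZ.
- by move=> i j a x ia jx; rewrite -addrA; apply: bdegl.
- by move=> i j x a ix ja; rewrite addrAC; apply: bdegr.
Defined.

Definition bzero : gbimod.
Proof.
refine (@GBimod 'rV[R]_0 (fun _ x => x) (fun x _ => x) (fun _ _ => True)
  _ _ _ _ _ _ _ _) => //.
- by split=> * //; apply/rowP=> - [].
- by split=> * //; apply/rowP=> - [].
Defined.

Definition bsum (M N : gbimod) : gbimod.
Proof.
refine (@GBimod (M * N)%type (fun a x => (bl a x.1, bl a x.2))
  (fun x a => (br x.1 a, br x.2 a)) (fun d x => bdeg d x.1 /\ bdeg d x.2)
  _ _ _ _ _ _ _ _).
- by case: (blP M) => *; case: (blP N) => *; split=> *;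
  apply: injective_projections => /=; auto.
- by case: (brP M) => *; case: (brP N) => *; split=> *;
  apply: injective_projections => /=; auto.
- by move=> a x b /=; rewrite !blr.
- by move=> d; split; apply: bdeg0.
- by move=> d x y [? ?] [? ?]; split; apply: bdegD.
- by move=> d c x [? ?]; split; apply: bdegZ.
- by move=> i j a x ia [? ?]; split; apply: bdegl.
- by move=> i j x a [? ?] ja; split; apply: bdegr.
Defined.

(* The bimodule structure on a balanced tensor product of a left module M and *)
(* a right module N.                                                           *)
Section TensorBimodule.
Variables (K : Type) (M N : lmodType R).
Variables (rK : M -> K -> M) (lK : K -> N -> N).
Variables (la : A -> M -> M) (ra : N -> A -> N).
Variables (degM : int -> M -> Prop) (degN : int -> N -> Prop).
Hypotheses (laP : is_lact la) (raP : is_ract ra).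
Hypothesis (la_K : forall a m k, la a (rK m k) = rK (la a m) k).
Hypothesis (ra_K : forall k n a, ra (lK k n) a = lK k (ra n a)).
Hypothesis degl : forall i j a x, zdeg i a -> degM j x -> degM (i + j) (la a x).
Hypothesis degr : forall i j x a, degN i x -> zdeg j a -> degN (i + j) (ra x a).
Local Notation T := (tensor rK lK).

Inductive tdeg : int -> T -> Prop :=
  | tdeg0 d : tdeg d 0
  | tdegD d x y : tdeg d x -> tdeg d y -> tdeg d (x + y)
  | tdegZ d c x : tdeg d x -> tdeg d (c *: x)
  | tdeg_pure i j m p : degM i m -> degN j p -> tdeg (i + j) (tpure m p).

Definition tla (a : A) : T -> T := tlift (fun m p => tpure (la a m) p).
Definition tra (x : T) (a : A) : T := tlift (fun m p => tpure m (ra p a)) x.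

Let bla a : balanced rK lK (fun m p => tpure (la a m) p : T).
Proof.
split.
- by move=> m m' p; rewrite lactDr // tpureDl.
- by move=> m p p'; rewrite tpureDr.
- by move=> c m p; rewrite lactZr // tpureZl.
- by move=> c m p; rewrite tpureZr.
- by move=> m k p; rewrite la_K tpure_bal.
Qed.

Let bra a : balanced rK lK (fun m p => tpure m (ra p a) : T).
Proof.
split.
- by move=> m m' p; rewrite tpureDl.
- by move=> m p p'; rewrite ractDl // tpureDr.
- by move=> c m p; rewrite tpureZl.
- by move=> c m p; rewrite ractZl // tpureZr.
- by move=> m k p; rewrite tpure_bal ra_K.
Qed.

Lemma tlaE a m p : tla a (tpure m p) = tpure (la a m) p.
Proof. by rewrite /tla tliftE. Qed.

Lemma traE a m p : tra (tpure m p) a = tpure m (ra p a).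
Proof. by rewrite /tra tliftE. Qed.

Let tlaD a x y : tla a (x + y) = tla a x + tla a y.
Proof. by rewrite /tla tliftD. Qed.
Let traD x y a : tra (x + y) a = tra x a + tra y a.
Proof. by rewrite /tra tliftD. Qed.
Let tlaZ a c x : tla a (c *: x) = c *: tla a x.
Proof. by rewrite /tla tliftZ. Qed.
Let traZ c x a : tra (c *: x) a = c *: tra x a.
Proof. by rewrite /tra tliftZ. Qed.

Lemma tlaP : is_lact tla.
Proof.
split=> //.
- move=> a b; elim/tensor_ind=> [m p|x y IHx IHy].
    by rewrite !tlaE -tpureDl lactDl.
  by rewrite !tlaD IHx IHy addrACA.
- move=> c a; elim/tensor_ind=> [m p|x y IHx IHy].
    by rewrite !tlaE -tpureZl lactZl.
  by rewrite !tlaD IHx IHy scalerDr.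
- move=> a b; elim/tensor_ind=> [m p|x y IHx IHy].
    by rewrite !tlaE lactM.
  by rewrite !tlaD IHx IHy.
- elim/tensor_ind=> [m p|x y IHx IHy]; first by rewrite tlaE lact1.
  by rewrite tlaD IHx IHy.
Qed.

Lemma traP : is_ract tra.
Proof.
split=> //.
- move=> x a b; elim/tensor_ind: x => [m p|x y IHx IHy].
    by rewrite !traE -tpureDr ractDr.
  by rewrite !traD IHx IHy addrACA.
- move=> c x a; elim/tensor_ind: x => [m p|x y IHx IHy].
    by rewrite !traE -tpureZr ractZr.
  by rewrite !traD IHx IHy scalerDr.
- move=> x a b; elim/tensor_ind: x => [m p|x y IHx IHy].
    by rewrite !traE ractM.
  by rewrite !traD IHx IHy.
- elim/tensor_ind=> [m p|x y IHx IHy]; first by rewrite traE ract1.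
  by rewrite traD IHx IHy.
Qed.

Lemma tlra a x b : tra (tla a x) b = tla a (tra x b).
Proof.
elim/tensor_ind: x => [m p|x y IHx IHy]; first by rewrite tlaE !traE tlaE.
by rewrite tlaD !traD tlaD IHx IHy.
Qed.

Lemma tdegl i j a x : zdeg i a -> tdeg j x -> tdeg (i + j) (tla a x).
Proof.
move=> ia; elim=> [d|d y z _ IHy _ IHz|d c y _ IHy|i' j' m p im jp].
- by rewrite -(scale0r (0 : T)) tlaZ scale0r; apply: tdeg0.
- by rewrite tlaD; apply: tdegD.
- by rewrite tlaZ; apply: tdegZ.
- by rewrite tlaE addrA; apply: tdeg_pure => //; apply: degl.
Qed.

Lemma tdegr i j x a : tdeg i x -> zdeg j a -> tdeg (i + j) (tra x a).
Proof.
move=> + ja; elim=> [d|d y z _ IHy _ IHz|d c y _ IHy|i' j' m p im jp].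
- by rewrite -(scale0r (0 : T)) traZ scale0r; apply: tdeg0.
- by rewrite traD; apply: tdegD.
- by rewrite traZ; apply: tdegZ.
- by rewrite traE -addrA; apply: tdeg_pure => //; apply: degr.
Qed.

Definition btensK : gbimod :=
  @GBimod T tla tra tdeg tlaP traP tlra tdeg0 tdegD tdegZ tdegl tdegr.

End TensorBimodule.

Definition btens (M N : gbimod) : gbimod :=
  @btensK A M N (@br M) (@bl N) (@bl M) (@br N) (@bdeg M) (@bdeg N)
    (blP M) (brP N) (fun a m k => esym (blr a m k)) (fun k p a => blr k p a)
    (@bdegl M) (@bdegr N).

Definition inP (j : nat) : pred A := fun x => `[< exists a, x = a * ze R n j >].
Definition inPr (j : nat) : pred A := fun x => `[< exists a, x = ze R n j * a >].

Fact inP_submod j : submod_closed (inP j).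
Proof.
split=> [|c x y /asboolP[a ->] /asboolP[b ->]]; apply/asboolP.
  by exists 0; rewrite mul0r.
by exists (c *: a + b); rewrite mulrDl zscaleAl.
Qed.
Fact inPr_submod j : submod_closed (inPr j).
Proof.
split=> [|c x y /asboolP[a ->] /asboolP[b ->]]; apply/asboolP.
  by exists 0; rewrite mulr0.
by exists (c *: a + b); rewrite mulrDr zscaleAr.
Qed.
HB.instance Definition _ j := GRing.isSubmodClosed.Build R A (inP j) (inP_submod j).
HB.instance Definition _ j := GRing.isSubmodClosed.Build R A (inPr j) (inPr_submod j).

Record projL (j : nat) := ProjL { projL_val : A; _ : inP j projL_val }.
Record projR (j : nat) := ProjR { projR_val : A; _ : inPr j projR_val }.

HB.instance Definition _ j := [isSub for @projL_val j].
HB.instance Definition _ j := [Choice of projL j by <:].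
HB.instance Definition _ j := [SubChoice_isSubLmodule of projL j by <:].
HB.instance Definition _ j := [isSub for @projR_val j].
HB.instance Definition _ j := [Choice of projR j by <:].
HB.instance Definition _ j := [SubChoice_isSubLmodule of projR j by <:].

Fact pl_subproof j a : inP j (a * ze R n j). Proof. by apply/asboolP; exists a. Qed.
Fact pr_subproof j a : inPr j (ze R n j * a). Proof. by apply/asboolP; exists a. Qed.

(* [pl j a] is a, read in P_j = B_n e_j: for a in B_n e_j it is a itself.     *)
Definition pl j (a : A) : projL j := ProjL (pl_subproof j a).
Definition pr j (a : A) : projR j := ProjR (pr_subproof j a).

(* F_1 = R and F_j = C for j >= 2, embedded in e_j B_n e_j. *)
Definition Fld (j : nat) : Type := if j == 1%N then R : Type else R[i].
Definition Femb (j : nat) : Fld j -> A :=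
  if j == 1%N as b return ((if b then R : Type else R[i]) -> A)
  then fun c => c *: ze R n j
  else fun z => complex.Re z *: ze R n j + complex.Im z *: zi R n j.

Lemma Femb_l j k : ze R n j * @Femb j k = @Femb j k.
Proof.
by rewrite /Femb /Fld in k *; case: (j == 1%N) k => k;
  rewrite ?mulrDr !zscaleAr zeK ?ze_zi.
Qed.
Lemma Femb_r j k : @Femb j k * ze R n j = @Femb j k.
Proof.
by rewrite /Femb /Fld in k *; case: (j == 1%N) k => k;
  rewrite ?mulrDl !zscaleAl zeK ?zi_ze.
Qed.

Definition projL_act j (a : A) (x : projL j) : projL j := pl j (a * projL_val x).
Definition projL_F j (x : projL j) (k : Fld j) : projL j := pl j (projL_val x * Femb k).
Definition projR_act j (x : projR j) (a : A) : projR j := pr j (projR_val x * a).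
Definition projR_F j (k : Fld j) (x : projR j) : projR j := pr j (Femb k * projR_val x).

Lemma projL_e j (x : projL j) : projL_val x * ze R n j = projL_val x.
Proof. by case: x => x /= /asboolP[a ->]; rewrite -mulrA zeK. Qed.
Lemma projR_e j (x : projR j) : ze R n j * projR_val x = projR_val x.
Proof. by case: x => x /= /asboolP[a ->]; rewrite mulrA zeK. Qed.
Lemma projL_actE j a (x : projL j) : projL_val (projL_act a x) = a * projL_val x.
Proof. by rewrite /= -mulrA projL_e. Qed.
Lemma projR_actE j (x : projR j) a : projR_val (projR_act x a) = projR_val x * a.
Proof. by rewrite /= mulrA projR_e. Qed.
Lemma projL_FE j (x : projL j) (k : Fld j) : projL_val (projL_F x k) = projL_val x * Femb k.
Proof. by rewrite /= -mulrA Femb_r. Qed.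
Lemma projR_FE j (k : Fld j) (x : projR j) : projR_val (projR_F k x) = Femb k * projR_val x.
Proof. by rewrite /= mulrA Femb_l. Qed.

Lemma projL_inj j : injective (@projL_val j). Proof. exact: val_inj. Qed.
Lemma projR_inj j : injective (@projR_val j). Proof. exact: val_inj. Qed.
Lemma projL_D j (x y : projL j) : projL_val (x + y) = projL_val x + projL_val y.
Proof. by []. Qed.
Lemma projR_D j (x y : projR j) : projR_val (x + y) = projR_val x + projR_val y.
Proof. by []. Qed.
Lemma projL_Z j c (x : projL j) : projL_val (c *: x) = c *: projL_val x.
Proof. by []. Qed.
Lemma projR_Z j c (x : projR j) : projR_val (c *: x) = c *: projR_val x.
Proof. by []. Qed.

Lemma projL_actP j : is_lact (@projL_act j).
Proof.
split=> *; apply: projL_inj; rewrite ?(projL_D, projL_Z, projL_actE).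
- by rewrite mulrDl.
- by rewrite mulrDr.
- by rewrite zscaleAl.
- by rewrite zscaleAr.
- by rewrite mulrA.
- by rewrite mul1r.
Qed.

Lemma projR_actP j : is_ract (@projR_act j).
Proof.
split=> *; apply: projR_inj; rewrite ?(projR_D, projR_Z, projR_actE).
- by rewrite mulrDl.
- by rewrite mulrDr.
- by rewrite zscaleAl.
- by rewrite zscaleAr.
- by rewrite mulrA.
- by rewrite mulr1.
Qed.

Lemma projL_act_F j a (x : projL j) k : projL_act a (projL_F x k) = projL_F (projL_act a x) k.
Proof. by apply: projL_inj; rewrite !(projL_actE, projL_FE) mulrA. Qed.
Lemma projR_act_F j k (x : projR j) a : projR_act (projR_F k x) a = projR_F k (projR_act x a).
Proof. by apply: projR_inj; rewrite !(projR_actE, projR_FE) mulrA. Qed.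

Definition projL_deg j (d : int) (x : projL j) : Prop := zdeg d (projL_val x).
Definition projR_deg j (d : int) (x : projR j) : Prop := zdeg d (projR_val x).

Lemma projL_degl j i d a (x : projL j) :
  zdeg i a -> projL_deg d x -> projL_deg (i + d) (projL_act a x).
Proof. by rewrite /projL_deg projL_actE; apply: zdegM. Qed.
Lemma projR_degr j d i (x : projR j) a :
  projR_deg d x -> zdeg i a -> projR_deg (d + i) (projR_act x a).
Proof. by rewrite /projR_deg projR_actE; apply: zdegM. Qed.

(* U_j = P_j (x)_{F_j} jP (1) *)
Definition bU (j : nat) : gbimod :=
  bshift 1 (btensK (@projL_actP j) (@projR_actP j) (@projL_act_F j) (@projR_act_F j)
              (@projL_degl j) (@projR_degr j)).

(* [u_ j a b] is the element a (x) b of U_j, for a in P_j and b in jP. *)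
Definition u_ (j : nat) (a b : A) : bU j := tpure (pl j a) (pr j b).

Implicit Types M N P Q : gbimod.

Record is_bihom (M N : gbimod) (f : M -> N) : Prop := IsBihom {
  biD : forall x y, f (x + y) = f x + f y;
  biZ : forall c x, f (c *: x) = c *: f x;
  bil : forall a x, f (bl a x) = bl a (f x);
  bir : forall x a, f (br x a) = br (f x) a }.

Definition of_degree (M N : gbimod) (d : int) (f : M -> N) : Prop :=
  forall k x, bdeg k x -> bdeg (k + d) (f x).

Inductive ghom (M N : gbimod) : (M -> N) -> Prop :=
  | ghom_homog d f : is_bihom f -> of_degree d f -> ghom f
  | ghom_add f g : ghom f -> ghom g -> ghom (f + g).

Lemma ghomP M N (f : M -> N) : ghom f -> is_bihom f.
Proof.
elim=> // {}f g _ [fD fZ fl fr] _ [gD gZ gl gr].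
split=> [x y|c x|a x|x a]; rewrite !addrfctE.
- by rewrite fD gD addrACA.
- by rewrite fZ gZ scalerDr.
- by rewrite fl gl (lactDr (blP N)).
- by rewrite fr gr (ractDl (brP N)).
Qed.

Lemma ghom_zero M N : ghom (0 : M -> N).
Proof.
apply: (@ghom_homog _ _ 0); last by move=> k x _; apply: bdeg0.
split=> [x y|c x|a x|x a]; first by rewrite -[RHS]/(0 + 0 : N) addr0.
- by rewrite -[RHS]/(c *: (0 : N)) scaler0.
- by rewrite -[RHS]/(bl a (0 : N)) (lact0 (blP N)).
- by rewrite -[RHS]/(br (0 : N) a) (ract0 (brP N)).
Qed.

Lemma ghom_scale M N c (f : M -> N) : ghom f -> ghom (c *: f).
Proof.
elim=> [d {}f [fD fZ fl fr] df|{}f g _ IHf _ IHg]; last first.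
  by rewrite scalerDr; apply: ghom_add.
apply: (@ghom_homog _ _ d); last by move=> k x kx; apply: bdegZ; apply: df.
split=> [x y|b x|a x|x a]; rewrite !scalrfctE.
- by rewrite fD scalerDr.
- by rewrite fZ !scalerA mulrC.
- by rewrite fl (lactZr (blP N)).
- by rewrite fr (ractZl (brP N)).
Qed.

Definition ghomb (M N : gbimod) : pred (M -> N) := fun f => `[< ghom f >].
Fact ghomb_submod M N : submod_closed (@ghomb M N).
Proof.
split=> [|c f g /asboolP fP /asboolP gP]; apply/asboolP; first exact: ghom_zero.
by apply: ghom_add => //; apply: ghom_scale.
Qed.
HB.instance Definition _ M N :=
  GRing.isSubmodClosed.Build R (M -> N) (@ghomb M N) (@ghomb_submod M N).

Record bhom (M N : gbimod) := BHom { bfun :> M -> N; _ : ghomb bfun }.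
HB.instance Definition _ M N := [isSub for @bfun M N].
HB.instance Definition _ M N := [Choice of bhom M N by <:].
HB.instance Definition _ M N := [SubChoice_isSubLmodule of bhom M N by <:].

Lemma bhomP M N (f : bhom M N) : ghom f. Proof. by case: f => f /= /asboolP. Qed.
Lemma bhom_bi M N (f : bhom M N) : is_bihom f. Proof. exact/ghomP/bhomP. Qed.
Lemma bhom_ext M N (f g : bhom M N) : (forall x, f x = g x) -> f = g.
Proof. by move=> fg; apply: val_inj; apply/funext. Qed.
Lemma bhom_addE M N (f g : bhom M N) x : (f + g) x = f x + g x. Proof. by []. Qed.
Lemma bhom_scaleE M N c (f : bhom M N) x : (c *: f) x = c *: f x. Proof. by []. Qed.

Definition mkhom M N (f : M -> N) (fP : ghom f) : bhom M N := BHom (introT (asboolP _) fP).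

Lemma ghom_id M : ghom (@id M).
Proof. by apply: (@ghom_homog _ _ 0) => // k x; rewrite addr0. Qed.

Lemma ghom_comp M N P (g : N -> P) (f : M -> N) : ghom g -> ghom f -> ghom (g \o f).
Proof.
move=> gP fP; have gB := ghomP gP; elim: fP => [d {}f fB df|{}f f' _ IHf _ IHf'].
  elim: gP {gB} => [e {}g gB dg|{}g g' _ IHg _ IHg']; last exact: ghom_add IHg IHg'.
  apply: (@ghom_homog _ _ (d + e)).
    case: fB gB => fD fZ fl fr [gD gZ gl gr].
    by split=> * /=; rewrite ?(fD, fZ, fl, fr) ?(gD, gZ, gl, gr).
  by move=> k x kx; rewrite addrA; apply/dg/df.
suff -> : g \o (f + f') = (g \o f) + (g \o f') by apply: ghom_add.
by apply/funext => x /=; rewrite addrfctE (biD gB).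
Qed.

Definition bid M : bhom M M := mkhom (@ghom_id M).
Definition bcomp M N P (g : bhom N P) (f : bhom M N) : bhom M P :=
  mkhom (ghom_comp (bhomP g) (bhomP f)).

Section TensorMaps.
Variables (M M' N N' : gbimod).

Definition tmapf (f : M -> N) (g : M' -> N') : btens M M' -> btens N N' :=
  tlift (fun m p => tpure (f m) (g p)).

Lemma tmapf_bal f g : is_bihom f -> is_bihom g ->
  balanced (@br M) (@bl M') (fun m p => tpure (f m) (g p) : btens N N').
Proof.
move=> [fD fZ fl fr] [gD gZ gl gr]; split=> *.
- by rewrite fD tpureDl.
- by rewrite gD tpureDr.
- by rewrite fZ tpureZl.
- by rewrite gZ tpureZr.
- by rewrite fr tpure_bal gl.
Qed.

Lemma tmapfE f g m p : is_bihom f -> is_bihom g ->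
  tmapf f g (tpure m p) = tpure (f m) (g p).
Proof. by move=> fB gB; rewrite /tmapf (tliftE (tmapf_bal fB gB)). Qed.

Lemma tmapfD f g x y : is_bihom f -> is_bihom g ->
  tmapf f g (x + y) = tmapf f g x + tmapf f g y.
Proof. by move=> fB gB; rewrite /tmapf (tliftD (tmapf_bal fB gB)). Qed.

Lemma tmapfZ f g c x : is_bihom f -> is_bihom g ->
  tmapf f g (c *: x) = c *: tmapf f g x.
Proof. by move=> fB gB; rewrite /tmapf (tliftZ (tmapf_bal fB gB)). Qed.

End TensorMaps.

Lemma bl_pure (M N : gbimod) a m p :
  bl a (tpure m p : btens M N) = tpure (bl a m) p :> btens M N.
Proof. by apply: tlaE; [exact: blP|move=> *; rewrite blr]. Qed.

Lemma br_pure (M N : gbimod) m p a :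
  br (tpure m p : btens M N) a = tpure m (br p a) :> btens M N.
Proof. by apply: traE; [exact: brP|move=> *; rewrite blr]. Qed.

(* A biadditive map out of a tensor product is a homogeneous bimodule map as  *)
(* soon as it is so on pure tensors.                                          *)
Lemma bihom_tens (M N P : gbimod) (f : btens M N -> P) :
  (forall x y, f (x + y) = f x + f y) -> (forall c x, f (c *: x) = c *: f x) ->
  (forall a m p, f (tpure (bl a m) p) = bl a (f (tpure m p))) ->
  (forall m p a, f (tpure m (br p a)) = br (f (tpure m p)) a) -> is_bihom f.
Proof.
move=> fD fZ fl fr; split=> // [a x|x a]; elim/tensor_ind: x => [m p|x y IHx IHy].
- by rewrite bl_pure fl.
- by rewrite (lactDr (blP _)) !fD IHx IHy (lactDr (blP _)).
- by rewrite br_pure fr.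
- by rewrite (ractDl (brP _)) !fD IHx IHy (ractDl (brP _)).
Qed.

Lemma degree_tens (M N P : gbimod) d (f : btens M N -> P) : is_bihom f ->
  (forall i j m p, bdeg i m -> bdeg j p -> bdeg (i + j + d) (f (tpure m p))) ->
  of_degree d f.
Proof.
move=> [fD fZ _ _] fdeg k x; elim=> [e|e y z _ IHy _ IHz|e c y _ IHy|i j m p im jp].
- by rewrite -(scale0r (0 : btens M N)) fZ scale0r; apply: bdeg0.
- by rewrite fD; apply: bdegD.
- by rewrite fZ; apply: bdegZ.
- exact: fdeg.
Qed.

Lemma ghom_tmap M M' N N' (f : M -> N) (g : M' -> N') :
  ghom f -> ghom g -> ghom (tmapf f g).
Proof.
move=> fP gP; have fB := ghomP fP.
elim: gP => [e {}g gB dg|{}g g' gP IHg gP' IHg']; last first.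
  suff -> : tmapf f (g + g') = tmapf f g + tmapf f g' by apply: ghom_add.
  apply/funext=> x; rewrite -[RHS]/(tmapf f g x + tmapf f g' x).
  have gB := ghomP gP; have gB' := ghomP gP'; have gB2 := ghomP (ghom_add gP gP').
  elim/tensor_ind: x => [m p|x y IHx IHy]; first by rewrite !tmapfE //; apply: tpureDr.
  by rewrite !tmapfD // IHx IHy addrACA.
elim: fP {fB} => [d {}f fB df|{}f f' fP IHf fP' IHf']; last first.
  suff -> : tmapf (f + f') g = tmapf f g + tmapf f' g by apply: ghom_add.
  apply/funext=> x; rewrite -[RHS]/(tmapf f g x + tmapf f' g x).
  have fB := ghomP fP; have fB' := ghomP fP'; have fB2 := ghomP (ghom_add fP fP').
  elim/tensor_ind: x => [m p|x y IHx IHy]; first by rewrite !tmapfE //; apply: tpureDl.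
  by rewrite !tmapfD // IHx IHy addrACA.
have tB : is_bihom (tmapf f g).
  apply: bihom_tens => *; rewrite ?tmapfD ?tmapfZ ?tmapfE //.
    by rewrite (bil fB) bl_pure.
  by rewrite (bir gB) br_pure.
apply: (@ghom_homog _ _ (d + e)) => //; apply: degree_tens => // i j m p im jp.
by rewrite tmapfE // addrACA; apply: tdeg_pure; [apply: df|apply: dg].
Qed.

Definition btmap M M' N N' (f : bhom M N) (g : bhom M' N') :
    bhom (btens M M') (btens N N') := mkhom (ghom_tmap (bhomP f) (bhomP g)).

Lemma btmapE M M' N N' (f : bhom M N) (g : bhom M' N') m p :
  btmap f g (tpure m p) = tpure (f m) (g p).
Proof. by rewrite /= tmapfE //; apply: bhom_bi. Qed.

Lemma bhom_tens_ext M N P (f g : bhom (btens M N) P) :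
  (forall m p, f (tpure m p) = g (tpure m p)) -> f = g.
Proof.
move=> fg; apply: bhom_ext; elim/tensor_ind=> [m p|x y IHx IHy]; first exact: fg.
by rewrite (biD (bhom_bi f)) (biD (bhom_bi g)) IHx IHy.
Qed.

Section Associator.
Variables M N P : gbimod.

Let h1 (p : P) (m : M) (q : N) : btens M (btens N P) := tpure m (tpure q p : btens N P).
Let h1P p : balanced (@br M) (@bl N) (h1 p).
Proof.
split=> *; rewrite /h1.
- exact: tpureDl.
- by rewrite -tpureDr -tpureDl.
- exact: tpureZl.
- by rewrite -tpureZr -tpureZl.
- by rewrite tpure_bal bl_pure.
Qed.
Let h2 (t : btens M N) (p : P) : btens M (btens N P) := tlift (h1 p) t.
Let h2E m q p : h2 (tpure m q) p = tpure m (tpure q p).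
Proof. exact: (tliftE (h1P p)). Qed.
Let h2Dl t t' p : h2 (t + t') p = h2 t p + h2 t' p.
Proof. exact: (tliftD (h1P p)). Qed.
Let h2Zl c t p : h2 (c *: t) p = c *: h2 t p.
Proof. exact: (tliftZ (h1P p)). Qed.
Let h2P : balanced (@br (btens M N)) (@bl P) h2.
Proof.
split=> //.
- elim/tensor_ind=> [m q|x y IHx IHy] p p'.
    by rewrite !h2E -tpureDr -tpureDr.
  by rewrite !h2Dl IHx IHy addrACA.
- move=> a; elim/tensor_ind=> [m q|x y IHx IHy] p.
    by rewrite !h2E -tpureZr -tpureZr.
  by rewrite !h2Dl IHx IHy scalerDr.
- elim/tensor_ind=> [m q|x y IHx IHy] a p.
    by rewrite br_pure !h2E tpure_bal.
  by rewrite (ractDl (brP _)) !h2Dl IHx IHy.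
Qed.

Definition assocf : btens (btens M N) P -> btens M (btens N P) := tlift h2.

Lemma assocfE m q p : assocf (tpure (tpure m q : btens M N) p) = tpure m (tpure q p : btens N P).
Proof. by rewrite /assocf (tliftE h2P) h2E. Qed.

Lemma ghom_assocf : ghom assocf.
Proof.
have fD x y : assocf (x + y) = assocf x + assocf y by exact: (tliftD h2P).
have fZ c x : assocf (c *: x) = c *: assocf x by exact: (tliftZ h2P).
have fE t p : assocf (tpure t p) = h2 t p by exact: (tliftE h2P).
have fB : is_bihom assocf.
  apply: bihom_tens => // [a t p|t p a]; rewrite !fE.
    elim/tensor_ind: t => [m q|x y IHx IHy]; first by rewrite bl_pure !h2E bl_pure.
    by rewrite (lactDr (blP _)) !h2Dl IHx IHy (lactDr (blP _)).
  elim/tensor_ind: t => [m q|x y IHx IHy]; first by rewrite !h2E !br_pure.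
  by rewrite !h2Dl IHx IHy (ractDl (brP _)).
apply: (@ghom_homog _ _ 0) => //; apply: degree_tens => // i j t p it jp.
rewrite addr0 fE; elim: it => [d|d x y _ IHx _ IHy|d c x _ IHx|i' j' m q im jq].
- by rewrite -(scale0r (0 : btens M N)) h2Zl scale0r; apply: bdeg0.
- by rewrite h2Dl; apply: bdegD.
- by rewrite h2Zl; apply: bdegZ.
- by rewrite h2E -addrA; apply: tdeg_pure => //; apply: tdeg_pure.
Qed.

Let g1 (m : M) (q : N) (p : P) : btens (btens M N) P := tpure (tpure m q : btens M N) p.
Let g1P m : balanced (@br N) (@bl P) (g1 m).
Proof.
split=> *; rewrite /g1.
- by rewrite -tpureDl -tpureDr.
- exact: tpureDr.
- by rewrite -tpureZl -tpureZr.
- exact: tpureZr.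
- by rewrite -tpure_bal br_pure.
Qed.
Let g2 (m : M) (t : btens N P) : btens (btens M N) P := tlift (g1 m) t.
Let g2E m q p : g2 m (tpure q p) = tpure (tpure m q) p.
Proof. exact: (tliftE (g1P m)). Qed.
Let g2Dr m t t' : g2 m (t + t') = g2 m t + g2 m t'.
Proof. exact: (tliftD (g1P m)). Qed.
Let g2Zr c m t : g2 m (c *: t) = c *: g2 m t.
Proof. exact: (tliftZ (g1P m)). Qed.
Let g2P : balanced (@br M) (@bl (btens N P)) g2.
Proof.
split=> //.
- move=> m m'; elim/tensor_ind=> [q p|x y IHx IHy].
    by rewrite !g2E -tpureDl -tpureDl.
  by rewrite !g2Dr IHx IHy addrACA.
- move=> a m; elim/tensor_ind=> [q p|x y IHx IHy].
    by rewrite !g2E -tpureZl -tpureZl.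
  by rewrite !g2Dr IHx IHy scalerDr.
- move=> m a; elim/tensor_ind=> [q p|x y IHx IHy].
    by rewrite bl_pure !g2E tpure_bal.
  by rewrite (lactDr (blP _)) !g2Dr IHx IHy.
Qed.

Definition iassocf : btens M (btens N P) -> btens (btens M N) P := tlift g2.

Lemma iassocfE m q p : iassocf (tpure m (tpure q p : btens N P)) = tpure (tpure m q : btens M N) p.
Proof. by rewrite /iassocf (tliftE g2P) g2E. Qed.

Lemma ghom_iassocf : ghom iassocf.
Proof.
have fD x y : iassocf (x + y) = iassocf x + iassocf y by exact: (tliftD g2P).
have fZ c x : iassocf (c *: x) = c *: iassocf x by exact: (tliftZ g2P).
have fE t p : iassocf (tpure t p) = g2 t p by exact: (tliftE g2P).
have fB : is_bihom iassocf.
  apply: bihom_tens => // [a m t|m t a]; rewrite !fE.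
    elim/tensor_ind: t => [q p|x y IHx IHy]; first by rewrite !g2E !bl_pure.
    by rewrite !g2Dr IHx IHy (lactDr (blP _)).
  elim/tensor_ind: t => [q p|x y IHx IHy]; first by rewrite br_pure !g2E br_pure.
  by rewrite (ractDl (brP _)) !g2Dr IHx IHy (ractDl (brP _)).
apply: (@ghom_homog _ _ 0) => //; apply: degree_tens => // i j m t im jt.
rewrite addr0 fE; elim: jt => [d|d x y _ IHx _ IHy|d c x _ IHx|i' j' q p iq jp].
- by rewrite -(scale0r (0 : btens N P)) g2Zr scale0r; apply: bdeg0.
- by rewrite g2Dr; apply: bdegD.
- by rewrite g2Zr; apply: bdegZ.
- by rewrite g2E addrA; apply: tdeg_pure => //; apply: tdeg_pure.
Qed.

Definition bassoc : bhom (btens (btens M N) P) (btens M (btens N P)) := mkhom ghom_assocf.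
Definition biassoc : bhom (btens M (btens N P)) (btens (btens M N) P) := mkhom ghom_iassocf.

End Associator.

Section Unitors.
Variable M : gbimod.

Definition lunitf : btens bregular M -> M := tlift (fun (a : A) (x : M) => bl a x).
Definition ilunitf (x : M) : btens bregular M := tpure (1 : A) x.
Definition runitf : btens M bregular -> M := tlift (fun (x : M) (a : A) => br x a).
Definition irunitf (x : M) : btens M bregular := tpure x (1 : A).

Let lP : balanced (@br bregular) (@bl M) (fun (a : A) (x : M) => bl a x).
Proof. by case: (blP M) => *; split=> * //=; auto. Qed.
Let rP : balanced (@br M) (@bl bregular) (fun (x : M) (a : A) => br x a).
Proof. by case: (brP M) => *; split=> * //=; auto. Qed.

Lemma lunitfE a x : lunitf (tpure (a : A) x) = bl a x.
Proof. exact: (tliftE lP). Qed.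
Lemma runitfE x a : runitf (tpure x (a : A)) = br x a.
Proof. exact: (tliftE rP). Qed.

Lemma ghom_lunitf : ghom lunitf.
Proof.
have fB : is_bihom lunitf.
  apply: bihom_tens => [x y|c x|b a x|a x b].
  - exact: (tliftD lP).
  - exact: (tliftZ lP).
  - by rewrite !lunitfE /= (lactM (blP M)).
  - by rewrite !lunitfE /= blr.
apply: (@ghom_homog _ _ 0) => //; apply: degree_tens => // i j a x ia jx.
by rewrite addr0 lunitfE; apply: bdegl.
Qed.

Lemma ghom_runitf : ghom runitf.
Proof.
have fB : is_bihom runitf.
  apply: bihom_tens => [x y|c x|b x a|x a b].
  - exact: (tliftD rP).
  - exact: (tliftZ rP).
  - by rewrite !runitfE /= blr.
  - by rewrite !runitfE /= (ractM (brP M)).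
apply: (@ghom_homog _ _ 0) => //; apply: degree_tens => // i j x a ix ja.
by rewrite addr0 runitfE; apply: bdegr.
Qed.

Lemma ghom_ilunitf : ghom ilunitf.
Proof.
apply: (@ghom_homog _ _ 0).
  split=> *; rewrite /ilunitf.
  - exact: tpureDr.
  - exact: tpureZr.
  - by rewrite bl_pure -tpure_bal /= mul1r mulr1.
  - by rewrite br_pure.
move=> k x kx; rewrite addr0 -[k]add0r; apply: tdeg_pure => //; exact: zdeg_1.
Qed.

Lemma ghom_irunitf : ghom irunitf.
Proof.
apply: (@ghom_homog _ _ 0).
  split=> *; rewrite /irunitf.
  - exact: tpureDl.
  - exact: tpureZl.
  - by rewrite bl_pure.
  - by rewrite br_pure tpure_bal /= mul1r mulr1.
move=> k x kx; apply: tdeg_pure => //; exact: zdeg_1.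
Qed.

Definition blunit : bhom (btens bregular M) M := mkhom ghom_lunitf.
Definition bilunit : bhom M (btens bregular M) := mkhom ghom_ilunitf.
Definition brunit : bhom (btens M bregular) M := mkhom ghom_runitf.
Definition birunit : bhom M (btens M bregular) := mkhom ghom_irunitf.

End Unitors.

Lemma bassocE M N P m q p :
  bassoc M N P (tpure (tpure m q : btens M N) p) = tpure m (tpure q p : btens N P).
Proof. exact: assocfE. Qed.
Lemma biassocE M N P m q p :
  biassoc M N P (tpure m (tpure q p : btens N P)) = tpure (tpure m q : btens M N) p.
Proof. exact: iassocfE. Qed.
Lemma blunitE M a x : blunit M (tpure (a : A) x) = bl a x. Proof. exact: lunitfE. Qed.
Lemma brunitE M x a : brunit M (tpure x (a : A)) = br x a. Proof. exact: runitfE. Qed.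

Lemma bhom_tens3_ext M N P Q (f g : bhom (btens (btens M N) P) Q) :
  (forall m q p, f (tpure (tpure m q : btens M N) p) = g (tpure (tpure m q : btens M N) p)) ->
  f = g.
Proof.
move=> fg; apply: bhom_tens_ext => t p.
elim/tensor_ind: t => [m q|x y IHx IHy]; first exact: fg.
by rewrite tpureDl (biD (bhom_bi f)) (biD (bhom_bi g)) IHx IHy.
Qed.

Lemma bhom_tens3r_ext M N P Q (f g : bhom (btens M (btens N P)) Q) :
  (forall m q p, f (tpure m (tpure q p : btens N P)) = g (tpure m (tpure q p : btens N P))) ->
  f = g.
Proof.
move=> fg; apply: bhom_tens_ext => m t.
elim/tensor_ind: t => [q p|x y IHx IHy]; first exact: fg.
by rewrite tpureDr (biD (bhom_bi f)) (biD (bhom_bi g)) IHx IHy.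
Qed.

Lemma bhom_tens4_ext M N P Q Q' (f g : bhom (btens (btens (btens M N) P) Q) Q') :
  (forall m q p r, f (tpure (tpure (tpure m q : btens M N) p : btens (btens M N) P) r)
                 = g (tpure (tpure (tpure m q : btens M N) p : btens (btens M N) P) r)) ->
  f = g.
Proof.
move=> fg; apply: bhom_tens3_ext => t p r.
elim/tensor_ind: t => [m q|x y IHx IHy]; first exact: fg.
by rewrite !tpureDl (biD (bhom_bi f)) (biD (bhom_bi g)) IHx IHy.
Qed.

Inductive generated : gbimod -> Prop :=
  | gen_one : generated bregular
  | gen_U j : is_vertex n j -> generated (bU j)
  | gen_tens M N : generated M -> generated N -> generated (btens M N)
  | gen_zero : generated bzero
  | gen_sum M N : generated M -> generated N -> generated (bsum M N)
  | gen_shift k M : generated M -> generated (bshift k M).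

Record bob := BOb { bob_val :> gbimod; bobP : generated bob_val }.

Definition bob_one : bob := BOb gen_one.
Definition bob_tens (M N : bob) : bob := BOb (gen_tens (bobP M) (bobP N)).

Definition bimodcat : lmoncat R.
Proof.
refine (@LMonCat R bob (fun M N : bob => bhom M N : lmodType R) (fun M : bob => bid M)
  (fun (M N P : bob) g f => bcomp g f) bob_one bob_tens (fun (M N M' N' : bob) f g => btmap f g)
  (fun M N P : bob => bassoc M N P) (fun M N P : bob => biassoc M N P)
  (fun M : bob => blunit M) (fun M : bob => bilunit M) (fun M : bob => brunit M) (fun M : bob => birunit M)
  _ _ _ _ _ _ _ _ _ _ _ _ _ _ _ _ _ _ _ _).
- by move=> M N P a g g' f; apply: bhom_ext.
- move=> M N P a g f f'; apply: bhom_ext => x.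
  by rewrite /= (biD (bhom_bi g)) (biZ (bhom_bi g)).
- by move=> M N P Q h g f; apply: bhom_ext.
- by move=> M N f; apply: bhom_ext.
- by move=> M N f; apply: bhom_ext.
- move=> M N M' N' a f f' g; apply: bhom_tens_ext => m p.
  by rewrite bhom_addE bhom_scaleE !btmapE bhom_addE bhom_scaleE tpureDl tpureZl.
- move=> M N M' N' a f g g'; apply: bhom_tens_ext => m p.
  by rewrite bhom_addE bhom_scaleE !btmapE bhom_addE bhom_scaleE tpureDr tpureZr.
- by move=> M N; apply: bhom_tens_ext => m p; rewrite btmapE.
- move=> M N P M' N' P' g f g' f'; apply: bhom_tens_ext => m p.
  by rewrite -[RHS]/(btmap g g' (btmap f f' (tpure m p))) !btmapE.
- move=> M N P; apply: bhom_tens3_ext => m q p.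
  by rewrite -[LHS]/(biassoc M N P (bassoc M N P _)) bassocE biassocE.
- move=> M N P; apply: bhom_tens3r_ext => m q p.
  by rewrite -[LHS]/(bassoc M N P (biassoc M N P _)) biassocE bassocE.
- move=> M; apply: bhom_tens_ext => a x.
  rewrite -[LHS]/(bilunit M (blunit M (tpure a x))) blunitE.
  by rewrite /= /ilunitf -tpure_bal /= mul1r.
- by move=> M; apply: bhom_ext => x; rewrite [LHS](blunitE 1 x) (lact1 (blP M)).
- move=> M; apply: bhom_tens_ext => x a.
  rewrite -[LHS]/(birunit M (brunit M (tpure x a))) brunitE.
  by rewrite /= /irunitf tpure_bal /= mulr1.
- by move=> M; apply: bhom_ext => x; rewrite [LHS](brunitE x 1) (ract1 (brP M)).
- move=> M N P M' N' P' f g h; apply: bhom_tens3_ext => m q p.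
  rewrite -[LHS]/(bassoc M' N' P' (btmap (btmap f g) h _)).
  rewrite -[RHS]/(btmap f (btmap g h) (bassoc M N P _)).
  by rewrite bassocE !btmapE bassocE.
- move=> M N f; apply: bhom_tens_ext => a x.
  rewrite -[LHS]/(blunit N (btmap (bid _) f (tpure a x))).
  rewrite -[RHS]/(f (blunit M (tpure a x))).
  by rewrite btmapE !blunitE (bil (bhom_bi f)).
- move=> M N f; apply: bhom_tens_ext => x a.
  rewrite -[LHS]/(brunit N (btmap f (bid _) (tpure x a))).
  rewrite -[RHS]/(f (brunit M (tpure x a))).
  by rewrite btmapE !brunitE (bir (bhom_bi f)).
- move=> M N; apply: bhom_tens3_ext => m a p.
  rewrite -[LHS]/(btmap (bid M) (blunit N) (bassoc M bregular N _)).
  by rewrite bassocE !btmapE blunitE brunitE tpure_bal.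
- move=> M N P Q; apply: bhom_tens4_ext => m q p r.
  rewrite -[LHS]/(bassoc M N (btens P Q) (bassoc (btens M N) P Q _)).
  rewrite -[RHS]/(btmap (bid M) (bassoc N P Q)
    (bassoc M (btens N P) Q (btmap (bassoc M N P) (bid Q) _))).
  by rewrite !bassocE btmapE bassocE bassocE btmapE bassocE.
Defined.

End Bimodules.

(* The simple reflections are the elements of 'I_n; s stands for s_j with     *)
(* j = s + 1.                                                                  *)
Definition lab (n : nat) (s : 'I_n) : nat := s.+1.

Definition cox (n : nat) (s t : 'I_n) : nat :=
  if s == t then 1 else
  if (lab s + lab t == 3)%N then 4 else
  if (lab s == (lab t).+1) || (lab t == (lab s).+1) then 3 else 2.

Section Realisation.
Variables (R : realType) (n : nat).

(* a_{s,t} = < alpha_s^vee , alpha_t > *)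
Definition cartan (s t : 'I_n) : R :=
  if s == t then 2 else
  if (lab s == 2%N) && (lab t == 1%N) then - 2 else
  if (lab s == (lab t).+1) || (lab t == (lab s).+1) then - 1 else 0.

(* R = Sym(h') for h' the dual of h is the polynomial ring on the basis 'X_t  *)
(* of h' dual to the basis alpha_t^vee of h.  The variables have degree 2 in   *)
(* the grading, which does not affect which polynomials are homogeneous.      *)
Definition sroot (s : 'I_n) : {mpoly R[n]} := \sum_(t < n) cartan t s *: 'X_t.

(* The reflection s(l) = l - < alpha_s^vee , l > alpha_s, extended to Sym.    *)
Definition refl (s : 'I_n) (f : {mpoly R[n]}) : {mpoly R[n]} :=
  f \mPo [tuple 'X_t - (t == s)%:R *: sroot s | t < n].

Record hpoly := HPoly { hpoly_val :> {mpoly R[n]}; _ : hpoly_val \is ishomog mdeg }.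

Fact root_homog s : sroot s \is ishomog mdeg.
Proof.
apply: (@homogE _ _ _ 1); apply: rpred_sum => t _.
by apply: dhomogZ; rewrite dhomogX /= mdeg1.
Qed.
Definition hroot (s : 'I_n) : hpoly := HPoly (root_homog s).

End Realisation.

(* Diagrams are formal composites of the generators in a strict monoidal      *)
(* category; isotopy is imposed by the monoidal category axioms and by the    *)
(* biadjunction and cyclicity relations.                                      *)

Section Diagrams.
Variables (R : realType) (n : nat).
Local Notation word := (seq 'I_n).

Inductive dterm : word -> word -> Type :=
  | Dzero x y : dterm x y
  | Dadd x y : dterm x y -> dterm x y -> dterm x y
  | Dscale x y : R -> dterm x y -> dterm x y
  | Did x : dterm x x
  | Dcomp x y z : dterm y z -> dterm x y -> dterm x z
  | Dtens x y x' y' : dterm x y -> dterm x' y' -> dterm (x ++ x') (y ++ y')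
  | Denddot s : dterm [:: s] [::]
  | Dstartdot s : dterm [::] [:: s]
  | Dsplit s : dterm [:: s] [:: s; s]
  | Dmerge s : dterm [:: s; s] [:: s]
  | Dbox : hpoly R n -> dterm [::] [::]
  | Dvert2 s t : cox s t = 2%N -> dterm [:: s; t] [:: t; s]
  | Dvert3 s t : cox s t = 3%N -> dterm [:: s; t; s] [:: t; s; t]
  | Dvert4 s t : cox s t = 4%N -> dterm [:: s; t; s; t] [:: t; s; t; s].

(* The identity, read along an equality of objects. *)
Definition Dcast (x y : word) (e : x = y) : dterm x y :=
  match e in _ = z return dterm x z with erefl => Did x end.

(* [f ⨾ g] is f followed by g, that is g stacked on top of f. *)
Local Notation "f ⨾ g" := (Dcomp g f) (at level 41, right associativity).
Local Notation "f ⊗ g" := (Dtens f g) (at level 31, right associativity).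
Local Notation "f ⊞ g" := (Dadd f g) (at level 50, left associativity).
Local Notation "c ⋅ f" := (Dscale c f) (at level 40).
Local Notation one x := (Did x).
Local Notation enddot := Denddot.
Local Notation startdot := Dstartdot.
Local Notation split := Dsplit.
Local Notation merge := Dmerge.
Local Notation box := Dbox.
Local Notation v2 := Dvert2.
Local Notation v3 := Dvert3.
Local Notation v4 := Dvert4.

Definition Dcap (s : 'I_n) : dterm [:: s; s] [::] := merge s ⨾ enddot s.
Definition Dcup (s : 'I_n) : dterm [::] [:: s; s] := startdot s ⨾ split s.
Local Notation cap := Dcap.
Local Notation cup := Dcup.

(* f with vertical strands u to its left and w to its right. *)
Definition Dwhisker (u x y w : word) (f : dterm x y) :
  dterm (u ++ (x ++ w)) (u ++ (y ++ w)) := one u ⊗ f ⊗ one w.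
Local Notation "u ◁ f ▷ w" := (@Dwhisker u _ _ w f)
  (at level 35, f at level 34, w at level 34).

(* Two-coloured Jones--Wenzl morphisms.  A Temperley-Lieb diagram on m - 1    *)
(* strands, whose m regions on the bottom and on the top are coloured         *)
(* s, t, s, and so on, is read as a morphism by retracting the regions; the   *)
(* cup-cap enclosing a t-region in an s-region becomes cupcap s t below, with *)
(* cupcap s t ⨾ cupcap s t = a_{s,t} cupcap s t.  JW is the element with      *)
(* coefficient 1 at the identity which is killed by all caps; JW_1 = id.      *)
Definition cupcap (s t : 'I_n) : dterm [:: s; t; s] [:: s; t; s] :=
  [:: s] ◁ enddot t ▷ [:: s] ⨾ merge s ⨾ split s ⨾ [:: s] ◁ startdot t ▷ [:: s].

Definition JW2 (s t : 'I_n) : dterm [:: s; t; s] [:: s; t; s] :=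
  one [:: s; t; s] ⊞ (- (cartan R s t)^-1) ⋅ cupcap s t.

Definition JW3 (s t : 'I_n) : dterm [:: s; t; s; t] [:: s; t; s; t] :=
  let x := cartan R s t in
  let y := cartan R t s in
  let E1 : dterm [:: s; t; s; t] [:: s; t; s; t] := cupcap s t ⊗ one [:: t] in
  let E2 : dterm [:: s; t; s; t] [:: s; t; s; t] := one [:: s] ⊗ cupcap t s in
  one [:: s; t; s; t]
  ⊞ (y / (1 - x * y)) ⋅ E1 ⊞ (x / (1 - x * y)) ⋅ E2
  ⊞ (- (1 - x * y)^-1) ⋅ (E1 ⨾ E2 ⊞ E2 ⨾ E1).

Reserved Notation "f ≈ g" (at level 70).
Inductive deq : forall x y, dterm x y -> dterm x y -> Prop :=
  | d_refl x y (f : dterm x y) : f ≈ f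
  | d_sym x y (f g : dterm x y) : f ≈ g -> g ≈ f
  | d_trans x y (f g h : dterm x y) : f ≈ g -> g ≈ h -> f ≈ h
  | d_add x y (f f' g g' : dterm x y) : f ≈ f' -> g ≈ g' -> f ⊞ g ≈ f' ⊞ g'
  | d_scale x y c (f f' : dterm x y) : f ≈ f' -> c ⋅ f ≈ c ⋅ f'
  | d_comp x y z (f f' : dterm x y) (g g' : dterm y z) :
      f ≈ f' -> g ≈ g' -> f ⨾ g ≈ f' ⨾ g'
  | d_tens x y x' y' (f f' : dterm x y) (g g' : dterm x' y') :
      f ≈ f' -> g ≈ g' -> f ⊗ g ≈ f' ⊗ g'
  | d_addA x y (f g h : dterm x y) : f ⊞ (g ⊞ h) ≈ (f ⊞ g) ⊞ h
  | d_addC x y (f g : dterm x y) : f ⊞ g ≈ g ⊞ f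
  | d_add0 x y (f : dterm x y) : Dzero x y ⊞ f ≈ f
  | d_scaleA x y a b (f : dterm x y) : a ⋅ (b ⋅ f) ≈ (a * b) ⋅ f
  | d_scale1 x y (f : dterm x y) : 1 ⋅ f ≈ f
  | d_scaleDr x y a (f g : dterm x y) : a ⋅ (f ⊞ g) ≈ a ⋅ f ⊞ a ⋅ g
  | d_scaleDl x y a b (f : dterm x y) : (a + b) ⋅ f ≈ a ⋅ f ⊞ b ⋅ f
  | d_scale0 x y (f : dterm x y) : 0 ⋅ f ≈ Dzero x y
  | d_compDl x y z a (f f' : dterm x y) (g : dterm y z) :
      (a ⋅ f ⊞ f') ⨾ g ≈ a ⋅ (f ⨾ g) ⊞ (f' ⨾ g)
  | d_compDr x y z a (f : dterm x y) (g g' : dterm y z) :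
      f ⨾ (a ⋅ g ⊞ g') ≈ a ⋅ (f ⨾ g) ⊞ (f ⨾ g')
  | d_compA x y z t (f : dterm x y) (g : dterm y z) (h : dterm z t) :
      f ⨾ (g ⨾ h) ≈ (f ⨾ g) ⨾ h
  | d_comp1l x y (f : dterm x y) : one x ⨾ f ≈ f
  | d_comp1r x y (f : dterm x y) : f ⨾ one y ≈ f
  | d_tensDl x y x' y' a (f f' : dterm x y) (g : dterm x' y') :
      (a ⋅ f ⊞ f') ⊗ g ≈ a ⋅ (f ⊗ g) ⊞ f' ⊗ g
  | d_tensDr x y x' y' a (f : dterm x y) (g g' : dterm x' y') :
      f ⊗ (a ⋅ g ⊞ g') ≈ a ⋅ (f ⊗ g) ⊞ f ⊗ g'
  | d_tens1 x y : one x ⊗ one y ≈ one (x ++ y)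
  | d_tens_comp x y z x' y' z' (f : dterm x y) (g : dterm y z)
      (f' : dterm x' y') (g' : dterm y' z') :
      (f ⨾ g) ⊗ (f' ⨾ g') ≈ (f ⊗ f') ⨾ (g ⊗ g')
  | d_tensA x y z x' y' z' (f : dterm x x') (g : dterm y y') (h : dterm z z') :
      (f ⊗ (g ⊗ h)) ⨾ Dcast (catA x' y' z') ≈ Dcast (catA x y z) ⨾ ((f ⊗ g) ⊗ h)
  | d_tens_onel x y (f : dterm x y) : one [::] ⊗ f ≈ f
  | d_tens_oner x y (f : dterm x y) :
      (f ⊗ one [::]) ⨾ Dcast (cats0 y) ≈ Dcast (cats0 x) ⨾ f
  | d_box_lin c (f g h : hpoly R n) :
      hpoly_val h = c *: hpoly_val f + hpoly_val g -> box h ≈ c ⋅ box f ⊞ box g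
  | d_box_mul (f g h : hpoly R n) :
      hpoly_val h = hpoly_val f * hpoly_val g -> box h ≈ box f ⊗ box g
  | d_box_one (h : hpoly R n) : hpoly_val h = 1 -> box h ≈ one [::]
  | d_barbell s : startdot s ⨾ enddot s ≈ box (hroot R s)
  (* the hypothesis says that g is the Demazure derivative of f *)
  | d_forcing s (f sf g : hpoly R n) :
      hpoly_val sf = refl s f -> hpoly_val f - hpoly_val sf = sroot R s * hpoly_val g ->
      box f ⊗ one [:: s] ≈ one [:: s] ⊗ box sf ⊞ (enddot s ⨾ box g ⨾ startdot s)
  | d_needle s : split s ⨾ cap s ≈ Dzero [:: s] [::]
  | d_assoc s : merge s ⊗ one [:: s] ⨾ merge s ≈ one [:: s] ⊗ merge s ⨾ merge s
  | d_coassoc s : split s ⨾ split s ⊗ one [:: s] ≈ split s ⨾ one [:: s] ⊗ split s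
  | d_unitl s : startdot s ⊗ one [:: s] ⨾ merge s ≈ one [:: s]
  | d_unitr s : one [:: s] ⊗ startdot s ⨾ merge s ≈ one [:: s]
  | d_counitl s : split s ⨾ enddot s ⊗ one [:: s] ≈ one [:: s]
  | d_counitr s : split s ⨾ one [:: s] ⊗ enddot s ≈ one [:: s]
  | d_frobl s : one [:: s] ⊗ split s ⨾ merge s ⊗ one [:: s] ≈ merge s ⨾ split s
  | d_frobr s : split s ⊗ one [:: s] ⨾ one [:: s] ⊗ merge s ≈ merge s ⨾ split s
  | d_zigzagl s : cup s ⊗ one [:: s] ⨾ one [:: s] ⊗ cap s ≈ one [:: s]
  | d_zigzagr s : one [:: s] ⊗ cup s ⨾ cap s ⊗ one [:: s] ≈ one [:: s]
  | d_dotl s : startdot s ⊗ one [:: s] ⨾ cap s ≈ enddot s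
  | d_dotr s : one [:: s] ⊗ startdot s ⨾ cap s ≈ enddot s
  | d_trivl s : cup s ⊗ one [:: s; s] ⨾ one [:: s] ⊗ merge s ⊗ one [:: s]
      ⨾ one [:: s] ⊗ cap s ≈ merge s
  | d_trivr s : one [:: s; s] ⊗ cup s ⨾ one [:: s] ⊗ merge s ⊗ one [:: s]
      ⨾ cap s ⊗ one [:: s] ≈ merge s
  | d_trivsl s : cup s ⊗ one [:: s] ⨾ one [:: s] ⊗ merge s ≈ split s
  | d_trivsr s : one [:: s] ⊗ cup s ⨾ merge s ⊗ one [:: s] ≈ split s
  | d_rot2 s t (mst : cox s t = 2%N) (mts : cox t s = 2%N) :
      [::] ◁ cup s ▷ [:: t; s] ⨾ [:: s] ◁ v2 mst ▷ [:: s] ⨾ [:: s; t] ◁ cap s ▷ [::]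
      ≈ v2 mts
  | d_rot2' s t (mst : cox s t = 2%N) (mts : cox t s = 2%N) :
      [:: t; s] ◁ cup t ▷ [::] ⨾ [:: t] ◁ v2 mst ▷ [:: t] ⨾ [::] ◁ cap t ▷ [:: s; t]
      ≈ v2 mts
  | d_rot3 s t (mst : cox s t = 3%N) (mts : cox t s = 3%N) :
      [::] ◁ cup s ▷ [:: t; s; t] ⨾ [:: s] ◁ v3 mst ▷ [:: t]
      ⨾ [:: s; t; s] ◁ cap t ▷ [::]
      ≈ v3 mts
  | d_rot3' s t (mst : cox s t = 3%N) (mts : cox t s = 3%N) :
      [:: t; s; t] ◁ cup s ▷ [::] ⨾ [:: t] ◁ v3 mst ▷ [:: s]
      ⨾ [::] ◁ cap t ▷ [:: s; t; s]
      ≈ v3 mts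
  | d_rot4 s t (mst : cox s t = 4%N) (mts : cox t s = 4%N) :
      [::] ◁ cup s ▷ [:: t; s; t; s] ⨾ [:: s] ◁ v4 mst ▷ [:: s]
      ⨾ [:: s; t; s; t] ◁ cap s ▷ [::]
      ≈ v4 mts
  | d_rot4' s t (mst : cox s t = 4%N) (mts : cox t s = 4%N) :
      [:: t; s; t; s] ◁ cup t ▷ [::] ⨾ [:: t] ◁ v4 mst ▷ [:: t]
      ⨾ [::] ◁ cap t ▷ [:: s; t; s; t]
      ≈ v4 mts
  | d_assoc2 s t (mst : cox s t = 2%N) :
      [::] ◁ merge s ▷ [:: t] ⨾ v2 mst
      ≈ [:: s] ◁ v2 mst ▷ [::] ⨾ [::] ◁ v2 mst ▷ [:: s] ⨾ [:: t] ◁ merge s ▷ [::]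
  | d_assoc3 s t (mst : cox s t = 3%N) :
      [::] ◁ merge s ▷ [:: t; s] ⨾ v3 mst
      ≈ [:: s] ◁ v3 mst ▷ [::] ⨾ [::] ◁ v3 mst ▷ [:: t] ⨾ [:: t; s] ◁ merge t ▷ [::]
  | d_assoc4 s t (mst : cox s t = 4%N) :
      [::] ◁ merge s ▷ [:: t; s; t] ⨾ v4 mst
      ≈ [:: s] ◁ v4 mst ▷ [::] ⨾ [::] ◁ v4 mst ▷ [:: s] ⨾ [:: t; s; t] ◁ merge s ▷ [::]
  | d_dot2 s t (mst : cox s t = 2%N) :
      v2 mst ⨾ [:: t] ◁ enddot s ▷ [::] ≈ [::] ◁ enddot s ▷ [:: t]
  | d_dot3 s t (mst : cox s t = 3%N) :
      v3 mst ⨾ [:: t; s] ◁ enddot t ▷ [::] ≈ JW2 s t ⨾ [::] ◁ enddot s ▷ [:: t; s]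
  | d_dot4 s t (mst : cox s t = 4%N) :
      v4 mst ⨾ [:: t; s; t] ◁ enddot s ▷ [::]
      ≈ JW3 s t ⨾ [::] ◁ enddot s ▷ [:: t; s; t]
  | d_A1I2 s t u (mst : cox s t = 2%N) (mus : cox u s = 2%N) (mut : cox u t = 2%N) :
      [::] ◁ v2 mus ▷ [:: t] ⨾ [:: s] ◁ v2 mut ▷ [::] ⨾ [::] ◁ v2 mst ▷ [:: u]
      ≈ [:: u] ◁ v2 mst ▷ [::] ⨾ [::] ◁ v2 mut ▷ [:: s] ⨾ [:: t] ◁ v2 mus ▷ [::]
  | d_A1I3 s t u (mst : cox s t = 3%N) (mus : cox u s = 2%N) (mut : cox u t = 2%N) :
      [::] ◁ v2 mus ▷ [:: t; s] ⨾ [:: s] ◁ v2 mut ▷ [:: s]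
      ⨾ [:: s; t] ◁ v2 mus ▷ [::] ⨾ [::] ◁ v3 mst ▷ [:: u]
      ≈ [:: u] ◁ v3 mst ▷ [::] ⨾ [::] ◁ v2 mut ▷ [:: s; t]
      ⨾ [:: t] ◁ v2 mus ▷ [:: t] ⨾ [:: t; s] ◁ v2 mut ▷ [::]
  | d_A1I4 s t u (mst : cox s t = 4%N) (mus : cox u s = 2%N) (mut : cox u t = 2%N) :
      [::] ◁ v2 mus ▷ [:: t; s; t] ⨾ [:: s] ◁ v2 mut ▷ [:: s; t]
      ⨾ [:: s; t] ◁ v2 mus ▷ [:: t] ⨾ [:: s; t; s] ◁ v2 mut ▷ [::]
      ⨾ [::] ◁ v4 mst ▷ [:: u]
      ≈ [:: u] ◁ v4 mst ▷ [::]
      ⨾ [::] ◁ v2 mut ▷ [:: s; t; s] ⨾ [:: t] ◁ v2 mus ▷ [:: t; s]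
      ⨾ [:: t; s] ◁ v2 mut ▷ [:: s] ⨾ [:: t; s; t] ◁ v2 mus ▷ [::]
  (* Three-colour relations.  In types A_3 and B_3 the two sides go the two   *)
  (* ways round the cycle of reduced expressions of the longest element       *)
  (* (modulo commutations), from sutsut to tsutsu, resp. from sutsutsut to    *)
  (* tustustus.  The starting point matters: from a class in the other orbit  *)
  (* under rotation of the diagrams, the two ways agree only modulo lower     *)
  (* terms.                                                                   *)
  | d_A3 s t u (mst : cox s t = 3%N) (mts : cox t s = 3%N) (mtu : cox t u = 3%N)
      (mut : cox u t = 3%N) (msu : cox s u = 2%N) (mus : cox u s = 2%N) :
      [:: s; u; t] ◁ v2 msu ▷ [:: t]
      ⨾ [:: s] ◁ v3 mut ▷ [:: s; t]
      ⨾ [:: s; t; u] ◁ v3 mts ▷ [::]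
      ⨾ [:: s; t] ◁ v2 mus ▷ [:: t; s]
      ⨾ [::] ◁ v3 mst ▷ [:: u; t; s]
      ⨾ [:: t; s] ◁ v3 mtu ▷ [:: s]
      ⨾ [:: t; s; u; t] ◁ v2 mus ▷ [::]
    ≈ [::] ◁ v2 msu ▷ [:: t; s; u; t]
      ⨾ [:: u] ◁ v3 mst ▷ [:: u; t]
      ⨾ [:: u; t; s] ◁ v3 mtu ▷ [::]
      ⨾ [:: u; t] ◁ v2 msu ▷ [:: t; u]
      ⨾ [::] ◁ v3 mut ▷ [:: s; t; u]
      ⨾ [:: t; u] ◁ v3 mts ▷ [:: u]
      ⨾ [:: t] ◁ v2 mus ▷ [:: t; s; u]
  | d_B3 s t u (mst : cox s t = 4%N) (mts : cox t s = 4%N) (mtu : cox t u = 3%N)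
      (mut : cox u t = 3%N) (msu : cox s u = 2%N) (mus : cox u s = 2%N) :
      [:: s; u; t] ◁ v2 msu ▷ [:: t; s; u; t]
      ⨾ [:: s] ◁ v3 mut ▷ [:: s; t; s; u; t]
      ⨾ [:: s; t; u] ◁ v4 mts ▷ [:: u; t]
      ⨾ [:: s; t] ◁ v2 mus ▷ [:: t; s; t; u; t]
      ⨾ [:: s; t; s; u; t; s] ◁ v3 mtu ▷ [::]
      ⨾ [:: s; t; s; u; t] ◁ v2 msu ▷ [:: t; u]
      ⨾ [:: s; t; s] ◁ v3 mut ▷ [:: s; t; u]
      ⨾ [::] ◁ v4 mst ▷ [:: u; t; s; t; u]
      ⨾ [:: t; s; t] ◁ v2 msu ▷ [:: t; s; t; u]
      ⨾ [:: t; s; t; u] ◁ v4 mst ▷ [:: u]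
      ⨾ [:: t; s] ◁ v3 mtu ▷ [:: s; t; s; u]
      ⨾ [:: t] ◁ v2 msu ▷ [:: t; u; s; t; s; u]
      ⨾ [:: t; u; s; t; u; s; t] ◁ v2 msu ▷ [::]
    ≈ [::] ◁ v2 msu ▷ [:: t; s; u; t; s; u; t]
      ⨾ [:: u; s; t; s; u; t] ◁ v2 msu ▷ [:: t]
      ⨾ [:: u; s; t; s] ◁ v3 mut ▷ [:: s; t]
      ⨾ [:: u] ◁ v4 mst ▷ [:: u; t; s; t]
      ⨾ [:: u; t; s; t] ◁ v2 msu ▷ [:: t; s; t]
      ⨾ [:: u; t; s; t; u] ◁ v4 mst ▷ [::]
      ⨾ [:: u; t; s] ◁ v3 mtu ▷ [:: s; t; s]
      ⨾ [:: u; t] ◁ v2 msu ▷ [:: t; u; s; t; s]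
      ⨾ [::] ◁ v3 mut ▷ [:: s; t; u; s; t; s]
      ⨾ [:: t; u; t; s; t] ◁ v2 mus ▷ [:: t; s]
      ⨾ [:: t; u] ◁ v4 mts ▷ [:: u; t; s]
      ⨾ [:: t; u; s; t; s] ◁ v3 mtu ▷ [:: s]
      ⨾ [:: t; u; s; t] ◁ v2 msu ▷ [:: t; u; s]
where "f ≈ g" := (deq f g).

Definition dpres (x y : word) : lmpres R :=
  @LMPres R (dterm x y) (@deq x y) (Dzero x y) (@Dadd x y) (@Dscale x y)
    (@d_refl x y) (@d_sym x y) (@d_trans x y) (@d_add x y) (@d_scale x y)
    (@d_addA x y) (@d_addC x y) (@d_add0 x y) (@d_scaleA x y) (@d_scale1 x y)
    (@d_scaleDr x y) (@d_scaleDl x y) (@d_scale0 x y).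

Definition dhom (x y : word) : lmodType R := lmq (dpres x y).
Definition dcl (x y : word) (f : dterm x y) : dhom x y := lmpi (P := dpres x y) f.

End Diagrams.

Section HeckeCategory.
Variables (R : realType) (n : nat).
Local Notation word := (seq 'I_n).
Local Notation dhom := (@dhom R n).
Local Notation dterm := (@dterm R n).

Definition dcomp (x y z : word) (g : dhom y z) (f : dhom x y) : dhom x z :=
  dcl (Dcomp (lmrepr (P := dpres R y z) g) (lmrepr (P := dpres R x y) f)).
Definition dtens (x y x' y' : word) (f : dhom x y) (g : dhom x' y') :
    dhom (x ++ x') (y ++ y') :=
  dcl (Dtens (lmrepr (P := dpres R x y) f) (lmrepr (P := dpres R x' y') g)).
Definition dcast (x y : word) (e : x = y) : dhom x y := dcl (Dcast R e).

Lemma dclP x y (f g : dterm x y) : dcl f = dcl g <-> deq f g.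
Proof. exact: (@lmpiP _ (dpres R x y)). Qed.

Lemma dcl_ind x y (K : dhom x y -> Prop) : (forall f, K (dcl f)) -> forall f, K f.
Proof. exact: (@lmq_ind _ (dpres R x y)). Qed.

Lemma dcompE x y z (g : dterm y z) (f : dterm x y) :
  dcomp (dcl g) (dcl f) = dcl (Dcomp g f).
Proof. by apply/dclP/d_comp; apply: (@lmreprK _ (dpres R _ _)). Qed.

Lemma dtensE x y x' y' (f : dterm x y) (g : dterm x' y') :
  dtens (dcl f) (dcl g) = dcl (Dtens f g).
Proof. by apply/dclP/d_tens; apply: (@lmreprK _ (dpres R _ _)). Qed.

Lemma dclD x y (f g : dterm x y) : dcl (Dadd f g) = dcl f + dcl g.
Proof. exact: (@lmpiD _ (dpres R x y)). Qed.

Lemma dclZ x y a (f : dterm x y) : dcl (Dscale a f) = a *: dcl f.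
Proof. exact: (@lmpiZ _ (dpres R x y)). Qed.

Lemma dcomp1m x y (f : dhom x y) : dcomp (dcl (Did R y)) f = f.
Proof. by elim/dcl_ind: f => f; rewrite dcompE; apply/dclP/d_comp1r. Qed.

Lemma dcompm1 x y (f : dhom x y) : dcomp f (dcl (Did R x)) = f.
Proof. by elim/dcl_ind: f => f; rewrite dcompE; apply/dclP/d_comp1l. Qed.

Lemma dtens11 x y : dtens (dcl (Did R x)) (dcl (Did R y)) = dcl (Did R (x ++ y)).
Proof. by rewrite dtensE; apply/dclP/d_tens1. Qed.

Lemma dcast1 x (e : x = x) : dcast e = dcl (Did R x).
Proof. by rewrite (eq_irrelevance e erefl). Qed.

Lemma dcast_irr x y (e e' : x = y) : dcast e = dcast e'.
Proof. by rewrite (eq_irrelevance e e'). Qed.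

Lemma dcast_comp x y z (e : x = y) (e' : y = z) :
  dcomp (dcast e') (dcast e) = dcast (etrans e e').
Proof. by case: z / e'; rewrite dcast1 dcomp1m; apply: dcast_irr. Qed.

Lemma dcast_tensl x y z (e : x = y) :
  dtens (dcast e) (dcl (Did R z)) = dcast (congr1 (cat^~ z) e).
Proof. by case: y / e; rewrite !dcast1 dtens11. Qed.

Lemma dcast_tensr x y z (e : x = y) :
  dtens (dcl (Did R z)) (dcast e) = dcast (congr1 (cat z) e).
Proof. by case: y / e; rewrite !dcast1 dtens11. Qed.

Lemma dcastK x y (e : x = y) (e' : y = x) : dcomp (dcast e') (dcast e) = dcl (Did R x).
Proof. by rewrite dcast_comp dcast1. Qed.

Lemma dcompA x y z t (h : dhom z t) (g : dhom y z) (f : dhom x y) :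
  dcomp h (dcomp g f) = dcomp (dcomp h g) f.
Proof.
elim/dcl_ind: h => h; elim/dcl_ind: g => g; elim/dcl_ind: f => f.
by rewrite !dcompE; apply/dclP/d_sym/d_compA.
Qed.

(* The strict monoidal category: the associator and the unitors are identities. *)
Definition heckecat : lmoncat R.
Proof.
refine (@LMonCat R word dhom (fun x => dcl (Did R x)) dcomp [::] cat dtens
  (fun x y z => dcast (esym (catA x y z))) (fun x y z => dcast (catA x y z))
  (fun x => dcast (cat0s x)) (fun x => dcast (esym (cat0s x)))
  (fun x => dcast (cats0 x)) (fun x => dcast (esym (cats0 x)))
  _ _ _ _ _ _ _ _ _ _ _ _ _ _ _ _ _ _ _ _).
- move=> x y z a; elim/dcl_ind=> g; elim/dcl_ind=> g'; elim/dcl_ind=> f.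
  by rewrite -dclZ -dclD !dcompE -dclZ -dclD; apply/dclP/d_compDr.
- move=> x y z a; elim/dcl_ind=> g; elim/dcl_ind=> f; elim/dcl_ind=> f'.
  by rewrite -dclZ -dclD !dcompE -dclZ -dclD; apply/dclP/d_compDl.
- exact: dcompA.
- exact: dcomp1m.
- exact: dcompm1.
- move=> x y x' y' a; elim/dcl_ind=> f; elim/dcl_ind=> f'; elim/dcl_ind=> g.
  by rewrite -dclZ -dclD !dtensE -dclZ -dclD; apply/dclP/d_tensDl.
- move=> x y x' y' a; elim/dcl_ind=> f; elim/dcl_ind=> g; elim/dcl_ind=> g'.
  by rewrite -dclZ -dclD !dtensE -dclZ -dclD; apply/dclP/d_tensDr.
- exact: dtens11.
- move=> x y z x' y' z'; elim/dcl_ind=> g; elim/dcl_ind=> f.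
  elim/dcl_ind=> g'; elim/dcl_ind=> f'.
  by rewrite (dcompE g f) (dcompE g' f') !dtensE dcompE; apply/dclP/d_tens_comp.
- by move=> *; apply: dcastK.
- by move=> *; apply: dcastK.
- by move=> *; apply: dcastK.
- by move=> *; apply: dcastK.
- by move=> *; apply: dcastK.
- by move=> *; apply: dcastK.
- move=> x y z x' y' z'; elim/dcl_ind=> f; elim/dcl_ind=> g; elim/dcl_ind=> h.
  set Y := dtens (dtens _ _) _; set X := dtens _ (dtens _ _).
  have e : dcomp (dcast (catA x' y' z')) X = dcomp Y (dcast (catA x y z)).
    rewrite /X /Y (dtensE g h) (dtensE f g) !dtensE !dcompE; exact/dclP/d_tensA.
  rewrite -[RHS]dcomp1m -(dcastK (catA x' y' z') (esym (catA x' y' z'))) -dcompA.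
  by rewrite (dcompA _ X) e -dcompA dcastK dcompm1.
- move=> x y; elim/dcl_ind=> f; rewrite !dcast1 dcomp1m dcompm1 dtensE.
  exact/dclP/d_tens_onel.
- move=> x y; elim/dcl_ind=> f; rewrite dtensE !dcompE.
  exact/dclP/d_tens_oner.
- move=> x y; rewrite dcast_tensr dcast_tensl dcast_comp; exact: dcast_irr.
- move=> x y z t; rewrite dcast_tensr dcast_tensl !dcast_comp; exact: dcast_irr.
Defined.

End HeckeCategory.

Section FunctorData.
Variables (R : realType) (n : nat).
Local Notation word := (seq 'I_n).
Local Notation gbimod := (gbimod R n).
Local Notation unit := (bregular R n).
Local Notation U s := (bU R n (lab s)).
Implicit Types (M N : gbimod) (w x y : word).

Definition Gfold M w : gbimod := foldl (fun M t => btens M (U t)) M w.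

Definition Gobj w : gbimod := if w is s :: w' then Gfold (U s) w' else unit.

Lemma Gfold_generated M w : generated M -> generated (Gfold M w).
Proof.
elim: w M => [|t w IHw] M genM //=; apply: IHw; apply: gen_tens => //.
by apply: gen_U; rewrite /is_vertex /lab /= ltn_ord.
Qed.

Lemma Gobj_generated w : generated (Gobj w).
Proof.
case: w => [|s w] /=; first exact: gen_one.
by apply: Gfold_generated; apply: gen_U; rewrite /is_vertex /lab /= ltn_ord.
Qed.

Definition Gob (w : heckecat R n) : bimodcat R n := BOb (Gobj_generated w).

(* Coherence isomorphisms.  As Gobj brackets to the left, the isomorphism      *)
(* G(x) (x) G(y) -> G(x ++ y) moves the factors of G(y) one at a time across   *)
(* the outer tensor product with inverse associators; it is a unitor when x or *)
(* y is empty.                                                                 *)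
Fixpoint Gfold_map M N (f : bhom M N) w : bhom (Gfold M w) (Gfold N w) :=
  match w with
  | [::] => f
  | t :: w' => Gfold_map (btmap f (bid (U t))) w'
  end.

Fixpoint mu_right M N w : bhom (btens M (Gfold N w)) (Gfold (btens M N) w) :=
  match w with
  | [::] => bid (btens M N)
  | t :: w' => bcomp (Gfold_map (biassoc M N (U t)) w') (mu_right M (btens N (U t)) w')
  end.

Fixpoint mu_left M w y : bhom (btens (Gfold M w) (Gobj y)) (Gfold M (w ++ y)) :=
  match w with
  | [::] => match y with
            | [::] => brunit M
            | t :: y' => mu_right M (U t) y'
            end
  | s :: w' => mu_left (btens M (U s)) w' y
  end.

Definition Gmu (x y : heckecat R n) : mor (mtens (Gob x) (Gob y)) (Gob (mtens x y)) :=
  match x as x return bhom (btens (Gobj x) (Gobj y)) (Gobj (x ++ y)) with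
  | [::] => blunit (Gobj y)
  | s :: x' => mu_left (U s) x' y
  end.

Definition Geps : mor (mone (bimodcat R n)) (Gob (mone (heckecat R n))) := bid unit.

(* The values below determine the bimodule maps, since e_j (x) e_j generates  *)
(* U_j, while e_j (x) X_j (x) e_j (x) e_j and e_j (x) e_j (x) e_j (x) e_j      *)
(* generate U_j (x) U_j.                                                       *)
Local Notation e j := (ze R n j).
Local Notation ie j := (zi R n j).
Local Notation X j := (zX R n j).
Local Notation "⟨ j | k ⟩" := (za R n j k) (at level 0, j at level 60, k at level 60).
Local Notation "a ⊗[ j ] b" := (@u_ R n j a b) (at level 45, j at level 9).

Definition ee (s : 'I_n) : U s := e (lab s) ⊗[lab s] e (lab s).
Definition eX (s : 'I_n) : U s := e (lab s) ⊗[lab s] X (lab s).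

Definition is_alpha (s : 'I_n) (f : bhom (U s) (btens (U s) (U s))) : Prop :=
  f (ee s) = tpure (ee s) (ee s).

Definition is_beta (s : 'I_n) (f : bhom (U s) unit) : Prop := f (ee s) = e (lab s).

Definition is_gamma (s : 'I_n) (f : bhom unit (U s)) : Prop :=
  let j := lab s in
  f 1 = X j ⊗[j] e j + e j ⊗[j] X j +
    (if j == 1%N then
       ⟨2 | 1⟩ ⊗[j] ⟨1 | 2⟩ + (- ie 2 * ⟨2 | 1⟩) ⊗[j] (⟨1 | 2⟩ * ie 2)
     else if (j < n)%N then
       ⟨j.-1 | j⟩ ⊗[j] ⟨j | j.-1⟩ + ⟨j.+1 | j⟩ ⊗[j] ⟨j | j.+1⟩
     else ⟨j.-1 | j⟩ ⊗[j] ⟨j | j.-1⟩).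

Definition is_delta (s : 'I_n) (f : bhom (btens (U s) (U s)) (U s)) : Prop :=
  f (tpure (eX s) (ee s)) = ee s /\ f (tpure (ee s) (ee s)) = 0.

Definition is_epsilon (s : 'I_n) (f : bhom unit unit) : Prop :=
  let j := lab s in
  f 1 = if j == 1%N then 2 *: X 1 + 2 *: X 2
        else if (j < n)%N then (-1) ^+ j.+1 *: (2 *: X j + X j.-1 + X j.+1)
        else (-1) ^+ j.+1 *: (2 *: X j + X j.-1).

End FunctorData.

(* Main.v *)
Require Import Defs.
From mathcomp Require Import all_boot all_order all_algebra.
From mathcomp Require Import boolp functions reals mpoly complex ring zify.

(* The functor is defined by recursion on formal diagrams, and has to respect  *)
(* every relation.  Write U_j (x) U_j = P_j (x)_{F_j} e_j B_n e_j (x)_{F_j} jP. *)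
(* The coefficient of X_j is an F_j-bilinear form phi on e_j B_n e_j, read off *)
(* from the left module P_j, and delta_j applies it to the middle factor.  The *)
(* element gamma_j(1) is central and consists of dual bases for the pairing    *)
(* phi (b c), which gives every one-colour relation.  The X_j are central with *)
(* X_j X_k = 0, so a box only sees the constant and linear terms of its        *)
(* polynomial: 'X_t acts as (-1)^(t+1) X_t.                                    *)
(* All 2m-valent vertices being 0, what is left is that an enddot to the left  *)
(* of a commuting colour is 0 (as e_s B_n e_t = 0) and that the two-coloured   *)
(* Jones-Wenzl morphisms are 0.  The latter holds before any dot is attached:  *)
(* for adjacent s, t the corner e_s B_n e_t is generated by one arrow, so JW_2 *)
(* and JW_3 only have to be evaluated on a few elements.                       *)

Set Implicit Arguments.
Unset Strict Implicit.
Unset Printing Implicit Defensive.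

Import Order.TTheory GRing.Theory Num.Theory.
Local Open Scope ring_scope.

(** Morphisms of the Hecke category are classes of formal diagrams, so a functor out of it is an
    evaluation of diagrams that is constant on classes. The content is the soundness statement
    [Geval_eq] for [diag_eval], one case for each relation. The category and monoidal relations hold
    because the coherence maps only concatenate lists of tensor factors ([gmuE]), and maps can be
    compared on pure tensors ([Gobj_ext]).

    One colour: phi makes jP dual to P_j over F_j, through the pairing that sends b and c to phi (b
    c). It exists because X_j is nonzero in B_n, which is seen on explicit matrices ([rep]). The
    merging vertex contracts the two inner factors with phi, the splitting vertex inserts e_j (x)
    e_j, and the startdot inserts the Casimir element gamma_j(1), the sum over a pair of dual bases.
    The unit, biadjunction and rotation relations are then forms of the dual-basis identities
    [dual_r] and [dual_l]. These are verified against e_j alone and extended to all of B_n because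
    gamma_j(1) is central ([gamma1_central]). Associativity is F_j-linearity of phi, and the needle
    is phi (e_j) = 0.

    Polynomials act through a ring homomorphism [zpoly] to the centre of B_n, which only sees terms
    of degree at most one. The barbell is the value of [zpoly] at a simple root
    ([gamma_basis_barbell]), and forcing needs only the low coefficients of a Demazure derivative
    ([demazure_low]).

    Several colours: every 2m-valent vertex is 0, so only the dot-crossing relations have a side
    that could survive. For commuting colours it factors through a zero corner e_s B_n e_t
    ([corner_far]). For the others it contains a Jones-Wenzl morphism, which is 0 ([Geval_JW2],
    [Geval_JW3]): the corner is spanned by one arrow and its multiples by i, so that a few explicit
    elements decide. *)

(** * The zigzag algebra *)

(* A locked copy of [zX]: unification would otherwise see [zX j] as a product. *)
Definition zXl (R : realType) (n j : nat) : zigzag R n := locked (zX R n j).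
Lemma zXlE (R : realType) n j : zXl R n j = zX R n j.
Proof. by rewrite /zXl -lock. Qed.

Section ZigzagRelations.
Variables (R : realType) (n : nat).
Local Notation A := (zigzag R n).
Local Notation e j := (ze R n j).
Local Notation i_ j := (zi R n j).
Local Notation a_ j k := (za R n j k).
Local Notation X j := (zXl R n j).
Local Notation lp := (lmpi (P := apres R n)).

Lemma za_out j k : ~~ is_arrow n j k -> a_ j k = 0.
Proof. by move=> h; apply/(@lmpiP _ (apres R n))/r_arr. Qed.
Lemma zi_out j : ~~ is_loop n j -> i_ j = 0.
Proof. by move=> h; apply/(@lmpiP _ (apres R n))/r_loop. Qed.

Lemma ze_orth j k : j != k -> e j * e k = 0.
Proof. by move=> h; rewrite [LHS]zmulE; apply/(@lmpiP _ (apres R n))/r_vtx_orth. Qed.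
Lemma ze_mul j k : e j * e k = if j == k then e j else 0.
Proof. by case: eqP => [->|/eqP /ze_orth //]; rewrite zeK. Qed.
Lemma ze_za j k : e j * a_ j k = a_ j k.
Proof. by rewrite [LHS]zmulE; apply/(@lmpiP _ (apres R n))/r_arr_src. Qed.
Lemma za_ze j k : a_ j k * e k = a_ j k.
Proof. by rewrite [LHS]zmulE; apply/(@lmpiP _ (apres R n))/r_arr_tgt. Qed.

Lemma zone : 1 = \sum_(j <- iota 1 n) e j.
Proof.
have -> : (1 : A) = lp (Aone R) by [].
rewrite (_ : lp (Aone R) = lp (foldr (@Aadd R) (Azero R) [seq Agen R (Qvtx j)
  | j <- iota 1 n])); last first.
  exact/(@lmpiP _ (apres R n))/r_one.
elim: (iota 1 n) => [|j s IH]; first by rewrite big_nil.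
by rewrite big_cons -IH -lmpiD.
Qed.

Lemma zzigzag j : (2 <= j <= n.-1)%N -> a_ j j.-1 * a_ j.-1 j = a_ j j.+1 * a_ j.+1 j.
Proof. by move=> h; rewrite [LHS]zmulE [RHS]zmulE; apply/(@lmpiP _ (apres R n))/r_zigzag. Qed.
Lemma zup j : (2 <= j <= n.-1)%N -> a_ j.-1 j * a_ j j.+1 = 0.
Proof. by move=> h; rewrite [LHS]zmulE; apply/(@lmpiP _ (apres R n))/r_up. Qed.
Lemma zdown j : (2 <= j <= n.-1)%N -> a_ j.+1 j * a_ j j.-1 = 0.
Proof. by move=> h; rewrite [LHS]zmulE; apply/(@lmpiP _ (apres R n))/r_down. Qed.
Lemma zi_sqr j : is_loop n j -> i_ j * i_ j = - e j.
Proof.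
by move=> h; rewrite -scaleN1r [LHS]zmulE -lmpiZ; apply/(@lmpiP _ (apres R n))/r_i2.
Qed.
Lemma zi_up j : (3 <= j <= n)%N -> i_ j.-1 * a_ j.-1 j = a_ j.-1 j * i_ j.
Proof. by move=> h; rewrite [LHS]zmulE [RHS]zmulE; apply/(@lmpiP _ (apres R n))/r_i_up. Qed.
Lemma zi_down j : (3 <= j <= n)%N -> i_ j * a_ j j.-1 = a_ j j.-1 * i_ j.-1.
Proof. by move=> h; rewrite [LHS]zmulE [RHS]zmulE; apply/(@lmpiP _ (apres R n))/r_i_down. Qed.
Lemma zi_one : a_ 1 2 * i_ 2 * a_ 2 1 = 0.
Proof.
have h : a_ 1 2 * i_ 2 = lp (Amul (Agen R (Qarr 1 2)) (Agen R (Qloop 2))) by rewrite [LHS]zmulE.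
by rewrite h [LHS]zmulE; apply/(@lmpiP _ (apres R n))/r_i_one.
Qed.
Lemma zi_X : i_ 2 * X 2 = X 2 * i_ 2.
Proof.
have -> : X 2 = lp (tX R 2) by rewrite zXlE /zX /= [LHS]zmulE.
by rewrite [LHS]zmulE [RHS]zmulE; apply/(@lmpiP _ (apres R n))/r_i_X.
Qed.

Lemma is_arrowC j k : is_arrow n j k = is_arrow n k j.
Proof. by rewrite /is_arrow andbCA orbC. Qed.

Lemma za_za_ne j k l m : k != l -> a_ j k * a_ l m = 0.
Proof. by move=> kl; rewrite -(za_ze j k) -(ze_za l m) -mulrA (mulrA (e k))
  ze_orth // mul0r mulr0. Qed.
Lemma ze_za_ne j k l : j != k -> e j * a_ k l = 0.
Proof. by move=> h; rewrite -(ze_za k l) mulrA ze_orth ?mul0r. Qed.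
Lemma za_ze_ne j k l : k != l -> a_ j k * e l = 0.
Proof. by move=> h; rewrite -(za_ze j k) -mulrA ze_orth ?mulr0. Qed.
Lemma zi_za_ne j k l : j != k -> i_ j * a_ k l = 0.
Proof. by move=> h; rewrite -(zi_ze R n j) -mulrA ze_za_ne ?mulr0. Qed.
Lemma za_zi_ne j k l : k != l -> a_ j k * i_ l = 0.
Proof. by move=> h; rewrite -(ze_zi R n l) mulrA za_ze_ne ?mul0r. Qed.
Lemma ze_zi_ne j k : j != k -> e j * i_ k = 0.
Proof. by move=> h; rewrite -(ze_zi R n k) mulrA ze_orth ?mul0r. Qed.
Lemma zi_ze_ne j k : j != k -> i_ j * e k = 0.
Proof. by move=> h; rewrite -(zi_ze R n j) -mulrA ze_orth ?mulr0. Qed.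
Lemma zi_zi_ne j k : j != k -> i_ j * i_ k = 0.
Proof. by move=> h; rewrite -(zi_ze R n j) -mulrA ze_zi_ne ?mulr0. Qed.

Lemma zX1E : X 1 = a_ 1 2 * a_ 2 1. Proof. by rewrite zXlE. Qed.
Lemma zXE j : j != 1%N -> X j = a_ j j.-1 * a_ j.-1 j.
Proof. by rewrite zXlE /zX => /negbTE ->. Qed.

(** The zigzag relation identifies the loops through the two neighbours of an interior vertex, and
    an end vertex has a single neighbour. *)
Lemma zX_arrow j m : is_arrow n j m -> a_ j m * a_ m j = X j.
Proof.
rewrite zXlE /zX /is_arrow /is_vertex => /and3P[hj hm /orP[/eqP h|/eqP h]]; subst.
  case: eqP => [-> //|/eqP h1]; rewrite -zzigzag //; lia.
by case: eqP => [h|_]; first lia.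
Qed.

Lemma ze_zX j : e j * X j = X j.
Proof. by rewrite zXlE /zX; case: eqP => [->|_]; rewrite mulrA ze_za. Qed.
Lemma zX_ze j : X j * e j = X j.
Proof. by rewrite zXlE /zX; case: eqP => [->|_]; rewrite -mulrA za_ze. Qed.
Lemma ze_zX_ne j k : j != k -> e j * X k = 0.
Proof. by move=> h; rewrite -ze_zX mulrA ze_orth ?mul0r. Qed.
Lemma zX_ze_ne j k : j != k -> X j * e k = 0.
Proof. by move=> h; rewrite -zX_ze -mulrA ze_orth ?mulr0. Qed.
Lemma zX_zi_ne j k : j != k -> X j * i_ k = 0.
Proof. by move=> h; rewrite -(ze_zi R n k) mulrA zX_ze_ne ?mul0r. Qed.
Lemma zi_zX_ne j k : j != k -> i_ j * X k = 0.
Proof. by move=> h; rewrite -(zi_ze R n j) -mulrA ze_zX_ne ?mulr0. Qed.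
Lemma zX_za_ne j k l : j != k -> X j * a_ k l = 0.
Proof. by move=> h; rewrite -(ze_za k l) mulrA zX_ze_ne ?mul0r. Qed.
Lemma za_zX_ne j k l : k != l -> a_ j k * X l = 0.
Proof. by move=> h; rewrite -(za_ze j k) -mulrA ze_zX_ne ?mulr0. Qed.

(** If both arrows exist and [j] differs from [l], the middle vertex has a neighbour on each side,
    hence is interior, and one of the two straight-path relations applies. *)
Lemma za_straight j m l : j != l -> a_ j m * a_ m l = 0.
Proof.
move=> jl; have [h1|/za_out ->] := boolP (is_arrow n j m); last by rewrite mul0r.
have [h2|/za_out ->] := boolP (is_arrow n m l); last by rewrite mulr0.
move: h1 h2; rewrite /is_arrow /is_vertex => h1 h2.
have [h|h] : (j = m.-1 /\ l = m.+1) \/ (j = m.+1 /\ l = m.-1) by lia.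
  by case: h => -> ->; apply: zup; lia.
by case: h => -> ->; apply: zdown; lia.
Qed.

Lemma zi_za j k : is_loop n j -> is_loop n k -> i_ j * a_ j k = a_ j k * i_ k.
Proof.
rewrite /is_loop => hj hk.
have [h1|/za_out ->] := boolP (is_arrow n j k); last by rewrite mul0r mulr0.
move: h1; rewrite /is_arrow /is_vertex => /and3P[_ _ /orP[/eqP h|/eqP h]]; subst.
  by rewrite -[j]/(j.+1.-1) zi_up //; lia.
by rewrite -[in a_ k.+1 k]/(k.+1.-1) zi_down //; lia.
Qed.

Lemma zi_zX j : i_ j * X j = X j * i_ j.
Proof.
have [hj|/zi_out ->] := boolP (is_loop n j); last by rewrite mul0r mulr0.
have [->|j2] := eqVneq j 2%N; first exact: zi_X.
move: hj; rewrite /is_loop => hj.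
rewrite zXE; last lia.
by rewrite mulrA zi_za -?mulrA ?zi_za // /is_loop; lia.
Qed.

(** If [j] has a neighbour other than [l], taking the loop through it creates a straight path
    ([hm]). If [l = j - 1] is at least 2, the loop is moved to [l] and taken through [l - 1].
    Between the vertices 1 and 2 there is no such detour: e_2 is replaced by - (ie_2)^2, and moving
    one ie_2 past X_2 exposes (1|2)(ie_2)(2|1) = 0. *)
Lemma zX_za j k l : X j * a_ k l = 0.
Proof.
have [<-{k}|jk] := eqVneq j k; last exact: zX_za_ne.
have [hjl|/za_out ->] := boolP (is_arrow n j l); last by rewrite mulr0.
have hm : forall m, is_arrow n j m -> m != l -> X j * a_ j l = 0.
  by move=> m jm ml; rewrite -(zX_arrow jm) -mulrA za_straight ?mulr0.
have [j1|j1] := eqVneq j 1%N.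
  have l2 : l = 2%N by move: hjl; rewrite /is_arrow /is_vertex; lia.
  subst.
  have h2 : is_loop n 2 by move: hjl; rewrite /is_arrow /is_vertex /is_loop; lia.
  rewrite -(zX_arrow hjl) -mulrA zX_arrow 1?is_arrowC //.
  rewrite -zX_ze -[e 2]opprK -zi_sqr // !mulrN !mulrA -(mulrA _ (X 2)) -zi_zX zXE //=.
  by rewrite !mulrA zi_one !mul0r oppr0.
have [hl|hl] := eqVneq l j.-1; last first.
  by apply: (hm j.-1); [move: hjl; rewrite /is_arrow /is_vertex|]; lia.
subst l; have [j2|j2] := eqVneq j 2%N.
  subst j; have h2 : is_loop n 2 by move: hjl; rewrite /is_arrow /is_vertex /is_loop; lia.
  rewrite -ze_zX -[e 2]opprK -zi_sqr // !mulNr -!mulrA (mulrA (i_ 2) (X 2)) zi_zX zXE //=.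
  by rewrite -!mulrA (mulrA (a_ 1 2)) zi_one !mulr0 oppr0.
rewrite -(zX_arrow hjl) -mulrA zX_arrow 1?is_arrowC //.
have -> : X j.-1 = a_ j.-1 j.-2 * a_ j.-2 j.-1.
  by rewrite zX_arrow //; move: hjl; rewrite /is_arrow /is_vertex; lia.
by rewrite mulrA za_straight ?mul0r //; move: hjl; rewrite /is_arrow /is_vertex; lia.
Qed.

Lemma za_zX j k l : a_ j k * X l = 0.
Proof.
have [<-{l}|kl] := eqVneq k l; last exact: za_zX_ne.
have [hjk|/za_out ->] := boolP (is_arrow n j k); last by rewrite mul0r.
by rewrite -(@zX_arrow k j) 1?is_arrowC // mulrA zX_arrow // zX_za.
Qed.

Lemma zX_zX j k : X j * X k = 0.
Proof. have [->|k1] := eqVneq k 1%N; first by rewrite zX1E mulrA zX_za mul0r.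
by rewrite (zXE k1) mulrA zX_za mul0r. Qed.

(** Both [zpath_ia] and [zpath_ai] are listed because i passes through an arrow only when both ends
    carry a loop; at the vertex 1 only one of the two forms can be nonzero. *)
Inductive zpath : A -> Prop :=
  | zpath_e j : zpath (e j)
  | zpath_i j : zpath (i_ j)
  | zpath_X j : zpath (X j)
  | zpath_iX j : zpath (i_ j * X j)
  | zpath_a j k : zpath (a_ j k)
  | zpath_ia j k : zpath (i_ j * a_ j k)
  | zpath_ai j k : zpath (a_ j k * i_ k).

Inductive zspan : A -> Prop :=
  | zspan0 : zspan 0
  | zspanD x y : zspan x -> zspan y -> zspan (x + y)
  | zspanZ c x : zspan x -> zspan (c *: x)
  | zspan_path x : zpath x -> zspan x.

Lemma zspanN x : zspan x -> zspan (- x).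
Proof. by rewrite -scaleN1r; apply: zspanZ. Qed.

Lemma zpath_ze k x : zpath x -> zspan (e k * x).
Proof.
have H j y : zpath (e j * y) -> e j * (e j * y) = e j * y -> zspan (e k * (e j * y)).
  have [<-|kj] := eqVneq k j; first by move=> h ->; apply: zspan_path.
  by move=> _ _; rewrite mulrA ze_orth // mul0r; apply: zspan0.
case=> [j|j|j|j|j l|j l|j l].
- rewrite ze_mul; case: ifP => _; [exact/zspan_path/zpath_e|exact: zspan0].
- by rewrite -ze_zi; apply: H; rewrite ?ze_zi //; apply: zpath_i.
- by rewrite -ze_zX; apply: H; rewrite ?ze_zX //; apply: zpath_X.
- by rewrite -ze_zi -mulrA; apply: H; rewrite !mulrA ?zeK ?ze_zi //; apply: zpath_iX.
- by rewrite -ze_za; apply: H; rewrite ?ze_za //; apply: zpath_a.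
- by rewrite -ze_zi -mulrA; apply: H; rewrite !mulrA ?zeK ?ze_zi //; apply: zpath_ia.
- by rewrite -ze_za -mulrA; apply: H; rewrite !mulrA ?zeK ?ze_za //; apply: zpath_ai.
Qed.

Lemma zi_i_za_i j k : zspan (i_ j * (a_ j k * i_ k)).
Proof.
have [hj|/zi_out ->] := boolP (is_loop n j); last by rewrite mul0r; apply: zspan0.
have [hk|/zi_out ->] := boolP (is_loop n k); last by rewrite !mulr0; apply: zspan0.
rewrite mulrA zi_za // -mulrA zi_sqr // mulrN za_ze.
exact/zspanN/zspan_path/zpath_a.
Qed.

Lemma zpath_zi k x : zpath x -> zspan (i_ k * x).
Proof.
have [hk|/zi_out -> _] := boolP (is_loop n k); last by rewrite mul0r; apply: zspan0.
case=> [j|j|j|j|j l|j l|j l]; have [<-{j}|kj] := eqVneq k j.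
- by rewrite zi_ze; apply/zspan_path/zpath_i.
- by rewrite zi_ze_ne //; apply: zspan0.
- by rewrite zi_sqr //; apply/zspanN/zspan_path/zpath_e.
- by rewrite zi_zi_ne //; apply: zspan0.
- exact/zspan_path/zpath_iX.
- by rewrite zi_zX_ne //; apply: zspan0.
- by rewrite mulrA zi_sqr // mulNr ze_zX; apply/zspanN/zspan_path/zpath_X.
- by rewrite mulrA zi_zi_ne // mul0r; apply: zspan0.
- exact/zspan_path/zpath_ia.
- by rewrite zi_za_ne //; apply: zspan0.
- by rewrite mulrA zi_sqr // mulNr ze_za; apply/zspanN/zspan_path/zpath_a.
- by rewrite mulrA zi_zi_ne // mul0r; apply: zspan0.
- exact: zi_i_za_i.
- by rewrite mulrA zi_za_ne // mul0r; apply: zspan0.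
Qed.

Lemma zpath_za2 j k l : zspan (a_ j k * a_ k l).
Proof.
have [<-|jl] := eqVneq j l; last by rewrite za_straight //; apply: zspan0.
have [h|/za_out ->] := boolP (is_arrow n j k); last by rewrite mul0r; apply: zspan0.
by rewrite zX_arrow //; apply/zspan_path/zpath_X.
Qed.

Lemma za_zi_za j k l : is_loop n k -> ~~ is_loop n j -> a_ j k * i_ k * a_ k l = 0.
Proof.
move=> hk hj; have [h1|/za_out ->] := boolP (is_arrow n j k); last by rewrite !mul0r.
have [h2|/za_out ->] := boolP (is_arrow n k l); last by rewrite mulr0.
have [? ?] : j = 1%N /\ k = 2%N.
  by move: h1 hj; rewrite /is_arrow /is_loop /is_vertex; lia.
subst; have [->|l1] := eqVneq l 1%N; first exact: zi_one.
rewrite -mulrA zi_za ?mulrA ?za_straight ?mul0r 1?eq_sym //.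
by move: h2; rewrite /is_arrow /is_loop /is_vertex; lia.
Qed.

Lemma zpath_za j k x : zpath x -> zspan (a_ j k * x).
Proof.
case=> [l|l|l|l|l m|l m|l m]; have [<-{l}|kl] := eqVneq k l.
- by rewrite za_ze; apply/zspan_path/zpath_a.
- by rewrite za_ze_ne //; apply: zspan0.
- exact/zspan_path/zpath_ai.
- by rewrite za_zi_ne //; apply: zspan0.
- by rewrite za_zX; apply: zspan0.
- by rewrite za_zX; apply: zspan0.
- by rewrite zi_zX mulrA za_zX mul0r; apply: zspan0.
- by rewrite mulrA za_zi_ne // mul0r; apply: zspan0.
- exact: zpath_za2.
- by rewrite za_za_ne //; apply: zspan0.
- have [hk|/zi_out ->] := boolP (is_loop n k); last by rewrite mul0r mulr0; apply: zspan0.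
  have [hj|hj] := boolP (is_loop n j); last by rewrite mulrA za_zi_za //; apply: zspan0.
  rewrite mulrA -zi_za // -mulrA.
  have [<-|jl] := eqVneq j m; last by rewrite za_straight // mulr0; apply: zspan0.
  have [h|/za_out ->] := boolP (is_arrow n j k); last by rewrite mul0r mulr0; apply: zspan0.
  by rewrite zX_arrow //; apply/zspan_path/zpath_iX.
- by rewrite mulrA za_zi_ne // mul0r; apply: zspan0.
- rewrite mulrA; have [<-|jl] := eqVneq j m; last by rewrite za_straight // mul0r;
  apply: zspan0.
  have [h|/za_out ->] := boolP (is_arrow n j k); last by rewrite !mul0r; apply: zspan0.
  by rewrite zX_arrow // -zi_zX; apply/zspan_path/zpath_iX.
- by rewrite mulrA za_za_ne // mul0r; apply: zspan0.
Qed.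

Lemma zspan_mul g y : (forall x, zpath x -> zspan (g * x)) -> zspan y -> zspan (g * y).
Proof.
move=> H; elim=> [|y1 y2 _ h1 _ h2|c y1 _ h|y1 /H //].
- by rewrite mulr0; apply: zspan0.
- by rewrite mulrDr; apply: zspanD.
- by rewrite zscaleAr; apply: zspanZ.
Qed.

Lemma zigzag_ind (K : A -> Prop) : K 0 -> (forall x y, K x -> K y -> K (x + y)) ->
  (forall c x, K x -> K (c *: x)) -> (forall x y, K x -> K y -> K (x * y)) -> K 1 ->
  (forall j, K (e j)) -> (forall j, K (i_ j)) -> (forall j k, K (a_ j k)) ->
  forall x, K x.
Proof.
move=> K0 KD KZ KM K1 Ke Ki Ka; elim/(@lmq_ind _ (apres R n)).
elim=> [||[j|j k|j]|x hx y hy|c x hx|x hx y hy] //.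
- exact: Ke.
- exact: Ka.
- exact: Ki.
- by rewrite (lmpiD (P := apres R n)); apply: KD.
- by rewrite (lmpiZ (P := apres R n)); apply: KZ.
- by rewrite -zmulE; apply: KM.
Qed.

(** The span contains 1 and is stable under left multiplication by the generators. The induction is
    on the left factor, for an arbitrary element of the span on its right, so that products go
    through. *)
Lemma zspanT x : zspan x.
Proof.
rewrite -[x]mulr1; have : zspan (1 : A).
  rewrite zone; elim: (iota 1 n) => [|j s IH]; first by rewrite big_nil; apply: zspan0.
  by rewrite big_cons; apply: zspanD => //; apply/zspan_path/zpath_e.
move: (1 : A); elim/zigzag_ind: x => [|x y hx hy|c x hx|x y hx hy||j|j|j k] z hz.
- by rewrite mul0r; apply: zspan0.
- by rewrite mulrDl; apply: zspanD; auto.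
- by rewrite zscaleAl; apply: zspanZ; auto.
- by rewrite -mulrA; apply/hx/hy.
- by rewrite mul1r.
- by apply: zspan_mul => // *; apply: zpath_ze.
- by apply: zspan_mul => // *; apply: zpath_zi.
- by apply: zspan_mul => // *; apply: zpath_za.
Qed.

Definition zadj (s t : nat) := (t == s.+1) || (s == t.+1).

Lemma is_arrow_adj s t : is_arrow n s t -> zadj s t.
Proof. by case/and3P. Qed.

(** An induction principle for the corner e_s B_n e_t between distinct vertices: of the spanning
    paths only those from [s] to [t] survive, namely the arrow and its multiples by i. As [V] is
    only closed under real combinations, these multiples are separate premises. *)
Lemma corner_sandwich (V : A -> Prop) s t x : V 0 -> (forall x y, V x -> V y -> V (x + y)) ->
  (forall c x, V x -> V (c *: x)) -> s != t -> V (a_ s t) -> V (i_ s * a_ s t) ->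
  V (a_ s t * i_ t) -> V (e s * x * e t).
Proof.
move=> V0 VD VZ st Va Vi Vi'; elim: {x}(zspanT x) => [|x y _ hx _ hy|c x _ hx|x].
- by rewrite mulr0 mul0r.
- by rewrite mulrDr mulrDl; apply: VD.
- by rewrite zscaleAr zscaleAl; apply: VZ.
have H j k y : e j * y * e k = y -> (s == j -> t == k -> V y) -> V (e s * y * e t).
  move=> hy; case: eqVneq => [->|sj] h; last by rewrite -hy !mulrA ze_orth // !mul0r.
  case: eqVneq h => [->|tk] h; first by rewrite hy; apply: h.
  by rewrite -hy -!mulrA ze_orth 1?eq_sym // !mulr0.
have ne j : s == j -> t == j -> V (e j) /\ V (i_ j) /\ V (X j) /\ V (i_ j * X j).
  by move=> /eqP h /eqP h'; rewrite h h' eqxx in st.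
case=> [j|j|j|j|j k|j k|j k].
- by apply: (@H j j); rewrite ?zeK // => h /(ne _ h) [].
- by apply: (@H j j); rewrite ?ze_zi ?zi_ze // => h /(ne _ h) [_ []].
- by apply: (@H j j); rewrite ?ze_zX ?zX_ze // => h /(ne _ h) [_ [_ []]].
- by apply: (@H j j); rewrite -?mulrA ?zX_ze ?mulrA ?ze_zi // => h /(ne _ h) [_ [_ []]].
- by apply: (@H j k); rewrite ?ze_za ?za_ze // => /eqP <- /eqP <-.
- by apply: (@H j k); rewrite ?mulrA ?ze_zi -?mulrA ?za_ze // => /eqP <- /eqP <-.
- by apply: (@H j k); rewrite ?mulrA ?ze_za -?mulrA ?zi_ze // => /eqP <- /eqP <-.
Qed.

Lemma corner_far s t x : s != t -> ~~ zadj s t -> e s * x * e t = 0.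
Proof.
move=> st h; have h0 : a_ s t = 0 by apply: za_out; apply: contra h; apply: is_arrow_adj.
apply: (@corner_sandwich (fun y => y = 0)) => //; rewrite ?h0 ?mulr0 ?mul0r //.
- by move=> ? ? -> ->; rewrite addr0.
- by move=> c ? ->; rewrite scaler0.
Qed.

Lemma zX_deg j : zdeg 2 (X j).
Proof. by rewrite zXlE /zX; case: ifP => _; apply: (@zdegM _ _ 1 1); apply: zdeg_a. Qed.

End ZigzagRelations.

(** * Detecting X_j: the left modules P_j *)

(* The left module P_j over C, on the basis e_j, (j-1|j), (j+1|j), X_j.  For  *)
(* j = 1 the basis is e_1, (2|1), ie_2 (2|1), X_1, and for j = n the missing   *)
(* third vector is replaced by a simple summand at the vertex n.               *)
Section Representation.
Variables (R : realType) (n j : nat).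
Local Notation C := (R[i]).

Definition rep_lab (r : nat) : nat :=
  match r with
  | 1 => if j == 1 then 2 else j.-1
  | 2 => if j == 1 then 2 else if j < n then j.+1 else j
  | _ => j
  end%N.

Definition rep_edge (r c : nat) : bool :=
  match r, c with
  | 1, 0 | 3, 1 => true
  | 2, 0 | 3, 2 => (1 < j < n)%N
  | _, _ => false
  end%N.

Definition rep_vtx k : 'M[C]_4 := \matrix_(r, c) ((r == c :> nat) && (rep_lab r == k))%:R.
(** The action of all the arrows at once; a single arrow is cut out of it by the vertex
    projections. *)
Definition rep_N : 'M[C]_4 := \matrix_(r, c) (rep_edge r c)%:R.
Definition rep_top : 'M[C]_4 := \matrix_(r, c) ((r == 3 :> nat) && (c == 0 :> nat))%:R.
Definition rep_arr k l : 'M[C]_4 :=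
  if is_arrow n k l then rep_vtx k *m rep_N *m rep_vtx l else 0.
Definition rep_loop k : 'M[C]_4 :=
  if j == 1%N then \matrix_(r, c) (((k == 2) && (r == 2 :> nat) && (c == 1 :> nat))%:R
                                  - ((k == 2) && (r == 1 :> nat) && (c == 2 :> nat))%:R)
  else (if is_loop n k then 'i%C else 0) *: rep_vtx k.

Definition rep_gen (g : qgen) : 'M[C]_4 :=
  match g with
  | Qvtx k => rep_vtx k
  | Qarr k l => rep_arr k l
  | Qloop k => rep_loop k
  end.

Fixpoint rep_term (x : aterm R) : 'M[C]_4 :=
  match x with
  | Azero => 0
  | Aone => 1%:M
  | Agen g => rep_gen g
  | Aadd x y => rep_term x + rep_term y
  | Ascale a x => (a%:C)%C *: rep_term x
  | Amul x y => rep_term x *m rep_term y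
  end.

Hypotheses (j_gt0 : (0 < j)%N) (j_le_n : (j <= n)%N) (n_ge2 : (2 <= n)%N).

Lemma rep_vtx_mulE k p (M : 'M[C]_(4, p)) r c : (rep_vtx k *m M)
  r c = (rep_lab r == k)%:R * M r c.
Proof.
rewrite mxE (bigD1 r) //= mxE eqxx /= big1 ?addr0 // => i ir.
by rewrite mxE -[X in X && _]/(r == i) eq_sym (negbTE ir) mul0r.
Qed.
Lemma rep_mul_vtxE k p (M : 'M[C]_(p, 4)) r c : (M *m rep_vtx k)
  r c = M r c * (rep_lab c == k)%:R.
Proof.
rewrite mxE (bigD1 c) //= mxE eqxx /= big1 ?addr0 // => i ir.
by rewrite mxE -[X in X && _]/(i == c) (negbTE ir) mulr0.
Qed.

Lemma rep_vtxM k l : rep_vtx k *m rep_vtx l = if k == l then rep_vtx k else 0.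
Proof.
apply/matrixP => r c; rewrite rep_vtx_mulE mxE; case: (eqVneq k l) => [<-|kl]; rewrite ?mxE.
  by case: eqVneq => _; rewrite ?mul1r ?mul0r ?andbF.
by case: eqVneq => h; rewrite ?mul0r // h (negbTE kl) andbF mulr0.
Qed.

Lemma rep_vtx_top k : rep_vtx k *m rep_top = (k == j)%:R *: rep_top.
Proof.
apply/matrixP => r c; rewrite rep_vtx_mulE !mxE.
case: (eqVneq (r : nat) 3%N) => [->|_] /=; last by rewrite !mulr0.
by rewrite eq_sym.
Qed.
Lemma rep_top_vtx k : rep_top *m rep_vtx k = (k == j)%:R *: rep_top.
Proof.
apply/matrixP => r c; rewrite rep_mul_vtxE !mxE andbC mulrC.
by case: (eqVneq (c : nat) 0%N) => [->|_] /=; rewrite ?mulr0 // eq_sym.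
Qed.

(** The number of two-step ways from e_j to X_j through the vertex [l]. *)
Definition rep_cnt l : nat := (l == rep_lab 1) + (1 < j < n)%N * (l == j.+1).

Lemma rep_NvN k : rep_N *m rep_vtx k *m rep_N = (rep_cnt k)%:R *: rep_top.
Proof.
apply/matrixP => r c; rewrite !mxE !big_ord_recr big_ord0 /= !rep_mul_vtxE !mxE /=.
move: r c => [[|[|[|[|//]]]] /= ?] [[|[|[|[|//]]]] /= ?].
all: rewrite ?(mul0r, mulr0, addr0, add0r, mul1r, mulr1) //.
rewrite /rep_cnt eq_sym natrD natrM; congr (_ + _).
case: (boolP (1 < j < n)%N) => h; last by rewrite !mul0r.
by rewrite ifF ?ifT 1?eq_sym ?mul1r ?mulr1 //; lia.
Qed.

Lemma rep_vtx_arr k l : rep_vtx k *m rep_arr k l = rep_arr k l.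
Proof. by rewrite /rep_arr; case: ifP; rewrite ?mulmx0 // !mulmxA rep_vtxM eqxx. Qed.
Lemma rep_arr_vtx k l : rep_arr k l *m rep_vtx l = rep_arr k l.
Proof. by rewrite /rep_arr; case: ifP; rewrite ?mul0mx // -!mulmxA rep_vtxM eqxx. Qed.

Lemma rep_arrM k l m : rep_arr k l *m rep_arr l m =
  [&& is_arrow n k l, is_arrow n l m, k == j & m == j]%:R * (rep_cnt l)%:R *: rep_top.
Proof.
rewrite /rep_arr; case: (is_arrow n k l) => /=; last by rewrite mul0mx mul0r scale0r.
case: (is_arrow n l m) => /=; last by rewrite mulmx0 mul0r scale0r.
rewrite -!mulmxA (mulmxA (rep_vtx l)) rep_vtxM eqxx !mulmxA -(mulmxA (rep_vtx k))
  -(mulmxA (rep_vtx k)).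
rewrite rep_NvN -scalemxAr rep_vtx_top scalerA -scalemxAl rep_top_vtx scalerA.
by case: (k == j); case: (m == j); rewrite /= ?(mul0r, mulr0, mul1r, mulr1).
Qed.

Lemma rep_zigzag k : (2 <= k <= n.-1)%N ->
  rep_arr k k.-1 *m rep_arr k.-1 k = rep_arr k k.+1 *m rep_arr k.+1 k.
Proof.
move=> h; rewrite !rep_arrM -!natrM; congr ((_%:R : C) *: _).
rewrite /rep_cnt /= /is_arrow /is_vertex.
case: (eqVneq k j) => kj; last by rewrite !andbF.
case: (eqVneq j 1%N) => j1; lia.
Qed.
Lemma rep_straight k l m : k != m -> rep_arr k l *m rep_arr l m = 0.
Proof.
move=> h; rewrite rep_arrM; case: (eqVneq k j) => kj; last by rewrite !andbF mul0r scale0r.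
by rewrite -kj eq_sym (negbTE h) !andbF mul0r scale0r.
Qed.

Lemma rep_one : \sum_(k <- iota 1 n) rep_vtx k = 1%:M.
Proof.
apply/matrixP => r c; rewrite summxE.
under eq_bigr do rewrite mxE -[X in X && _]/(r == c).
rewrite mxE; case: (r == c) => /=; last by rewrite big1.
rewrite -natr_sum (_ : (\sum_(k <- _) _)%N = count_mem (rep_lab r) (iota 1 n)); last first.
  by rewrite -sum1_count [RHS]big_mkcond; apply: eq_bigr => k _; rewrite eq_sym /=; case: ifP.
rewrite count_uniq_mem ?iota_uniq // mem_iota.
suff -> : (1 <= rep_lab r < 1 + n)%N by [].
move: r => [[|[|[|[|//]]]] /= ?]; repeat case: ifP => ?; lia.
Qed.

Lemma rep_vtx_out k : ~~ is_vertex n k -> rep_vtx k = 0.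
Proof.
move=> h; apply/matrixP => r c; rewrite !mxE; case: (eqVneq (rep_lab r) k) => hk;
  last by rewrite andbF.
move: h; rewrite -hk /is_vertex; move: r {hk} => [[|[|[|[|//]]]] /= ?];
  repeat case: ifP => ?; lia.
Qed.

Lemma rep_loop_vtx k : j != 1%N -> rep_loop k = (if is_loop n k then 'i%C else 0) *: rep_vtx k.
Proof. by rewrite /rep_loop => /negbTE ->. Qed.

Lemma rep_loop1E k (r c : 'I_4) : j = 1%N -> rep_loop k r c =
  ((k == 2) && (r == 2 :> nat) && (c == 1 :> nat))%:R
   - ((k == 2) && (r == 1 :> nat) && (c == 2 :> nat))%:R.
Proof. by rewrite /rep_loop => ->; rewrite mxE. Qed.

Lemma rep_loop_out k : ~~ is_loop n k -> rep_loop k = 0.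
Proof.
move=> h; case: (eqVneq j 1%N) => j1; last by rewrite rep_loop_vtx // (negbTE h) scale0r.
apply/matrixP => r c; rewrite rep_loop1E // mxE.
by case: eqP h => [->|_ _]; rewrite /= ?subr0 // /is_loop /= n_ge2.
Qed.

Lemma rep_vtx_loop k : rep_vtx k *m rep_loop k = rep_loop k.
Proof.
case: (eqVneq j 1%N) => j1; last by rewrite rep_loop_vtx // -scalemxAr rep_vtxM eqxx.
apply/matrixP => r c; rewrite rep_vtx_mulE rep_loop1E // /rep_lab j1 /=.
case: (eqVneq k 2%N) => [->|_] /=; last by rewrite subr0 mulr0.
by move: r => [[|[|[|[|//]]]] /= ?]; rewrite ?mul1r ?subr0 ?mulr0.
Qed.
Lemma rep_loop_vtxr k : rep_loop k *m rep_vtx k = rep_loop k.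
Proof.
case: (eqVneq j 1%N) => j1; last by rewrite rep_loop_vtx // -scalemxAl rep_vtxM eqxx.
apply/matrixP => r c; rewrite rep_mul_vtxE rep_loop1E // /rep_lab j1 /=.
case: (eqVneq k 2%N) => [->|_] /=; last by rewrite subr0 mul0r.
by move: c => [[|[|[|[|//]]]] /= ?]; rewrite ?mulr1 ?andbF ?subr0 ?mul0r.
Qed.

Lemma rep_loop_sqr k : is_loop n k -> rep_loop k *m rep_loop k = - rep_vtx k.
Proof.
move=> hk; case: (eqVneq j 1%N) => j1; last first.
  by rewrite rep_loop_vtx // hk -scalemxAl -scalemxAr rep_vtxM eqxx scalerA -expr2 sqr_i
    scaleN1r.
apply/matrixP => r c; rewrite !mxE !big_ord_recr big_ord0 /= !rep_loop1E // /rep_lab j1 /=.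
case: (eqVneq k 2%N) => [->|k2] /=.
  move: r c => [[|[|[|[|//]]]] /= ?] [[|[|[|[|//]]]] /= ?];
  by rewrite ?(subr0, mulr0, mul0r, addr0, add0r, sub0r, mulrN, mulNr, mul1r, oppr0).
rewrite !subr0 !mulr0 !addr0; move: hk k2; rewrite /is_loop.
move=> hk k2; have [h1 h2] : (1%N == k) = false /\ (2%N == k) = false by lia.
by move: r => [[|[|[|[|//]]]] /= ?]; rewrite ?h1 ?h2 andbF oppr0.
Qed.

Lemma rep_vtx1_out k : j = 1%N -> (2 < k)%N -> rep_vtx k = 0.
Proof.
move=> j1 hk; apply/matrixP => r c; rewrite !mxE /rep_lab j1 /=.
have [h1 h2] : (1%N == k) = false /\ (2%N == k) = false by lia.
by move: r => [[|[|[|[|//]]]] /= ?]; rewrite ?h1 ?h2 andbF.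
Qed.

(** For [j = 1] both sides vanish: of two distinct vertices with loops one exceeds 2, and no basis
    vector of P_1 sits there. *)
Lemma rep_loop_arr k l : is_loop n k -> is_loop n l -> k != l ->
  rep_loop k *m rep_arr k l = rep_arr k l *m rep_loop l.
Proof.
move=> hk hl kl; case: (eqVneq j 1%N) => j1; last first.
  by rewrite !rep_loop_vtx // hk hl -scalemxAl -scalemxAr rep_vtx_arr rep_arr_vtx.
suff -> : rep_arr k l = 0 by rewrite mulmx0 mul0mx.
rewrite /rep_arr; case: ifP => // _; have [h|h] : ((2 < k) \/ (2 < l))%N.
  by move: hk hl kl; rewrite /is_loop; lia.
- by rewrite rep_vtx1_out // !mul0mx.
- by rewrite (@rep_vtx1_out l) // mulmx0.
Qed.

Lemma rep_i_one : rep_arr 1 2 *m rep_loop 2 *m rep_arr 2 1 = 0.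
Proof.
case: (eqVneq j 1%N) => j1; last first.
  by rewrite rep_loop_vtx // -scalemxAr rep_arr_vtx -scalemxAl rep_arrM (eq_sym 1%N) (negbTE j1)
    !andbF mul0r scale0r scaler0.
rewrite /rep_arr; case: ifP => _; rewrite ?mul0mx //; case: ifP => _; rewrite ?mulmx0 //.
rewrite -!mulmxA (mulmxA (rep_vtx 2) (rep_loop 2)) rep_vtx_loop (mulmxA (rep_loop 2))
  rep_loop_vtxr.
suff h : rep_N *m (rep_loop 2 *m rep_N) = 0.
  by rewrite (mulmxA (rep_loop 2)) (mulmxA rep_N) h mul0mx mulmx0.
apply/matrixP => r c; rewrite !mxE !big_ord_recr big_ord0 /= !mxE !big_ord_recr !big_ord0 /=.
rewrite !rep_loop1E // !mxE /= /rep_edge j1 /=.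
move: r c => [[|[|[|[|//]]]] /= ?] [[|[|[|[|//]]]] /= ?];
by rewrite ?(subr0, mulr0, mul0r, addr0, add0r, sub0r, mulrN, mulNr, mul1r, oppr0).
Qed.

Lemma rep_i_X : rep_loop 2 *m (rep_arr 2 1 *m rep_arr 1 2)
  = rep_arr 2 1 *m rep_arr 1 2 *m rep_loop 2.
Proof.
case: (eqVneq j 1%N) => j1; last first.
  by rewrite rep_loop_vtx // -scalemxAl mulmxA rep_vtx_arr -scalemxAr -mulmxA rep_arr_vtx.
by rewrite rep_arrM j1 !andbF mul0r scale0r mulmx0 mul0mx.
Qed.

Lemma real_complexD (a b : R) : ((a + b)%:C = a%:C + b%:C)%C.
Proof. exact: (rmorphD (real_complex R)). Qed.
Lemma real_complexM (a b : R) : ((a * b)%:C = a%:C * b%:C)%C.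
Proof. exact: (rmorphM (real_complex R)). Qed.

Lemma rep_term_eq x y : aeq n x y -> rep_term x = rep_term y.
Proof.
elim=> //=; try by move=> *; congruence.
- by move=> *; rewrite addrA.
- by move=> *; rewrite addrC.
- by move=> *; rewrite add0r.
- by move=> *; rewrite scalerA real_complexM.
- by move=> *; rewrite scale1r.
- by move=> *; rewrite scalerDr.
- by move=> *; rewrite real_complexD scalerDl.
- by move=> *; rewrite scale0r.
- by move=> *; rewrite mulmxA.
- by move=> *; rewrite mul1mx.
- by move=> *; rewrite mulmx1.
- by move=> *; rewrite mulmxDl.
- by move=> *; rewrite mulmxDr.
- by move=> *; rewrite -scalemxAl.
- by move=> *; rewrite -scalemxAr.
- exact: rep_vtx_out.
- by move=> k l /negbTE h; rewrite /rep_arr h.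
- exact: rep_loop_out.
- rewrite -rep_one; elim: (iota 1 n) => [|k s IH]; first by rewrite big_nil.
  by rewrite big_cons IH.
- by move=> k; rewrite rep_vtxM eqxx.
- by move=> k l /negbTE h; rewrite rep_vtxM h.
- exact: rep_vtx_arr.
- exact: rep_arr_vtx.
- exact: rep_vtx_loop.
- exact: rep_loop_vtxr.
- exact: rep_zigzag.
- by move=> k h; apply: rep_straight; lia.
- by move=> k h; apply: rep_straight; lia.
- move=> k h; rewrite rep_loop_sqr // (_ : (_%:C)%C = -1 :> C) ?scaleN1r //.
  exact: (rmorphN1 (real_complex R)).
- by move=> k h; apply: rep_loop_arr; rewrite /is_loop; lia.
- by move=> k h; apply: rep_loop_arr; rewrite /is_loop; lia.
- exact: rep_i_one.
- exact: rep_i_X.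
Qed.

Definition rep (x : zigzag R n) : 'M[C]_4 := rep_term (lmrepr (P := apres R n) x).

Lemma rep_pi x : rep (lmpi (P := apres R n) x) = rep_term x.
Proof. exact/rep_term_eq/(@lmreprK _ (apres R n)). Qed.
Lemma repD x y : rep (x + y) = rep x + rep y.
Proof.
elim/(@lmq_ind _ (apres R n)): x => x; elim/(@lmq_ind _ (apres R n)): y => y.
by rewrite -lmpiD !rep_pi.
Qed.
Lemma repZ a x : rep (a *: x) = (a%:C)%C *: rep x.
Proof. by elim/(@lmq_ind _ (apres R n)): x => x; rewrite -lmpiZ !rep_pi. Qed.
Lemma repM x y : rep (x * y) = rep x *m rep y.
Proof.
elim/(@lmq_ind _ (apres R n)): x => x; elim/(@lmq_ind _ (apres R n)): y => y.
by rewrite [_ * _]zmulE !rep_pi.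
Qed.
Lemma rep1 : rep 1 = 1%:M. Proof. by rewrite -[1]/(lmpi (P := apres R n) (Aone R)) rep_pi. Qed.

(** The degrees of the four basis vectors. For [j = n] the third one spans a separate simple
    summand, so its degree can be chosen freely. *)
Definition rep_deg (r : nat) : int := if r == 0%N then 0 else if r == 3%N then 2 else 1.

Lemma rep_graded d x : zdeg d x ->
  forall r c : 'I_4, rep x r c != 0 -> d = rep_deg r - rep_deg c.
Proof.
elim=> {d x} [d|d x y _ hx _ hy|d a x _ hx|d d' x y _ hx _ hy||k|k|k l] r c.
- by rewrite -(scale0r (0 : zigzag R n)) repZ mxE mul0r eqxx.
- rewrite repD mxE; case: (eqVneq (rep x r c) 0) => [->|h _]; last exact: hx.
  by rewrite add0r; apply: hy.
- by rewrite repZ mxE mulf_eq0 negb_or => /andP[_]; apply: hx.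
- rewrite repM mxE => h.
  have /existsP [s hs] : [exists s, rep x r s * rep y s c != 0].
    apply/contraT; rewrite negb_exists => /forallP h0; case/negP: h; apply/eqP/big1 => s _.
    by apply/eqP; rewrite -[_ == _]negbK.
  move: hs; rewrite mulf_eq0 negb_or => /andP[/hx -> /hy ->]; ring.
- by rewrite rep1 mxE; case: (eqVneq r c) => [->|]; rewrite ?eqxx // subrr.
- by rewrite rep_pi mxE -[X in X && _]/(r == c); case: (eqVneq r c) => [->|];
  rewrite ?eqxx // subrr.
- rewrite rep_pi /=; case: (eqVneq j 1%N) => j1; last first.
    rewrite rep_loop_vtx // !mxE -[X in X && _]/(r == c).
    by case: (eqVneq r c) => [->|]; rewrite ?mulr0 ?eqxx // subrr.
  rewrite rep_loop1E //.
  by move: r c => [[|[|[|[|//]]]] /= ?] [[|[|[|[|//]]]] /= ?];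
    rewrite /rep_deg ?andbF ?subr0 ?subrr ?eqxx.
- rewrite rep_pi /= /rep_arr; case: ifP => _; last by rewrite mxE eqxx.
  rewrite rep_mul_vtxE rep_vtx_mulE !mxE.
  by move: r c => [[|[|[|[|//]]]] /= ?] [[|[|[|[|//]]]] /= ?];
    rewrite /rep_deg ?(mulr0, mul0r) ?eqxx.
Qed.

End Representation.

(** * The form phi: the coefficient of X_j *)

Section TraceForm.
Variables (R : realType) (n j : nat).
Local Notation A := (zigzag R n).
Local Notation e j := (ze R n j).
Local Notation i_ j := (zi R n j).
Local Notation a_ j k := (za R n j k).
Local Notation X j := (zXl R n j).

Lemma Femb_span (k : Fld R j) : exists a b, Femb n k = a *: e j + b *: i_ j.
Proof.
rewrite /Femb /Fld in k *; case: (j == 1%N) k => k;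
  last by exists (complex.Re k), (complex.Im k).
by exists k, 0; rewrite scale0r addr0.
Qed.

(** For [j = 1] the imaginary part disappears because ie_1 is 0 in the algebra; this lets one
    formula serve both fields. *)
Lemma span_Femb a b : exists k : Fld R j, a *: e j + b *: i_ j = Femb n k.
Proof.
rewrite /Femb /Fld; case: eqP => [->|_]; last by exists (Complex a b).
by exists a; rewrite zi_out // scaler0 addr0.
Qed.

(* The coefficient of X_j, an element of F_j, seen in e_j B_n e_j.             *)
Definition phi : A -> A := locked (fun x =>
  let z := rep j x ord_max ord0 in complex.Re z *: e j + complex.Im z *: i_ j).

Lemma phiE x : phi x = complex.Re (rep j x ord_max ord0) *: e j
                       + complex.Im (rep j x ord_max ord0) *: i_ j.
Proof. by rewrite /phi -lock. Qed.

Lemma phi_Femb x : exists k : Fld R j, phi x = Femb n k.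
Proof. rewrite phiE; exact: span_Femb. Qed.

Lemma phi_el x : e j * phi x = phi x.
Proof. by rewrite !phiE mulrDr !zscaleAr zeK ze_zi. Qed.
Lemma phi_er x : phi x * e j = phi x.
Proof. by rewrite !phiE mulrDl !zscaleAl zeK zi_ze. Qed.

Hypotheses (j_gt0 : (0 < j)%N) (j_le_n : (j <= n)%N) (n_ge2 : (2 <= n)%N).

Lemma phiD x y : phi (x + y) = phi x + phi y.
Proof.
rewrite !phiE repD // mxE; case: (rep j x _ _) => a b; case: (rep j y _ _) => c d /=.
by rewrite !scalerDl addrACA.
Qed.
Lemma phiZ c x : phi (c *: x) = c *: phi x.
Proof.
rewrite !phiE repZ // mxE; case: (rep j x _ _) => a b /=.
by rewrite !mul0r subr0 addr0 scalerDr !scalerA.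
Qed.
Lemma phi0 : phi 0 = 0.
Proof. by rewrite -{1}(scale0r (0 : A)) phiZ scale0r. Qed.
Lemma phiM_el x : phi (e j * x) = phi x.
Proof. by rewrite !phiE repM // [rep j (e j)]rep_pi // rep_vtx_mulE /= eqxx mul1r. Qed.
Lemma phiM_er x : phi (x * e j) = phi x.
Proof. by rewrite !phiE repM // [rep j (e j)]rep_pi // rep_mul_vtxE /= eqxx mulr1. Qed.

Lemma phiM_il x : phi (i_ j * x) = i_ j * phi x.
Proof.
have [->|j1] := eqVneq j 1%N; first by rewrite (@zi_out _ _ 1) // !mul0r phi0.
have jl : is_loop n j by rewrite /is_loop; lia.
rewrite !phiE repM // [rep j (i_ j)]rep_pi // [rep_term _ _ _]rep_loop_vtx // jl -scalemxAl mxE.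
rewrite rep_vtx_mulE /= eqxx mul1r; case: (rep j x _ _) => a b /=.
rewrite mulrDr !zscaleAr zi_ze zi_sqr // !mul0r !mul1r ?(add0r, addr0, sub0r, scaleNr, scalerN).
by rewrite addrC.
Qed.
Lemma phiM_ir x : phi (x * i_ j) = phi x * i_ j.
Proof.
have [->|j1] := eqVneq j 1%N; first by rewrite (@zi_out _ _ 1) // !mulr0 phi0.
have jl : is_loop n j by rewrite /is_loop; lia.
rewrite !phiE repM // [rep j (i_ j)]rep_pi // [rep_term _ _ _]rep_loop_vtx // jl -scalemxAr mxE.
rewrite rep_mul_vtxE /= eqxx mulr1; case: (rep j x _ _) => a b /=.
rewrite mulrDl !zscaleAl ze_zi zi_sqr // !mul0r !mul1r ?(add0r, addr0, sub0r, scaleNr, scalerN).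
by rewrite addrC.
Qed.

Lemma phiM_Fr (k : Fld R j) x : phi (x * Femb n k) = phi x * Femb n k.
Proof.
have [a [b ->]] := Femb_span k.
by rewrite !mulrDr !zscaleAr phiD !phiZ phiM_er phiM_ir phi_er.
Qed.
Lemma phiM_phir x y : phi (x * phi y) = phi x * phi y.
Proof. by have [k ->] := phi_Femb y; rewrite phiM_Fr. Qed.

Lemma phi_X : phi (X j) = e j.
Proof.
(* A neighbour of [j]: X_j is the loop through it, and [rep_cnt] counts exactly one way through this
   vertex. *)
set m := (if j == 1 then 2 else j.-1)%N.
have jm : is_arrow n j m by rewrite /is_arrow /is_vertex /m; case: eqP => ?; lia.
rewrite -(@zX_arrow R n j m jm) !phiE repM // [rep j (a_ j m)]rep_pi // [rep j (a_ m
  j)]rep_pi //.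
rewrite rep_arrM // !mxE jm is_arrowC jm !eqxx /= /rep_cnt (_ : (m == _) = true) //=;
  last exact: eqxx.
rewrite (_ : ((1 < j < n)%N * (m == j.+1))%N = 0%N) /=; last by rewrite /m;
  case: (eqVneq j 1%N) => ?; lia.
by rewrite ?mulr1 /= !(mulr0, mul0r, subr0, addr0, scale1r, scale0r).
Qed.

Lemma phi_e : phi (e j) = 0.
Proof. by rewrite !phiE [rep j (e j)]rep_pi // mxE /= !scale0r addr0. Qed.

(** The matrix entry read by phi goes from e_j in degree 0 to X_j in degree 2. This makes delta_j
    homogeneous. *)
Lemma phi_deg d x : zdeg d x -> phi x = 0 \/ d = 2.
Proof.
move=> hx; have h := @rep_graded R n j j_gt0 j_le_n n_ge2 d x hx ord_max ord0.
rewrite !phiE; case: (eqVneq (rep j x ord_max ord0) 0) => [->|/h ->]; last by right.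
by left; rewrite /= !scale0r addr0.
Qed.
End TraceForm.

(** * The bimodules U_j *)

Section BimoduleU.
Variables (R : realType) (n : nat).
Local Notation A := (zigzag R n).
Local Notation e j := (ze R n j).
Local Notation i_ j := (zi R n j).
Local Notation U j := (bU R n j).

Section OneVertex.
Variable j : nat.
Local Notation u := (@u_ R n j).

Let plD a b : pl j (a + b) = pl j a + pl j b :> projL R n j.
Proof. by apply: projL_inj; rewrite projL_D /= mulrDl. Qed.
Let plZ c a : pl j (c *: a) = c *: pl j a :> projL R n j.
Proof. by apply: projL_inj; rewrite projL_Z /= zscaleAl. Qed.
Let prD a b : pr j (a + b) = pr j a + pr j b :> projR R n j.
Proof. by apply: projR_inj; rewrite projR_D /= mulrDr. Qed.
Let prZ c a : pr j (c *: a) = c *: pr j a :> projR R n j.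
Proof. by apply: projR_inj; rewrite projR_Z /= zscaleAr. Qed.

Lemma u_Dl a b c : u (a + b) c = u a c + u b c.
Proof. by rewrite /u_ plD; apply: tpureDl. Qed.
Lemma u_Dr a b c : u a (b + c) = u a b + u a c.
Proof. by rewrite /u_ prD; apply: tpureDr. Qed.
Lemma u_Zl k a b : u (k *: a) b = k *: u a b.
Proof. by rewrite /u_ plZ; apply: tpureZl. Qed.
Lemma u_Zr k a b : u a (k *: b) = k *: u a b.
Proof. by rewrite /u_ prZ; apply: tpureZr. Qed.
Lemma u_0l b : u 0 b = 0. Proof. by rewrite -(scale0r (0 : A)) u_Zl scale0r. Qed.
Lemma u_0r a : u a 0 = 0. Proof. by rewrite -(scale0r (0 : A)) u_Zr scale0r. Qed.
Lemma u_Nl a b : u (- a) b = - u a b. Proof. by rewrite -scaleN1r u_Zl scaleN1r. Qed.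
Lemma u_Nr a b : u a (- b) = - u a b. Proof. by rewrite -scaleN1r u_Zr scaleN1r. Qed.
Lemma u_er a b : u (a * e j) b = u a b.
Proof. by congr tpure; apply: projL_inj; rewrite /= -mulrA zeK. Qed.
Lemma u_el a b : u a (e j * b) = u a b.
Proof. by congr tpure; apply: projR_inj; rewrite /= mulrA zeK. Qed.
Lemma u_1l b : u 1 b = u (e j) b. Proof. by rewrite -[RHS]u_er zeK -[e j]mul1r u_er. Qed.
Lemma u_F (k : Fld R j) a b : u (a * Femb n k) b = u a (Femb n k * b).
Proof.
rewrite /u_ (_ : pl j (a * _) = projL_F (pl j a) k); last first.
  by apply: projL_inj; rewrite projL_FE /= -!mulrA Femb_r Femb_l.
rewrite (_ : pr j (_ * b) = projR_F k (pr j b)); last first.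
  by apply: projR_inj; rewrite projR_FE /= !mulrA Femb_r Femb_l.
exact: tpure_bal.
Qed.
Lemma u_i a b : u (a * i_ j) b = u a (i_ j * b).
Proof. by have [k] := @span_Femb R n j 0 1; rewrite scale0r add0r scale1r => ->;
  apply: u_F. Qed.
Lemma u_phi a x b : u (a * phi j x) b = u a (phi j x * b).
Proof. by have [k ->] := phi_Femb j x; apply: u_F. Qed.

Lemma bl_u x a b : bl x (u a b : U j) = u (x * a) b.
Proof.
rewrite /u_ [LHS]tlaE; last 2 first.
- exact: projL_actP.
- exact: projL_act_F.
by congr tpure; apply: projL_inj; rewrite projL_actE /= mulrA.
Qed.
Lemma br_u x a b : br (u a b : U j) x = u a (b * x).
Proof.
rewrite /u_ [LHS]traE; last 2 first.
- exact: projR_actP.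
- exact: projR_act_F.
by congr tpure; apply: projR_inj; rewrite projR_actE /= mulrA.
Qed.

Lemma U_ind (Q : U j -> Prop) : (forall a b, Q (u a b)) ->
  (forall x y, Q x -> Q y -> Q (x + y)) -> forall x, Q x.
Proof.
move=> Qu QD; apply: tensor_ind => // m p.
suff -> : tpure m p = u (projL_val m) (projR_val p) :> U j by [].
by congr tpure; [apply: projL_inj; rewrite /= projL_e|apply: projR_inj; rewrite /= projR_e].
Qed.

(** The shift in U_j accounts for the [- 1]. *)
Lemma bdeg_U_ind (Q : U j -> Prop) k : Q 0 -> (forall x y, Q x -> Q y -> Q (x + y)) ->
  (forall c x, Q x -> Q (c *: x)) ->
  (forall d d' a b, zdeg d a -> zdeg d' b -> k = d + d' - 1 -> Q (u a b)) ->
  forall x : U j, bdeg k x -> Q x.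
Proof.
move=> Q0 QD QZ Qu x; rewrite -[k](addrK 1); move: (k + 1) (addrK 1 k) => D Dk.
rewrite /= subrK => hx; elim: hx Dk => {D x} [D|D x y _ hx _ hy|D c x _ hx|d d' p q dp dq] Dk.
- exact: Q0.
- by apply: QD; auto.
- by apply: QZ; auto.
- have -> : tpure p q = u (projL_val p) (projR_val q) :> U j.
    by congr tpure; [apply: projL_inj; rewrite /= projL_e|apply: projR_inj; rewrite /= projR_e].
  exact: (Qu d d' _ _ dp dq (esym Dk)).
Qed.

Lemma bdeg_u d d' a b : zdeg d a -> zdeg d' b -> bdeg (d + d' - 1) (u a b : U j).
Proof.
move=> da db; rewrite /= subrK; apply: tdeg_pure.
  by rewrite /projL_deg /= -[d]addr0; apply: zdegM => //; apply: zdeg_e.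
by rewrite /projR_deg /= -[d']add0r; apply: zdegM => //; apply: zdeg_e.
Qed.

Section Lift.
Variables (V : lmodType R) (h : A -> A -> V).
(** Maps out of U_j are given by formulas on pairs of elements of B_n: [ub_er] and [ub_el] say that
    only their images in P_j and jP count. Balancing over F_j then reduces to linearity and [ub_i],
    which is an equality of zeros when [j = 1]. *)
Record ubalanced : Prop := UBalanced {
  ub_Dl : forall a b c, h (a + b) c = h a c + h b c;
  ub_Dr : forall a b c, h a (b + c) = h a b + h a c;
  ub_Zl : forall k a b, h (k *: a) b = k *: h a b;
  ub_Zr : forall k a b, h a (k *: b) = k *: h a b;
  ub_er : forall a b, h (a * e j) b = h a b;
  ub_el : forall a b, h a (e j * b) = h a b;
  ub_i : forall a b, h (a * i_ j) b = h a (i_ j * b) }.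
Hypothesis hP : ubalanced.

Definition ulift (x : U j) : V :=
  tlift (fun (p : projL R n j) (q : projR R n j) => h (projL_val p) (projR_val q)) x.

Let hB : balanced (@projL_F R n j) (@projR_F R n j)
  (fun (p : projL R n j) (q : projR R n j) => h (projL_val p) (projR_val q)).
Proof.
case: hP => hDl hDr hZl hZr her hel hi; split; try by move=> *;
  rewrite ?projL_D ?projR_D ?projL_Z ?projR_Z.
move=> m k p; rewrite projL_FE projR_FE; case: (Femb_span n k) => x [y ->].
by rewrite mulrDl mulrDr !zscaleAl !zscaleAr hDl hDr !hZl !hZr her hel hi.
Qed.

Lemma uliftE a b : ulift (u a b) = h a b.
Proof. by rewrite /ulift [LHS](tliftE hB) /= ub_er // ub_el. Qed.
Lemma uliftD x y : ulift (x + y) = ulift x + ulift y.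
Proof. exact: (tliftD hB). Qed.
Lemma uliftZ c x : ulift (c *: x) = c *: ulift x.
Proof. exact: (tliftZ hB). Qed.
End Lift.

Lemma ghom_ulift (M : gbimod R n) (h : A -> A -> M) d : ubalanced h ->
  (forall x a b, h (x * a) b = bl x (h a b)) -> (forall x a b, h a (b * x) = br (h a b) x) ->
  (forall k l a b, zdeg k a -> zdeg l b -> bdeg (k + l - 1 + d) (h a b)) ->
  ghom (ulift h : U j -> M).
Proof.
move=> hP hl hr hd; apply: (@ghom_homog _ _ _ _ d).
  split; [exact: uliftD|exact: uliftZ|move=> a|move=> + a]; apply: U_ind => [b c|x y hx hy].
  - by rewrite bl_u !uliftE.
  - by rewrite (lactDr (blP (U j))) !uliftD // hx hy (lactDr (blP M)).
  - by rewrite br_u !uliftE.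
  - by rewrite (ractDl (brP (U j))) !uliftD // hx hy (ractDl (brP M)).
move=> k; apply: bdeg_U_ind => [|x y hx hy|c x hx|d1 d2 a b ha hb ->].
- by rewrite -(scale0r (0 : U j)) uliftZ // scale0r; apply: bdeg0.
- by rewrite uliftD //; apply: bdegD.
- by rewrite uliftZ //; apply: bdegZ.
- by rewrite uliftE //; apply: hd.
Qed.

Lemma bdeg_cast (M : gbimod R n) (d d' : int) (x : M) : bdeg d x -> d = d' -> bdeg d' x.
Proof. by move=> h <-. Qed.

Let betaf (a b : A) : bregular R n := a * e j * b.
Let betaP : ubalanced betaf.
Proof.
split=> *; rewrite /betaf ?mulrDl ?mulrDr ?zscaleAl ?zscaleAr -?mulrA ?(mulrA (e j) (e j))
  ?zeK //.
by rewrite (mulrA (i_ j)) zi_ze (mulrA (e j)) ze_zi.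
Qed.
Lemma ghom_beta : ghom (ulift betaf).
Proof.
apply: (@ghom_ulift _ _ 1) => //.
- by move=> x a b; rewrite /betaf /= !mulrA.
- by move=> x a b; rewrite /betaf /= !mulrA.
- move=> k l a b ka lb; rewrite subrK /betaf -[k]addr0.
  by apply: zdegM => //; apply: zdegM => //; apply: zdeg_e.
Qed.
Definition Ubeta : bhom (U j) (bregular R n) := mkhom ghom_beta.
Lemma UbetaE a b : Ubeta (u a b) = a * e j * b.
Proof. exact: uliftE. Qed.

Let alphaf (a b : A) : btens (U j) (U j) := tpure (u a (e j)) (u (e j) b).
Let alphaP : ubalanced alphaf.
Proof.
split=> *; rewrite /alphaf ?u_Dl ?u_Dr ?u_Zl ?u_Zr ?u_er ?u_el //.
- exact: tpureDl.
- exact: tpureDr.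
- exact: tpureZl.
- exact: tpureZr.
(* ie_j travels from the first factor to the last through both copies of e_j, crossing the middle
   tensor product over B_n. *)
- rewrite u_i zi_ze -u_i ze_zi.
  by rewrite -{1}[i_ j](ze_zi R n) -br_u tpure_bal bl_u zi_ze.
Qed.
Lemma ghom_alpha : ghom (ulift alphaf).
Proof.
apply: (@ghom_ulift _ _ (- 1)) => //.
- by move=> x a b; rewrite /alphaf bl_pure bl_u.
- by move=> x a b; rewrite /alphaf br_pure br_u.
- move=> k l a b ka lb; rewrite /alphaf.
  rewrite (_ : k + l - 1 + - 1 = (k + 0 - 1) + (0 + l - 1)); last by ring.
  by apply: tdeg_pure; apply: bdeg_u => //; apply: zdeg_e.
Qed.
Definition Ualpha : bhom (U j) (btens (U j) (U j)) := mkhom ghom_alpha.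
Lemma UalphaE a b : Ualpha (u a b) = tpure (u a (e j)) (u (e j) b).
Proof. exact: uliftE. Qed.

Section Delta.
Hypotheses (j_gt0 : (0 < j)%N) (j_le_n : (j <= n)%N) (n_ge2 : (2 <= n)%N).
Local Notation phi := (phi j).

(** The contraction of the inner factors. It is lifted one tensor sign at a time: over F_j in the
    second copy of U_j ([delta1]), over F_j in the first ([delta2]), then over B_n ([deltaf]). *)
Let delta0 (a b c d : A) : U j := u (a * phi (b * c)) d.
Let delta0P a b : ubalanced (delta0 a b).
Proof.
split=> *; rewrite /delta0.
- by rewrite mulrDr phiD // mulrDr u_Dl.
- by rewrite u_Dr.
- by rewrite zscaleAr phiZ // zscaleAr u_Zl.
- by rewrite u_Zr.
- by rewrite mulrA phiM_er.
- by rewrite u_el.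
- by rewrite mulrA phiM_ir // mulrA u_i.
Qed.
Let delta1 (y : U j) (a b : A) : U j := ulift (delta0 a b) y.
Let delta1E a b c d : delta1 (u c d) a b = u (a * phi (b * c)) d.
Proof. exact: uliftE. Qed.
Let delta1D y y' a b : delta1 (y + y') a b = delta1 y a b + delta1 y' a b.
Proof. exact: uliftD. Qed.
Let delta1Z k y a b : delta1 (k *: y) a b = k *: delta1 y a b.
Proof. exact: uliftZ. Qed.
Let delta1P y : ubalanced (delta1 y).
Proof.
split=> [a b c|a b c|k a b|k a b|a b|a b|a b]; elim/U_ind: y => [x z|x z hx hz];
  rewrite ?delta1D ?delta1E.
- by rewrite mulrDl u_Dl.
- by rewrite hx hz addrACA.
- by rewrite mulrDl phiD // mulrDr u_Dl.
- by rewrite hx hz addrACA.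
- by rewrite zscaleAl u_Zl.
- by rewrite hx hz scalerDr.
- by rewrite zscaleAl phiZ // zscaleAr u_Zl.
- by rewrite hx hz scalerDr.
- by rewrite -mulrA phi_el.
- by rewrite hx hz.
- by rewrite -mulrA phiM_el.
- by rewrite hx hz.
- by rewrite -mulrA -phiM_il // mulrA.
- by rewrite hx hz.
Qed.
Let delta2 (x y : U j) : U j := ulift (delta1 y) x.
Let delta2E a b c d : delta2 (u a b) (u c d) = u (a * phi (b * c)) d.
Proof. by rewrite /delta2 uliftE ?delta1E. Qed.
Let delta2Dl x x' y : delta2 (x + x') y = delta2 x y + delta2 x' y.
Proof. exact: uliftD. Qed.
Let delta2Dr x y y' : delta2 x (y + y') = delta2 x y + delta2 x y'.
Proof.
elim/U_ind: x => [a b|x z hx hz]; first by rewrite /delta2 !uliftE ?delta1D.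
by rewrite !delta2Dl hx hz addrACA.
Qed.
Let delta2B : balanced (@br _ _ (U j)) (@bl _ _ (U j)) delta2.
Proof.
split=> [x x' y|x y y'|c x y|c x y|x a y]; rewrite ?delta2Dl ?delta2Dr //.
- exact: uliftZ.
- elim/U_ind: x => [a b|x z hx hz]; first by rewrite /delta2 !uliftE ?delta1Z.
  by rewrite !delta2Dl hx hz scalerDr.
- elim/U_ind: x => [b c|x z hx hz]; last by rewrite (ractDl (brP (U j))) !delta2Dl hx hz.
  elim/U_ind: y => [b' c'|x z hx hz]; last by rewrite (lactDr (blP (U j))) !delta2Dr hx hz.
  by rewrite br_u bl_u !delta2E mulrA.
Qed.
Let deltaf (x : btens (U j) (U j)) : U j := tlift delta2 x.
Let deltafE a b c d : deltaf (tpure (u a b) (u c d)) = u (a * phi (b * c)) d.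
Proof. by rewrite /deltaf (tliftE delta2B). Qed.

Lemma ghom_delta : ghom deltaf.
Proof.
have fD x y : deltaf (x + y) = deltaf x + deltaf y by exact: (tliftD delta2B).
have fZ c x : deltaf (c *: x) = c *: deltaf x by exact: (tliftZ delta2B).
have fE x y : deltaf (tpure x y) = delta2 x y by exact: (tliftE delta2B).
have fB : is_bihom deltaf.
  apply: bihom_tens => // [a x y|x y a]; rewrite !fE.
    elim/U_ind: x => [b c|x z hx hz]; last by rewrite (lactDr (blP (U j)))
      !delta2Dl hx hz (lactDr (blP (U j))).
    elim/U_ind: y => [b' c'|x z hx hz]; last by rewrite !delta2Dr hx hz (lactDr (blP (U j))).
    by rewrite bl_u !delta2E bl_u mulrA.
  elim/U_ind: x => [b c|x z hx hz]; last by rewrite !delta2Dl hx hz (ractDl (brP (U j))).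
  elim/U_ind: y => [b' c'|x z hx hz]; last by rewrite (ractDl (brP (U j)))
    !delta2Dr hx hz (ractDl (brP (U j))).
  by rewrite br_u !delta2E br_u.
apply: (@ghom_homog _ _ _ _ (- 1)) => //; apply: degree_tens => // k l x y kx ly.
rewrite fE; move: x kx; apply: bdeg_U_ind => [|x x' hx hx'|c x hx|d1 d2 a b ha hb ->].
- by rewrite -(scale0r (0 : U j)) [delta2 _ _]uliftZ // scale0r; apply: bdeg0.
- by rewrite delta2Dl; apply: bdegD.
- by rewrite [delta2 _ _]uliftZ //; apply: bdegZ.
move: y ly; apply: bdeg_U_ind => [|y y' hy hy'|c' y hy|d3 d4 c d hc hd ->].
- by rewrite -(scale0r (0 : U j)) (bal_Zr delta2B) scale0r; apply: bdeg0.
- by rewrite delta2Dr; apply: bdegD.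
- by rewrite (bal_Zr delta2B); apply: bdegZ.
(* Either the value is 0, or the inner degrees add up to 2 and phi gives degree 0. This loss of 2,
   with one shift fewer in the target, amounts to degree -1. *)
rewrite delta2E; have [->|h] := phi_deg j_gt0 j_le_n n_ge2 (zdegM hb hc).
  by rewrite mulr0 u_0l; apply: bdeg0.
have hphi : zdeg 0 (phi (b * c)).
  rewrite phiE; apply: zdegD; apply: zdegZ; [exact: zdeg_e|exact: zdeg_i].
apply: (bdeg_cast (bdeg_u (zdegM ha hphi) hd)); move: h; lia.
Qed.
Definition Udelta : bhom (btens (U j) (U j)) (U j) := mkhom ghom_delta.
Lemma UdeltaE a b c d : Udelta (tpure (u a b) (u c d)) = u (a * phi (b * c)) d.
Proof. exact: deltafE. Qed.
End Delta.

End OneVertex.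
End BimoduleU.

(** * Central elements, and the dual bases in gamma_j(1) *)

Section CentralElements.
Variables (R : realType) (n : nat).
Local Notation A := (zigzag R n).
Local Notation e j := (ze R n j).
Local Notation i_ j := (zi R n j).
Local Notation a_ j k := (za R n j k).
Local Notation X j := (zXl R n j).
Local Notation U j := (bU R n j).

Definition bcentral (M : gbimod R n) (m : M) := forall x, bl x m = br m x.

Lemma bcentral_gen (M : gbimod R n) (m : M) : (forall j, bl (e j) m = br m (e j)) ->
  (forall j, bl (i_ j) m = br m (i_ j)) -> (forall j k, bl (a_ j k) m = br m (a_ j k)) ->
  bcentral m.
Proof.
have lP := blP M; have rP := brP M.
move=> he hi ha x; elim/zigzag_ind: x => [|x y hx hy|c x hx|x y hx hy||||] //.
- by rewrite -(scale0r (0 : A)) (lactZl lP) (ractZr rP) !scale0r.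
- by rewrite (lactDl lP) (ractDr rP) hx hy.
- by rewrite (lactZl lP) (ractZr rP) hx.
- by rewrite (lactM lP) (ractM rP) hy -blr hx.
- by rewrite (lact1 lP) (ract1 rP).
Qed.

(** A bimodule map out of B_n is determined by the image of 1, which may be any central element. *)
Lemma ghom_central (M : gbimod R n) (m : M) d : bcentral m -> bdeg d m ->
  ghom (fun x : bregular R n => bl x m).
Proof.
have lP := blP M; have rP := brP M.
move=> mC md; apply: (@ghom_homog _ _ _ _ d); last by move=> k x kx; apply: bdegl.
split=> [x y|c x|a x|x a].
- exact: lactDl.
- exact: lactZl.
- exact: lactM.
- by rewrite [LHS](lactM lP) mC blr.
Qed.

(* For j = n the last pair is zero, since (n+1|n) = 0 in the algebra.          *)
Definition gamma_basis (j : nat) : seq (A * A) :=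
  if j == 1%N
  then [:: (X 1, e 1); (e 1, X 1); (a_ 2 1, a_ 1 2); (- i_ 2 * a_ 2 1, a_ 1 2 * i_ 2)]
  else [:: (X j, e j); (e j, X j); (a_ j.-1 j, a_ j j.-1); (a_ j.+1 j, a_ j j.+1)].

Definition gamma1 (j : nat) : U j := \sum_(p <- gamma_basis j) @u_ R n j p.1 p.2.

Local Notation u j := (@u_ R n j).

Lemma u_XeC_e j k : u j (e k * X j) (e j) = u j (X j) (e j * e k).
Proof. by have [->|kj] := eqVneq k j; rewrite ?ze_zX ?zeK // ze_zX_ne // ze_orth 1?eq_sym //
  u_0l u_0r. Qed.
Lemma u_eXC_e j k : u j (e k * e j) (X j) = u j (e j) (X j * e k).
Proof. by have [->|kj] := eqVneq k j; rewrite ?zX_ze ?zeK // zX_ze_ne 1?eq_sym // ze_orth //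
  u_0l u_0r. Qed.
Lemma u_XeC_i j k : u j (i_ k * X j) (e j) = u j (X j) (e j * i_ k).
Proof.
have [->|kj] := eqVneq k j; first by rewrite zi_zX u_i zi_ze ze_zi.
by rewrite zi_zX_ne // ze_zi_ne 1?eq_sym // u_0l u_0r.
Qed.
Lemma u_eXC_i j k : u j (i_ k * e j) (X j) = u j (e j) (X j * i_ k).
Proof.
have [->|kj] := eqVneq k j; first by rewrite zi_ze -{1}(ze_zi R n j) u_i zi_zX.
by rewrite zi_ze_ne // zX_zi_ne 1?eq_sym // u_0l u_0r.
Qed.
Lemma u_aaC_e j m k : u j (e k * a_ m j) (a_ j m) = u j (a_ m j) (a_ j m * e k).
Proof.
have [->|km] := eqVneq k m; first by rewrite ze_za za_ze.
by rewrite ze_za_ne // za_ze_ne 1?eq_sym // u_0l u_0r.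
Qed.
Lemma u_aaC_i j m k : j != 1%N -> u j (i_ k * a_ m j) (a_ j m) = u j (a_ m j) (a_ j m * i_ k).
Proof.
move=> j1; have [->|km] := eqVneq k m; last by rewrite zi_za_ne // za_zi_ne 1?eq_sym // u_0l
  u_0r.
have [hm|/zi_out ->] := boolP (is_loop n m); last by rewrite mul0r mulr0 u_0l u_0r.
have [hj|hj] := boolP (is_loop n j); first by rewrite zi_za // u_i zi_za.
by rewrite za_out ?u_0l ?mulr0 ?u_0l //; move: hj; rewrite /is_loop /is_arrow /is_vertex; lia.
Qed.
Lemma u_mid_l j m k l : u j (a_ k l * a_ m j) (a_ j m) =
  if (k == j) && (l == m) then u j (X j) (a_ j m) else 0.
Proof.
have [mj|mj] := boolP (is_arrow n m j); last first.
  by rewrite (@za_out R n m j) // (@za_out R n j m) 1?is_arrowC // mulr0 u_0l u_0r; case: ifP.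
case: (eqVneq l m) => [->|lm]; last by rewrite za_za_ne // u_0l andbF.
case: (eqVneq k j) => [->|kj]; first by rewrite zX_arrow // is_arrowC.
by rewrite za_straight // u_0l.
Qed.
Lemma u_mid_r j m k l : u j (a_ m j) (a_ j m * a_ k l) =
  if (l == j) && (k == m) then u j (a_ m j) (X j) else 0.
Proof.
have [mj|mj] := boolP (is_arrow n m j); last first.
  by rewrite (@za_out R n m j) // !u_0l; case: ifP.
case: (eqVneq k m) => [->|km]; last by rewrite za_za_ne 1?eq_sym // u_0r andbF.
case: (eqVneq l j) => [->|lj]; first by rewrite zX_arrow // is_arrowC.
by rewrite za_straight ?u_0r // eq_sym.
Qed.
Lemma u_eXC_a j k l : u j (a_ k l * e j) (X j) = if l == j then u j (a_ k j) (X j) else 0.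
Proof. by case: eqVneq => [->|h]; rewrite ?za_ze // za_ze_ne // u_0l. Qed.
Lemma u_XeC_a j k l : u j (X j) (e j * a_ k l) = if k == j then u j (X j) (a_ j l) else 0.
Proof. by case: eqVneq => [->|h]; rewrite ?ze_za // ze_za_ne ?u_0r // eq_sym. Qed.

Lemma u_X_nbrs j l : (if l == j.-1 then u j (X j) (a_ j j.-1) else 0)
  + (if l == j.+1 then u j (X j) (a_ j j.+1) else 0) = u j (X j) (a_ j l).
Proof.
case: eqVneq => [->|h1]; first by rewrite ifF ?addr0 //; lia.
case: eqVneq => [->|h2]; first by rewrite add0r.
by rewrite za_out ?u_0r ?addr0 // /is_arrow; lia.
Qed.
Lemma u_nbrs_X j k : (if k == j.-1 then u j (a_ j.-1 j) (X j) else 0)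
  + (if k == j.+1 then u j (a_ j.+1 j) (X j) else 0) = u j (a_ k j) (X j).
Proof.
case: eqVneq => [->|h1]; first by rewrite ifF ?addr0 //; lia.
case: eqVneq => [->|h2]; first by rewrite add0r.
by rewrite za_out ?u_0l ?addr0 // /is_arrow; lia.
Qed.

(** Vertices and loops pass through each dual pair separately. An arrow does not, but from either
    side it produces the same two terms, of the shapes arrow (x) X_j and X_j (x) arrow: one comes
    from a pair containing e_j, the other from the arrow pairs. *)
Lemma gamma1_central_gt1 j : j != 1%N -> bcentral (gamma1 j).
Proof.
move=> j1; rewrite /gamma1 /gamma_basis (negbTE j1) !(big_cons, big_nil) /= addr0.
have lP := blP (U j); have rP := brP (U j).
apply: bcentral_gen => [k|k|k l]; rewrite !(lactDr lP) !(ractDl rP) !bl_u !br_u.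
- by rewrite u_XeC_e u_eXC_e !u_aaC_e.
- by rewrite u_XeC_i u_eXC_i !u_aaC_i.
rewrite za_zX zX_za u_0l u_0r u_eXC_a u_XeC_a !u_mid_l !u_mid_r !add0r.
case: (k == j); case: (l == j) => /=; rewrite ?u_X_nbrs ?u_nbrs_X ?addr0 ?add0r //.
exact: addrC.
Qed.

(** Here ie_2 does not pass through (2|1); multiplication by it exchanges the last two terms of
    gamma_1(1) instead. Their extra products with arrows vanish by (1|2)(ie_2)(2|1) = 0. *)
Lemma gamma1_central_1 : (2 <= n)%N -> bcentral (gamma1 1).
Proof.
move=> n2; rewrite /gamma1 /gamma_basis /= !(big_cons, big_nil) /= addr0.
have lP := blP (U 1); have rP := brP (U 1).
have l2 : is_loop n 2 by [].
apply: bcentral_gen => [k|k|k l]; rewrite !(lactDr lP) !(ractDl rP) !bl_u !br_u.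
- rewrite u_XeC_e u_eXC_e !u_aaC_e !mulNr mulrN !u_Nl; congr (_ + (_ + (_ - _))).
  have [->|k2] := eqVneq k 2%N; first by rewrite mulrA ze_zi -mulrA zi_ze.
  by rewrite mulrA ze_zi_ne // -mulrA zi_ze_ne 1?eq_sym // mul0r mulr0 u_0l u_0r.
- rewrite u_XeC_i u_eXC_i; congr (_ + (_ + _)).
  have [->|k2] := eqVneq k 2%N; last first.
    have h : 2%N != k by rewrite eq_sym.
    rewrite zi_za_ne // (@za_zi_ne _ _ 1 2 k) // -(mulrA _ (i_ 2) (i_ k)) (zi_zi_ne _ _ h).
    by rewrite mulNr mulrN mulrA (zi_zi_ne _ _ k2) mul0r oppr0 mulr0 !u_0l !u_0r.
  rewrite mulNr mulrN mulrA zi_sqr // -(mulrA _ (i_ 2) (i_ 2)) zi_sqr //.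
  by rewrite !(mulNr, mulrN) opprK ze_za za_ze !u_Nl u_Nr opprK addrC.
have [kl|/za_out kl] := boolP (is_arrow n k l); last by rewrite kl !mul0r !mulr0 !u_0l !u_0r.
rewrite za_zX zX_za u_0l u_0r u_eXC_a u_XeC_a u_mid_l u_mid_r !add0r.
have h1 : a_ k l * i_ 2 * a_ 2 1 = 0.
  have [->|l2'] := eqVneq l 2%N; last by rewrite za_zi_ne // mul0r.
  have [kk|kk] := boolP (is_loop n k); last exact: za_zi_za.
  by rewrite -zi_za // -mulrA za_straight ?mulr0 //; move: kk; rewrite /is_loop; lia.
have h2 : a_ 1 2 * i_ 2 * a_ k l = 0.
  have [<-|k2] := eqVneq 2%N k; last by rewrite -mulrA zi_za_ne // mulr0.
  exact: za_zi_za.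
rewrite mulNr mulrN mulrA h1 h2 oppr0 u_0l u_0r !addr0.
move: kl; rewrite /is_arrow /is_vertex => kl.
have [k1|k1] := eqVneq k 1%N; have [l1|l1] := eqVneq l 1%N => /=; rewrite ?addr0 ?add0r //.
- lia.
- by have -> : l = 2%N by lia.
- by have -> : k = 2%N by lia.
Qed.

Lemma gamma1_central j : (2 <= n)%N -> bcentral (gamma1 j).
Proof.
by move=> n2; have [->|j1] := eqVneq j 1%N; [apply: gamma1_central_1|apply: gamma1_central_gt1].
Qed.

Lemma gamma1_deg j : bdeg 1 (gamma1 j).
Proof.
rewrite /gamma1; have H (s : seq (A * A)) : (forall p, p \in s ->
  exists d d', [/\ zdeg d p.1, zdeg d' p.2
    & d + d' = 2]) -> bdeg 1 (\sum_(p <- s) @u_ R n j p.1 p.2).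
  elim: s => [|p s IH] h; first by rewrite big_nil; apply: bdeg0.
  rewrite big_cons; apply: bdegD; last by apply: IH => q qs; apply: h; rewrite in_cons qs orbT.
  have [d [d' [hd hd' dd]]] := h p (mem_head _ _).
  by apply: (bdeg_cast (bdeg_u j hd hd')); rewrite dd.
apply: H => p; rewrite /gamma_basis; case: ifP => _; rewrite !inE => /or4P[] /eqP -> /=.
- by exists 2, 0; split; [exact: zX_deg|exact: zdeg_e|].
- by exists 0, 2; split; [exact: zdeg_e|exact: zX_deg|].
- by exists 1, 1; split; [exact: zdeg_a|exact: zdeg_a|].
- exists 1, 1; split=> //; last by apply: (@zdegM _ _ 1 0); [exact: zdeg_a|exact: zdeg_i].
  by apply: (@zdegM _ _ 0 1); [rewrite -scaleN1r; apply/zdegZ/zdeg_i|exact: zdeg_a].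
- by exists 2, 0; split; [exact: zX_deg|exact: zdeg_e|].
- by exists 0, 2; split; [exact: zdeg_e|exact: zX_deg|].
- by exists 1, 1; split; [exact: zdeg_a|exact: zdeg_a|].
- by exists 1, 1; split; [exact: zdeg_a|exact: zdeg_a|].
Qed.

Definition Ugamma (n2 : (2 <= n)%N) j : bhom (bregular R n) (U j) :=
  mkhom (ghom_central (gamma1_central j n2) (gamma1_deg j)).

Lemma UgammaE n2 j x : Ugamma n2 j x = bl x (gamma1 j).
Proof. by []. Qed.

(* The two halves of [gamma1 j] are dual bases for the pairing phi (b c).      *)
Lemma gamma_basis_phir j : (0 < j <= n)%N -> (2 <= n)%N ->
  \sum_(p <- gamma_basis j) @u_ R n j p.1 (phi j (p.2 * e j)) = @u_ R n j (e j) (e j).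
Proof.
move=> /andP[j0 jn] n2; rewrite /gamma_basis; case: eqP => [j1|j1];
  rewrite !(big_cons, big_nil) /=; [subst j|].
all: rewrite zeK zX_ze phi_e // phi_X // u_0r add0r.
- rewrite za_ze_ne // -mulrA zi_ze_ne // mulr0 phi0 // !u_0r !addr0 //.
- by rewrite !za_ze_ne ?phi0 // ?u_0r ?addr0 //; lia.
Qed.
Lemma gamma_basis_phil j : (0 < j <= n)%N -> (2 <= n)%N ->
  \sum_(p <- gamma_basis j) @u_ R n j (phi j (e j * p.1)) p.2 = @u_ R n j (e j) (e j).
Proof.
move=> /andP[j0 jn] n2; rewrite /gamma_basis; case: eqP => [j1|j1];
  rewrite !(big_cons, big_nil) /=; [subst j|].
all: rewrite zeK ze_zX phi_e // phi_X // u_0l.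
- by rewrite ze_za_ne // mulNr mulrN mulrA ze_zi_ne // mul0r oppr0 phi0 // !u_0l add0r !addr0.
- by rewrite !ze_za_ne ?phi0 // ?u_0l ?add0r ?addr0 //; lia.
Qed.

Lemma zX_central j : bcentral (X j : bregular R n).
Proof.
apply: bcentral_gen => [k|k|k l] /=; last by rewrite za_zX zX_za.
  by have [->|kj] := eqVneq k j; [rewrite ze_zX zX_ze|rewrite ze_zX_ne // zX_ze_ne 1?eq_sym].
by have [->|kj] := eqVneq k j; [rewrite zi_zX|rewrite zi_zX_ne // zX_zi_ne 1?eq_sym].
Qed.

End CentralElements.

(** * Coherence isomorphisms *)

Section Coherence.
Variables (R : realType) (n : nat).
Local Notation A := (zigzag R n).
Local Notation word := (seq 'I_n).
Local Notation gbimod := (gbimod R n).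
Local Notation U s := (bU R n (lab s)).
Implicit Types (M N : gbimod) (w x y : word) (l : seq (A * A)).

(** The default pair is read only when the list is shorter than the word. *)
Definition uhead (s : 'I_n) l : U s := u_ (lab s) (head (0, 0) l).1 (head (0, 0) l).2.

Fixpoint pfold M (m : M) w l : Gfold M w :=
  match w with
  | [::] => m
  | t :: w' => pfold (tpure m (uhead t l) : btens M (U t)) w' (behead l)
  end.

(* The pure tensor (a_1 (x) b_1) (x) ... (x) (a_k (x) b_k), given by the list  *)
(* of the pairs (a_i, b_i).                                                   *)
Definition ptens w l : Gobj R w :=
  if w is s :: w' return Gobj R w then pfold (uhead s l) w' (behead l) else (1 : A).

Lemma pfoldD M (m m' : M) w l : pfold (m + m') w l = pfold m w l + pfold m' w l.
Proof. by elim: w M m m' l => [//|t w IH] M m m' l /=; rewrite tpureDl IH. Qed.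

Lemma bl_pfold M a (m : M) w l : bl a (pfold m w l) = pfold (bl a m) w l.
Proof. by elim: w M m l => [//|t w IH] M m l /=; rewrite IH bl_pure. Qed.

Lemma Gfold_mapE M N (f : bhom M N) m w l : Gfold_map f w (pfold m w l) = pfold (f m) w l.
Proof. by elim: w M N f m l => [//|t w IH] M N f m l /=; rewrite IH btmapE. Qed.

Lemma mu_rightE M N m q w l : mu_right M N w (tpure m (pfold q w l))
  = pfold (tpure m q : btens M N) w l.
Proof.
elim: w M N m q l => [//|t w IH] M N m q l.
rewrite -[LHS]/(Gfold_map (biassoc M N (U t)) w (mu_right M (btens N (U t))
  w (tpure m (pfold q (t :: w) l)))).
by rewrite [X in Gfold_map _ _ X]IH Gfold_mapE biassocE.
Qed.

Lemma mu_leftE M m w y l l' : size l = size w ->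
  mu_left M w y (tpure (pfold m w l) (ptens y l')) = pfold m (w ++ y) (l ++ l').
Proof.
elim: w M m l => [|t w IH] M m [|p l] //=; last by case=> h; rewrite IH.
move=> _; case: y => [|t y]; first by rewrite [LHS]brunitE (ract1 (brP M)).
exact: mu_rightE.
Qed.

Definition gmu x y : bhom (btens (Gobj R x) (Gobj R y)) (Gobj R (x ++ y)) := @Gmu R n x y.

(** On pure tensors the coherence map forgets the bracketing and concatenates the lists of factors;
    the coherence axioms reduce to this. *)
Lemma gmuE x y l l' : size l = size x ->
  gmu x y (tpure (ptens x l) (ptens y l')) = ptens (x ++ y) (l ++ l').
Proof.
case: x l => [|s x] [|p l] //= h; first by rewrite [LHS]blunitE (lact1 (blP _)).
by rewrite [LHS]mu_leftE //; case: h.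
Qed.

Lemma Gfold_ind M w (Q : Gfold M w -> Prop) :
  (forall m l, size l = size w -> Q (pfold m w l)) -> (forall z z', Q z -> Q z' ->
    Q (z + z')) ->
  forall z, Q z.
Proof.
elim: w M Q => [|t w IH] M Q Qp QD z; first exact: (Qp z [::]).
apply: (IH (btens M (U t))) => // m l h; elim/tensor_ind: m => [m v|m m' hm hm']; last first.
  by rewrite pfoldD; apply: QD.
elim/U_ind: v => [a b|v v' hv hv']; last by rewrite tpureDr pfoldD; apply: QD.
by apply: (Qp m ((a, b) :: l)); rewrite /= h.
Qed.

Lemma bl_ptens a s w p l : bl a (ptens (s :: w) (p :: l)) = ptens (s :: w) ((a * p.1,
  p.2) :: l).
Proof.
transitivity (pfold (bl a (uhead s (p :: l))) w l); first exact: bl_pfold.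
by apply: (congr1 (fun m => pfold m w l)); apply: bl_u.
Qed.

(** The left scalar [a] serves the empty word, whose only pure tensor is 1. *)
Lemma Gobj_ind w (Q : Gobj R w -> Prop) :
  (forall a l, size l = size w -> Q (bl a (ptens w l))) -> (forall z z', Q z -> Q z' ->
    Q (z + z')) ->
  forall z, Q z.
Proof.
case: w Q => [|s w] Q Qp QD z; first by have := Qp z [::] erefl; rewrite /= mulr1.
apply: Gfold_ind => // m l h; elim/U_ind: m => [a b|v v' hv hv']; last by rewrite pfoldD;
  apply: QD.
have := Qp 1 ((a, b) :: l); rewrite bl_ptens /= mul1r; apply; by rewrite /= h.
Qed.

Lemma Gobj_ext w N (f g : bhom (Gobj R w) N) :
  (forall l, size l = size w -> f (ptens w l) = g (ptens w l)) -> f = g.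
Proof.
move=> fg; apply: bhom_ext; apply: Gobj_ind => [a l h|x y hx hy].
  by rewrite (bil (bhom_bi f)) (bil (bhom_bi g)) fg.
by rewrite (biD (bhom_bi f)) (biD (bhom_bi g)) hx hy.
Qed.

Fixpoint mu_right_inv M N w : bhom (Gfold (btens M N) w) (btens M (Gfold N w)) :=
  match w with
  | [::] => bid (btens M N)
  | t :: w' => bcomp (mu_right_inv M (btens N (U t)) w') (Gfold_map (bassoc M N (U t)) w')
  end.

Fixpoint mu_left_inv M w y : bhom (Gfold M (w ++ y)) (btens (Gfold M w) (Gobj R y)) :=
  match w with
  | [::] => match y with
            | [::] => birunit M
            | t :: y' => mu_right_inv M (U t) y'
            end
  | s :: w' => mu_left_inv (btens M (U s)) w' y
  end.

Definition gmui x y : bhom (Gobj R (x ++ y)) (btens (Gobj R x) (Gobj R y)) :=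
  match x as x return bhom (Gobj R (x ++ y)) (btens (Gobj R x) (Gobj R y)) with
  | [::] => bilunit (Gobj R y)
  | s :: x' => mu_left_inv (U s) x' y
  end.

Lemma mu_right_invE M N m q w l : mu_right_inv M N w (pfold (tpure m q : btens M N) w l)
  = tpure m (pfold q w l).
Proof.
elim: w M N m q l => [//|t w IH] M N m q l.
rewrite -[LHS]/(mu_right_inv M (btens N (U t)) w (Gfold_map (bassoc M N (U t))
  w (pfold (tpure m q : btens M N) (t :: w) l))).
by rewrite [X in mu_right_inv _ _ _ X]Gfold_mapE bassocE IH.
Qed.

Lemma mu_left_invE M m w y l l' : size l = size w ->
  mu_left_inv M w y (pfold m (w ++ y) (l ++ l')) = tpure (pfold m w l) (ptens y l').
Proof.
elim: w M m l => [|t w IH] M m [|p l] //=; last by case=> h; rewrite IH.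
move=> _; case: y => [//|t y]; exact: mu_right_invE.
Qed.

Lemma gmuiE x y l l' : size l = size x ->
  gmui x y (ptens (x ++ y) (l ++ l')) = tpure (ptens x l) (ptens y l').
Proof.
case: x l => [|s x] [|p l] //= h.
by rewrite [LHS]mu_left_invE //; case: h.
Qed.

Lemma split_size x y l : size l = size (x ++ y) -> exists l1 l2, [/\ l = l1 ++ l2,
  size l1 = size x & size l2 = size y].
Proof.
rewrite size_cat => h; exists (take (size x) l), (drop (size x) l).
by rewrite cat_take_drop size_takel ?size_drop ?h ?leq_addr // addKn.
Qed.

Lemma Gobj_tens_ext x y N (f g : bhom (btens (Gobj R x) (Gobj R y)) N) :
  (forall l l', size l = size x -> size l' = size y ->
    f (tpure (ptens x l) (ptens y l')) = g (tpure (ptens x l) (ptens y l'))) -> f = g.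
Proof.
move=> fg; apply: bhom_tens_ext => p q.
elim/Gobj_ind: q p => [b l' hl'|q q' hq hq'] p; last by rewrite tpureDr !(biD (bhom_bi _))
  hq hq'.
(* The left scalar of the second factor is absorbed by the first, which is still arbitrary. *)
rewrite -tpure_bal; move: (br p b) => {b}p; elim/Gobj_ind: p => [a l hl|p p' hp hp'].
  by rewrite -bl_pure !(bil (bhom_bi _)) fg.
by rewrite tpureDl !(biD (bhom_bi _)) hp hp'.
Qed.

Lemma gmuK x y : bcomp (gmui x y) (gmu x y) = bid _.
Proof.
apply: Gobj_tens_ext => l l' h h'.
by rewrite -[LHS]/(gmui x y (gmu x y (tpure _ _))) gmuE // gmuiE.
Qed.
Lemma gmuiK x y : bcomp (gmu x y) (gmui x y) = bid _.
Proof.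
apply: Gobj_ext => l /split_size [l1 [l2 [-> h1 h2]]].
by rewrite -[LHS]/(gmu x y (gmui x y _)) gmuiE // gmuE.
Qed.
Lemma gmuK_app x y z : gmui x y (gmu x y z) = z.
Proof. by have := gmuK x y => /(congr1 (fun f : bhom _ _ => f z)). Qed.
Definition star x y (p : Gobj R x) (q : Gobj R y) : Gobj R (x ++ y) := gmu x y (tpure p q).

Lemma starDl x y (p p' : Gobj R x) (q : Gobj R y) : star (p + p') q = star p q + star p' q.
Proof. by rewrite /star tpureDl (biD (bhom_bi _)). Qed.
Lemma starDr x y (p : Gobj R x) (q q' : Gobj R y) : star p (q + q') = star p q + star p q'.
Proof. by rewrite /star tpureDr (biD (bhom_bi _)). Qed.
Lemma starZl x y c (p : Gobj R x) (q : Gobj R y) : star (c *: p) q = c *: star p q.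
Proof. by rewrite /star tpureZl (biZ (bhom_bi _)). Qed.
Lemma starZr x y c (p : Gobj R x) (q : Gobj R y) : star p (c *: q) = c *: star p q.
Proof. by rewrite /star tpureZr (biZ (bhom_bi _)). Qed.
Lemma star_bal x y (p : Gobj R x) a (q : Gobj R y) : star (br p a) q = star p (bl a q).
Proof. by rewrite /star tpure_bal. Qed.
Lemma star_bl x y a (p : Gobj R x) (q : Gobj R y) : star (bl a p) q = bl a (star p q).
Proof. by rewrite /star -(bil (bhom_bi _)) bl_pure. Qed.
Lemma star_br x y a (p : Gobj R x) (q : Gobj R y) : star p (br q a) = br (star p q) a.
Proof. by rewrite /star -(bir (bhom_bi _)) br_pure. Qed.
Lemma star_nill y (a : A) (q : Gobj R y) : star (a : Gobj R [::]) q = bl a q.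
Proof. exact: blunitE. Qed.
Lemma star_ptens x y l l' : size l = size x ->
  star (ptens x l) (ptens y l') = ptens (x ++ y) (l ++ l').
Proof. exact: gmuE. Qed.

(** Concatenation of words is associative only up to a propositional equality, along which values
    have to be transported. *)
Definition gcast x y (E : x = y) : bhom (Gobj R x) (Gobj R y) :=
  match E in _ = z return bhom (Gobj R x) (Gobj R z) with erefl => bid _ end.
Lemma gcastE x y (E : x = y) l : gcast E (ptens x l) = ptens y l.
Proof. by case: y / E. Qed.
Lemma gcast1 x (E : x = x) : gcast E = bid _.
Proof. by rewrite (eq_irrelevance E erefl). Qed.

Lemma starA x y z (p : Gobj R x) (q : Gobj R y) (r : Gobj R z) :
  gcast (catA x y z) (star p (star q r)) = star (star p q) r.
Proof.
elim/Gobj_ind: r p q => [c l3 h3|r r' hr hr'] p q; last first.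
  by rewrite !starDr (biD (bhom_bi _)) hr hr'.
rewrite -!star_bal; rewrite -star_br; move: (br q c) => {c}q.
elim/Gobj_ind: q p => [b l2 h2|q q' hq hq'] p; last first.
  by rewrite !(starDl, starDr) (biD (bhom_bi _)) hq hq'.
rewrite star_bl -!star_bal; move: (br p b) => {b}p.
elim/Gobj_ind: p => [a l1 h1|p p' hp hp']; last first.
  by rewrite !starDl (biD (bhom_bi _)) hp hp'.
rewrite !star_bl (bil (bhom_bi _)) !star_ptens ?size_cat ?h1 ?h2 //.
by rewrite gcastE catA.
Qed.

Lemma star_nilr x (p : Gobj R x) (a : A) : gcast (cats0 x) (star p (a : Gobj R [::])) = br p a.
Proof.
transitivity (gcast (cats0 x) (star (br p a) (ptens [::] [::]))).
  by rewrite star_bal /= mulr1.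
move: (br p a) => {}p.
elim/Gobj_ind: p => [b l h|p p' hp hp']; last first.
  by rewrite !starDl (biD (bhom_bi _)) hp hp'.
by rewrite star_bl (bil (bhom_bi _)) star_ptens // gcastE cats0.
Qed.

End Coherence.

(** * Polynomial boxes *)

Section Polynomials.
Variables (R : realType) (n : nat).
Local Notation A := (zigzag R n).
Local Notation X j := (zXl R n j).
Implicit Types (f g : {mpoly R[n]}) (s t : 'I_n).

Lemma mcoeffU_deriv f t : f@_(U_(t)) = (f^`M(t))@_0.
Proof. by rewrite mcoeff_deriv add0m mnm0E. Qed.

Lemma mcoeff0M f g : (f * g)@_0 = f@_0 * g@_0.
Proof. exact: (rmorphM (mcoeff 0)). Qed.

Lemma mcoeffUM f g t : (f * g)@_(U_(t)) = f@_(U_(t)) * g@_0 + f@_0 * g@_(U_(t)).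
Proof. by rewrite !mcoeffU_deriv mderivM mcoeffD !mcoeff0M. Qed.

Section Line.
Variable s : 'I_n.

(** The restriction of [f] to the coordinate axis of ['X_s], rescaled by [c]. *)
Definition mline (c : R) f : {poly R} := mmap polyC (fun t => if t == s then c *: 'X else 0) f.

Lemma coef_mline c f k : (mline c f)`_k = c ^+ k * f@_(U_(s) *+ k)%MM.
Proof.
rewrite /mline; elim/mpolyind: f => [|a m f hm ha IH];
  first by rewrite raddf0 coef0 mcoeff0 mulr0.
rewrite raddfD /= coefD IH mcoeffD mulrDr mmapZ mmapX coefCM mcoeffZ mcoeffX; congr (_ + _).
rewrite mulrCA; congr (_ * _); rewrite /mmap1 (bigD1 s) //= eqxx exprZn -scalerAl coefZ.
(* Only powers of ['X_s] survive on the axis. *)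
have [/forallP h|] := boolP [forall i, (i != s) ==> (m i == 0%N)].
  rewrite big1 ?mulr1; last by move=> i si; rewrite (negbTE si) (eqP (implyP (h i) si)) expr0.
  rewrite coefXn (_ : (m == _) = (k == m s)); first by case: eqP => [->|]; rewrite ?mulr0.
  apply/eqP/eqP => [->|->]; first by rewrite mulmnE mnm1E eqxx mul1n.
  apply/mnmP => i; rewrite mulmnE mnm1E; case: eqVneq => [->|si]; first by rewrite mul1n.
  by rewrite eq_sym in si; rewrite (eqP (implyP (h i) si)).
rewrite negb_forall; case/fintype.existsP=> i; rewrite negb_imply; case/andP=> si mi.
rewrite (bigD1 i) //= (negbTE si) expr0n (negbTE mi) mul0r mulr0 coef0 mulr0.
rewrite (_ : (m == _) = false) ?mulr0 //; apply/negbTE; apply: contra mi => /eqP ->.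
by rewrite mulmnE mnm1E (eq_sym s) (negbTE si).
Qed.

(** On this axis alpha_s is twice the coordinate, so the reflection sends u to u - 2 u and leaves
    the other coordinates 0. *)
Lemma mline_refl f : mline 1 (refl s f) = mline (- 1) f.
Proof.
rewrite /refl comp_mpolyE /mline raddf_sum /= [RHS]/mmap; apply: eq_bigr => m _.
rewrite mmapZ; congr (_ * _); rewrite rmorph_prod /= /mmap1; apply: eq_bigr => t _.
rewrite rmorphXn /=; congr (_ ^+ _); rewrite tnth_mktuple rmorphB /= mmapX mmap1U mmapZ
  raddf_sum /=.
have -> : \sum_(i < n) mmap polyC (fun t : 'I_n => if t == s then 1 *: 'X else 0)
  (cartan R i s *: 'X_i) = 2 *: 'X.
  rewrite (bigD1 s) //= big1 ?addr0; last first.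
    by move=> i si; rewrite mmapZ mmapX mmap1U (negbTE si) mulr0.
  by rewrite mmapZ mmapX mmap1U eqxx /cartan eqxx scale1r mul_polyC.
case: eqVneq => _ /=; last by rewrite mul0r subr0.
by rewrite polyC1 mul1r -scalerBl; congr (_ *: _); ring.
Qed.

Lemma mline_root : mline 1 (sroot R s) = 2 *: 'X.
Proof.
rewrite /sroot /mline raddf_sum /= (bigD1 s) //= big1 ?addr0; last first.
  by move=> i si; rewrite mmapZ mmapX mmap1U (negbTE si) mulr0.
by rewrite mmapZ mmapX mmap1U eqxx /cartan eqxx scale1r mul_polyC.
Qed.

(* On the line where only 'X_s is nonzero, 2 u g(u) = f(u) - f(-u).           *)
Lemma demazure_low f g : f - refl s f = sroot R s * g -> g@_0 = f@_(U_(s)) /\ g@_(U_(s)) = 0.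
Proof.
move=> /(congr1 (mline 1)); rewrite [RHS](rmorphM (mmap polyC _)) /= -!/(mline 1 _) mline_root.
rewrite [LHS](rmorphB (mmap polyC _)) /= -!/(mline 1 _) mline_refl => E.
(* The coefficients of u and of u^2 say that twice the constant term of [g] is twice the ['X_s]
   coefficient of [f], and that twice the ['X_s] coefficient of [g] is 0. *)
have E1 := congr1 (fun p : {poly R} => p`_1) E; have E2 := congr1 (fun p : {poly R} => p`_2) E.
rewrite coefB -scalerAl coefZ coefXM !coef_mline /= !expr0 !expr1 !mul1r mulm0n mulm1n in E1.
rewrite coefB -scalerAl coefZ coefXM !coef_mline /= !expr1 sqrrN !expr1n !mul1r mulm1n subrr
  in E2.
have two : (2 : R) != 0 by rewrite pnatr_eq0.
split; last by apply/eqP; move/esym/eqP: E2; rewrite mulf_eq0 (negbTE two).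
apply: (mulfI two); rewrite -E1; ring.
Qed.
End Line.

(** The alternating sign turns the negative off-diagonal Cartan entries into the positive
    coefficients inside epsilon_j. *)
Definition zweight t : A := (-1) ^+ (lab t).+1 *: X (lab t).

(** Monomials of degree two and more may be dropped because all products X_j X_k are 0; this makes
    the truncation multiplicative. *)
Definition zpoly f : A := f@_0 *: (1 : A) + \sum_(t < n) f@_(U_(t)) *: zweight t.

Lemma zweightM s t : zweight s * zweight t = 0.
Proof. by rewrite /zweight zscaleAl zscaleAr zX_zX !scaler0. Qed.

Lemma zweight_central t x : x * zweight t = zweight t * x.
Proof. by rewrite /zweight zscaleAl zscaleAr; congr (_ *: _); apply: zX_central. Qed.

Lemma zpoly_central f x : x * zpoly f = zpoly f * x.
Proof.
rewrite /zpoly mulrDl mulrDr zscaleAl zscaleAr mul1r mulr1 mulr_sumr mulr_suml; congr (_ + _).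
by apply: eq_bigr => t _; rewrite zscaleAl zscaleAr zweight_central.
Qed.

Lemma zpoly_lin c f g : zpoly (c *: f + g) = c *: zpoly f + zpoly g.
Proof.
rewrite /zpoly scalerDr addrACA mcoeffD mcoeffZ scalerDl scalerA; congr (_ + _).
rewrite scaler_sumr -big_split; apply: eq_bigr => t _ /=.
by rewrite mcoeffD mcoeffZ scalerDl -scalerA.
Qed.

Lemma zpolyM f g : zpoly (f * g) = zpoly f * zpoly g.
Proof.
pose F (h : {mpoly R[n]}) := \sum_(t < n) h@_(U_(t)) *: zweight t.
have E h : zpoly h = h@_0 *: (1 : A) + F h by [].
have FF : F f * F g = 0.
  rewrite mulr_suml big1 // => t _; rewrite mulr_sumr big1 // => t' _.
  by rewrite zscaleAl zscaleAr zweightM !scaler0.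
rewrite !E mulrDl !mulrDr FF addr0 !zscaleAl !mul1r zscaleAr mulr1 mcoeff0M scalerA -addrA.
congr (_ + _); rewrite !scaler_sumr -big_split; apply: eq_bigr => t _.
by rewrite mcoeffUM (mulrC f@_(U_(t))) scalerDl -!scalerA addrC.
Qed.

Lemma zpoly1 : zpoly 1 = 1.
Proof.
rewrite /zpoly mcoeff1 eqxx scale1r big1 ?addr0 // => t _.
by rewrite mcoeff1 mnm1_eq0 scale0r.
Qed.

Lemma mcoeffU_sroot s t : (sroot R s)@_(U_(t)) = cartan R t s.
Proof.
rewrite /sroot raddf_sum /= (bigD1 t) //= big1 ?addr0.
  by rewrite mcoeffZ mcoeffX eqxx mulr1.
by move=> i it; rewrite mcoeffZ mcoeffX eq_mnm1 (negbTE it) mulr0.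
Qed.
Lemma mcoeff0_sroot s : (sroot R s)@_0 = 0.
Proof.
rewrite /sroot raddf_sum /= big1 // => t _.
by rewrite mcoeffZ mcoeffX mnm1_eq0 mulr0.
Qed.

Lemma sum_nbrs (V : zmodType) (F : nat -> V) s :
  (forall k, k != s :> nat -> k != s.+1 :> nat -> k.+1 != s :> nat -> F k = 0) ->
  \sum_(t < n) F t = F s + ((if (0 < s)%N then F s.-1 else 0)
    + (if (s.+1 < n)%N then F s.+1 else 0)).
Proof.
move=> F0; have sn := ltn_ord s.
rewrite -(big_mkord xpredT F) (@big_cat_nat _ _ _ s) //=; last exact: ltnW.
rewrite (big_ltn sn) addrCA; congr (_ + (_ + _)).
  case: (nat_of_ord s) F0 => [|k] F0 /=; first by rewrite big_geq.
  rewrite big_nat_recr //= big_nat_cond big1 ?add0r // => i /andP[/andP[_ ik] _].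
  by apply: F0; lia.
case: ifP => h; last by rewrite big_geq // leqNgt h.
rewrite (big_ltn h) big_nat_cond big1 ?addr0 // => i /andP[/andP[ik _] _].
by apply: F0; lia.
Qed.

(** Column [s] of the Cartan matrix is supported on [s] and its neighbours. The entry -2 for s_2,
    s_1 produces the coefficient 2 of X_2 when [j = 1]. *)
Lemma zpoly_root s : (2 <= n)%N -> zpoly (sroot R s) =
  let j := lab s in
  if j == 1%N then 2 *: X 1 + 2 *: X 2
  else if (j < n)%N then (-1) ^+ j.+1 *: (2 *: X j + X j.-1 + X j.+1)
  else (-1) ^+ j.+1 *: (2 *: X j + X j.-1).
Proof.
move=> n2; rewrite /zpoly mcoeff0_sroot scale0r add0r.
under eq_bigr do rewrite mcoeffU_sroot.
pose F (k : nat) : A := (if k == s then 2 else if (k == 1%N) && (s == 0%N :> nat) then - 2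
  else if (k == s.+1) || (s == k.+1 :> nat) then - 1 else 0) *: ((-1) ^+ k.+2 *: X k.+1).
rewrite (eq_bigr (fun t : 'I_n => F t)); last first.
  by move=> t _; rewrite /F /zweight /cartan /lab !eqSS.
rewrite (@sum_nbrs _ F s); last first.
  move=> k k1 k2 k3; rewrite /F (negbTE k1) (negbTE k2) [_ == k.+1]eq_sym (negbTE k3) /=.
  by rewrite ifF ?scale0r //; lia.
rewrite /F eqxx /lab /=.
have sn := ltn_ord s.
case: (nat_of_ord s) sn => [|k] sn /=.
  rewrite add0r n2 /= !exprS expr0 !mulr1 !mulN1r !opprK scale1r scaleN1r.
  by rewrite scalerN scaleNr opprK.
rewrite (_ : k == k.+1 = false) 1?(_ : k.+2 == k.+1 = false) ?andbF /=; try lia.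
set c := (-1) ^+ k.+3.
have h2 : (-1) ^+ k.+2 = - c :> R by rewrite /c [in RHS]exprS mulN1r opprK.
have h4 : (-1) ^+ k.+4 = - c :> R by rewrite /c exprS mulN1r.
rewrite h2 h4 !eqxx orbT /= !scalerA mulN1r opprK (mulrC 2).
by case: ifP => _; rewrite ?addr0 -!scalerA -!scalerDr ?addrA.
Qed.

End Polynomials.

(** * The functor on diagrams *)

Section Evaluation.
Variables (R : realType) (n : nat).
Hypothesis n_ge2 : (2 <= n)%N.
Local Notation A := (zigzag R n).
Local Notation e j := (ze R n j).
Local Notation word := (seq 'I_n).
Local Notation unit := (bregular R n).
Local Notation U s := (bU R n (lab s)).
Local Notation dterm := (@dterm R n).
Implicit Types (w : word) (l : seq (A * A)) (s t : 'I_n).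

Lemma lab_gt0 s : (0 < lab s)%N. Proof. by []. Qed.
Lemma lab_le s : (lab s <= n)%N. Proof. exact: ltn_ord. Qed.
Lemma lab_bound s : (0 < lab s <= n)%N. Proof. exact: ltn_ord. Qed.

Lemma additive_sum (V W : zmodType) (f : V -> W) (I : Type) (r : seq I) (F : I -> V) :
  (forall p q, f (p + q) = f p + f q) -> f (\sum_(i <- r) F i) = \sum_(i <- r) f (F i).
Proof.
move=> fD; elim: r => [|i r IH]; last by rewrite !big_cons fD IH.
by rewrite !big_nil; apply: (addrI (f 0)); rewrite -fD !addr0.
Qed.

Lemma bhom_sum (M N : gbimod R n) (f : bhom M N) (I : Type) (r : seq I) (F : I -> M) :
  f (\sum_(i <- r) F i) = \sum_(i <- r) f (F i).
Proof. exact/additive_sum/(biD (bhom_bi f)). Qed.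
Lemma bhomZ (M N : gbimod R n) (f : bhom M N) c p : f (c *: p) = c *: f p.
Proof. exact: biZ (bhom_bi f) _ _. Qed.
Lemma bhomD (M N : gbimod R n) (f : bhom M N) p q : f (p + q) = f p + f q.
Proof. exact: biD (bhom_bi f) _ _. Qed.

(** Morphisms are sums of homogeneous maps, so the constant part, of degree 0, and the linear part,
    of degree 2, are handled separately. *)
Lemma ghom_box (f : {mpoly R[n]}) : ghom (fun x : unit => bl x (zpoly f : unit)).
Proof.
have H (I : Type) (r : seq I) (c : I -> R) (F : I -> unit) d :
    (forall i, bcentral (F i)) -> (forall i, bdeg d (F i)) ->
    ghom (fun x : unit => bl x (\sum_(i <- r) c i *: F i)).
  move=> FC Fd; elim: r => [|i r IH].
    rewrite big_nil; suff -> : (fun x : unit => bl x (0 : unit)) = 0 by apply: ghom_zero.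
    by apply/funext => x; rewrite (lact0 (blP unit)).
  rewrite big_cons.
  suff -> : (fun x : unit => bl x (c i *: F i + \sum_(i <- r) c i *: F i))
      = (fun x : unit => bl x (c i *: F i)) + (fun x : unit => bl x (\sum_(i <- r) c i *: F i)).
    apply: ghom_add => //; apply: (@ghom_central _ _ _ _ d); last exact: bdegZ.
    by move=> x; rewrite (lactZr (blP unit)) FC (ractZl (brP unit)).
  by apply/funext => x; rewrite (lactDr (blP unit)).
suff -> : (fun x : unit => bl x (zpoly f : unit)) =
    (fun x : unit => bl x (\sum_(i <- [:: tt]) f@_0 *: (1 : unit)))
    + (fun x : unit => bl x (\sum_(t < n) f@_(U_(t)) *: (zweight R t : unit))).
  apply: ghom_add; first by apply: (H _ _ _ _ 0) => _; [move=> x /=;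
    rewrite mulr1 mul1r|exact: zdeg_1].
  apply: (H _ _ _ _ 2) => t; first by move=> x; apply: zweight_central.
  by apply/zdegZ/zX_deg.
by apply/funext => x; rewrite big_seq1; apply: (lactDr (blP unit)).
Qed.
Definition Ubox (f : {mpoly R[n]}) : bhom unit unit := mkhom (ghom_box f).

(** Enddots and splitting vertices carry this sign; in the counit and zigzag relations it occurs
    squared. *)
Definition sgn s : R := (-1) ^+ (lab s).+1.
Lemma sgnK s : sgn s * sgn s = 1. Proof. by rewrite -expr2 sqrr_sign. Qed.

Fixpoint diag_eval x y (d : dterm x y) : bhom (Gobj R x) (Gobj R y) :=
  match d in Defs.dterm _ x y return bhom (Gobj R x) (Gobj R y) with
  | Dzero _ _ => 0
  | Dadd _ _ f g => diag_eval f + diag_eval g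
  | Dscale _ _ c f => c *: diag_eval f
  | Did x => bid (Gobj R x)
  | Dcomp _ _ _ g f => bcomp (diag_eval g) (diag_eval f)
  | Dtens x y x' y' f g => bcomp (gmu R y y') (bcomp (btmap (diag_eval f) (diag_eval g))
    (gmui R x x'))
  | Denddot s => sgn s *: Ubeta R n (lab s)
  | Dstartdot s => Ugamma R n_ge2 (lab s)
  | Dsplit s => sgn s *: Ualpha R n (lab s)
  | Dmerge s => Udelta R (lab_gt0 s) (lab_le s) n_ge2
  | Dbox f => Ubox f
  | Dvert2 _ _ _ => 0
  | Dvert3 _ _ _ => 0
  | Dvert4 _ _ _ => 0
  end.

Local Notation Geval := diag_eval.

Lemma Geval_comp x y z (g : dterm y z) (f : dterm x y) p : Geval (Dcomp g f)
  p = Geval g (Geval f p).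
Proof. by []. Qed.
Lemma Geval_add x y (f g : dterm x y) p : Geval (Dadd f g) p = Geval f p + Geval g p.
Proof. by []. Qed.
Lemma Geval_scale x y c (f : dterm x y) p : Geval (Dscale c f) p = c *: Geval f p.
Proof. by []. Qed.
Lemma Geval_id (x : word) p : Geval (Did R x) p = p. Proof. by []. Qed.

Lemma Geval_star x y x' y' (f : dterm x y) (g : dterm x' y') p q :
  Geval (Dtens f g) (star p q) = star (Geval f p) (Geval g q).
Proof.
rewrite -[LHS]/(gmu R y y' (btmap (Geval f) (Geval g) (gmui R x x' (star p q)))).
by rewrite /star gmuK_app btmapE.
Qed.

Lemma Geval_tens x y x' y' (f : dterm x y) (g : dterm x' y') l l' : size l = size x ->
  Geval (Dtens f g) (ptens (x ++ x') (l ++ l')) = star (Geval f (ptens x l))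
    (Geval g (ptens x' l')).
Proof. by move=> h; rewrite -star_ptens // Geval_star. Qed.

Lemma star_suml (x y : word) (I : Type) (r : seq I) (F : I -> Gobj R x) (q : Gobj R y) :
  star (\sum_(i <- r) F i) q = \sum_(i <- r) star (F i) q.
Proof. by apply: (additive_sum (f := fun p => star p q)) => *; apply: starDl. Qed.
Lemma star_sumr (x y : word) (I : Type) (r : seq I) (p : Gobj R x) (F : I -> Gobj R y) :
  star p (\sum_(i <- r) F i) = \sum_(i <- r) star p (F i).
Proof. by apply: (additive_sum (f := star p)) => *; apply: starDr. Qed.

Section OneColour.
Variable s : 'I_n.
Local Notation j := (lab s).
Local Notation phi := (phi j).
Local Notation u := (@u_ R n j).

Lemma ptens1 a b : ptens [:: s] [:: (a, b)] = u a b. Proof. by []. Qed.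
Lemma ptens2 a b c d : ptens [:: s; s] [:: (a, b); (c, d)] = tpure (u a b) (u c d).
Proof. by []. Qed.

Lemma Geval_enddot a b : Geval (Denddot R s) (ptens [:: s] [:: (a,
  b)]) = sgn s *: (a * e j * b) :> unit.
Proof. exact: (congr1 (fun z : unit => sgn s *: z) (UbetaE j a b)). Qed.
Lemma Geval_startdot : Geval (Dstartdot R s) (ptens [::] [::])
  = \sum_(p <- gamma_basis R n j) ptens [:: s] [:: p].
Proof. by rewrite [LHS](lact1 (blP (U s))). Qed.
Lemma Geval_split a b : Geval (Dsplit R s) (ptens [:: s] [:: (a, b)]) = sgn s *: ptens [:: s;
  s] [:: (a, e j); (e j, b)].
Proof. exact: (congr1 (fun z : btens (U s) (U s) => sgn s *: z) (UalphaE j a b)). Qed.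
Lemma Geval_merge a b c d : Geval (Dmerge R s) (ptens [:: s; s] [:: (a, b);
  (c, d)]) = ptens [:: s] [:: (a * phi (b * c), d)].
Proof. exact: UdeltaE. Qed.

Lemma phiel x : e j * phi x = phi x. Proof. exact: phi_el. Qed.

Lemma Geval_cap a b c d : Geval (Dcap R s) (ptens [:: s; s] [:: (a, b); (c, d)])
  = sgn s *: (a * phi (b * c) * d) :> unit.
Proof. by rewrite Geval_comp Geval_merge Geval_enddot -(mulrA a) phi_er. Qed.
Lemma Geval_cup : Geval (Dcup R s) (ptens [::] [::])
  = sgn s *: \sum_(p <- gamma_basis R n j) ptens [:: s; s] [:: (p.1, e j); (e j, p.2)].
Proof.
rewrite Geval_comp Geval_startdot bhom_sum scaler_sumr; apply: eq_bigr => -[a b] _.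
exact: Geval_split.
Qed.

Lemma gamma1_bl a : bl a (gamma1 R n j) = \sum_(p <- gamma_basis R n j) u (a * p.1) p.2.
Proof.
rewrite [LHS]additive_sum; last exact: (lactDr (blP (U s))).
by apply: eq_bigr => p _; apply: bl_u.
Qed.
Lemma gamma1_br a : br (gamma1 R n j) a = \sum_(p <- gamma_basis R n j) u p.1 (p.2 * a).
Proof.
rewrite /gamma1 (additive_sum (f := fun x : U s => br x a)); last by move=> *;
  apply: (ractDl (brP (U s))).
by apply: eq_bigr => p _; apply: br_u.
Qed.
Lemma gamma_basis_central a : \sum_(p <- gamma_basis R n j) u (a * p.1) p.2 =
  \sum_(p <- gamma_basis R n j) u p.1 (p.2 * a).
Proof. by rewrite -gamma1_bl -gamma1_br (gamma1_central _ n_ge2). Qed.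

(** Applying the map that sends x (x) y to x (x) phi (y e_j) b to the centrality identity for
    gamma_j(1) moves [a] out of phi, which leaves the case of e_j, [gamma_basis_phir]. *)
Lemma dual_r a b : \sum_(p <- gamma_basis R n j) u p.1 (phi (p.2 * a) * b) = u a b.
Proof.
pose h (x y : A) : U s := u x (phi (y * e j) * b).
have hB : ubalanced j h.
  split=> *; rewrite /h.
  - by rewrite u_Dl.
  - by rewrite mulrDl phiD // ?lab_le // mulrDl u_Dr.
  - by rewrite u_Zl.
  - by rewrite zscaleAl phiZ ?lab_le // zscaleAl u_Zr.
  - by rewrite u_er.
  - by rewrite -mulrA phiM_el ?lab_le.
  - by rewrite u_i -mulrA phiM_il ?lab_le // mulrA.
have E x y : ulift h (u x y) = u x (phi (y * e j) * b) by exact: uliftE.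
have ES (F : A * A -> U s) : ulift h (\sum_(p <- gamma_basis R n j) F p)
  = \sum_(p <- gamma_basis R n j) ulift h (F p).
  by apply: (additive_sum (f := ulift h)) => p q; rewrite (uliftD hB).
have := congr1 (ulift h) (gamma_basis_central a); rewrite !ES.
move=> H; transitivity (\sum_(p <- gamma_basis R n j) ulift h (u p.1 (p.2 * a))).
  by apply: eq_bigr => p _; rewrite E phiM_er ?lab_le.
rewrite -H; transitivity (br (bl a (u (e j) (e j) : U s)) b);
  last by rewrite bl_u br_u u_er u_el.
rewrite -(gamma_basis_phir R (lab_bound s) n_ge2) (additive_sum (f := fun x : U s => br (bl a
  x) b)).
  by apply: eq_bigr => p _; rewrite E bl_u br_u.
by move=> x y; rewrite (lactDr (blP (U s))) (ractDl (brP (U s))).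
Qed.

(** The mirror image of [dual_r], with [gamma_basis_phil]. *)
Lemma dual_l a b : \sum_(p <- gamma_basis R n j) u (a * phi (b * p.1)) p.2 = u a b.
Proof.
pose h (x y : A) : U s := u (a * phi (e j * x)) y.
have hB : ubalanced j h.
  split=> *; rewrite /h.
  - by rewrite mulrDr phiD // ?lab_le // mulrDr u_Dl.
  - by rewrite u_Dr.
  - by rewrite zscaleAr phiZ ?lab_le // zscaleAr u_Zl.
  - by rewrite u_Zr.
  - by rewrite mulrA phiM_er ?lab_le.
  - by rewrite u_el.
  - by rewrite mulrA phiM_ir ?lab_le // mulrA u_i.
have E x y : ulift h (u x y) = u (a * phi (e j * x)) y by exact: uliftE.
have ES (F : A * A -> U s) : ulift h (\sum_(p <- gamma_basis R n j) F p)
  = \sum_(p <- gamma_basis R n j) ulift h (F p).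
  by apply: (additive_sum (f := ulift h)) => p q; rewrite (uliftD hB).
have := congr1 (ulift h) (gamma_basis_central b); rewrite !ES => H.
transitivity (\sum_(p <- gamma_basis R n j) ulift h (u (b * p.1) p.2)).
  by apply: eq_bigr => p _; rewrite E phiM_el ?lab_le.
rewrite H; transitivity (br (bl a (u (e j) (e j) : U s)) b);
  last by rewrite bl_u br_u u_er u_el.
rewrite -(gamma_basis_phil R (lab_bound s) n_ge2) (additive_sum (f := fun x : U s => br (bl a
  x) b)).
  by apply: eq_bigr => p _; rewrite E bl_u br_u.
by move=> x y; rewrite (lactDr (blP (U s))) (ractDl (brP (U s))).
Qed.

Lemma ptens_dual_r a b : \sum_(p <- gamma_basis R n j) ptens [:: s; s] [:: (p.1, e j);
  (phi (p.2 * a), b)]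
  = ptens [:: s; s] [:: (a, e j); (e j, b)].
Proof.
rewrite [RHS](_ : _ = Ualpha R n j (u a b)); last by rewrite UalphaE.
rewrite -dual_r bhom_sum; apply: eq_bigr => p _; rewrite UalphaE ptens2.
by rewrite -u_phi phiel.
Qed.
Lemma ptens_dual_l a b : \sum_(p <- gamma_basis R n j) ptens [:: s;
  s] [:: (a * phi (b * p.1), e j); (e j, p.2)]
  = ptens [:: s; s] [:: (a, e j); (e j, b)].
Proof.
rewrite [RHS](_ : _ = Ualpha R n j (u a b)); last by rewrite UalphaE.
by rewrite -dual_l bhom_sum; apply: eq_bigr => p _; rewrite UalphaE ptens2.
Qed.

End OneColour.
End Evaluation.

(* Evaluates [f (x) g] on a concrete pure tensor, split as l followed by l'.   *)
Ltac gtens l l' :=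
  match goal with
  | |- context [diag_eval _ (@Dtens _ _ ?x ?y ?x' ?y' ?F ?G)] =>
      rewrite [bfun (diag_eval _ (@Dtens _ _ x y x' y' F G))
        _](@Geval_tens _ _ _ x y x' y' F G l l' erefl)
  end.

Arguments ptens : simpl never.
Arguments diag_eval : simpl never.
Arguments star : simpl never.

(** * One-colour relations *)

Section Frobenius.
Variables (R : realType) (n : nat).
Hypothesis n_ge2 : (2 <= n)%N.
Local Notation A := (zigzag R n).
Local Notation unit := (bregular R n).
Local Notation U s := (bU R n (lab s)).
Local Notation e j := (ze R n j).
Local Notation Geval := (diag_eval n_ge2).
Local Notation "f ⨾ g" := (Dcomp g f) (at level 41, right associativity).
Local Notation "f ⊗ g" := (Dtens f g) (at level 31, right associativity).
Local Notation one x := (Did R x).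
Local Notation enddot := (Denddot R).
Local Notation startdot := (Dstartdot R).
Local Notation split := (Dsplit R).
Local Notation merge := (Dmerge R).
Local Notation cap := (Dcap R).
Local Notation cup := (Dcup R).

Variable s : 'I_n.
Local Notation j := (lab s).
Local Notation phi := (phi j).
Local Notation u := (@u_ R n j).
Local Notation sg := (sgn R s).

Lemma phir (x y : A) : phi (x * phi y) = phi x * phi y.
Proof. by rewrite phiM_phir ?lab_le. Qed.

Lemma star1r (p : U s) (a : A) : @star R n [:: s] [::] p a = br p a.
Proof. by have := @star_nilr R n [:: s] p a; rewrite gcast1. Qed.

(** Both orders contract [b] with [c] and [d] with [x]; the nested contraction factors by
    F_j-linearity of phi. *)
Lemma Geval_assoc : Geval (merge s ⊗ one [:: s] ⨾ merge s)
  = Geval (one [:: s] ⊗ merge s ⨾ merge s).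
Proof.
apply: Gobj_ext => [[|[a b] [|[c d] [|[x y] [|? ?]]]]] // _.
rewrite !Geval_comp.
gtens [:: (a, b); (c, d)] [:: (x, y)]; rewrite Geval_merge Geval_id star_ptens // Geval_merge.
gtens [:: (a, b)] [:: (c, d); (x, y)]; rewrite Geval_merge Geval_id star_ptens // Geval_merge.
by rewrite !mulrA phir !mulrA.
Qed.

Lemma Geval_coassoc : Geval (split s ⨾ split s ⊗ one [:: s])
  = Geval (split s ⨾ one [:: s] ⊗ split s).
Proof.
apply: Gobj_ext => [[|[a b] [|? ?]]] // _.
rewrite !Geval_comp Geval_split !bhomZ.
gtens [:: (a, e j)] [:: (e j, b)]; rewrite Geval_split Geval_id starZl star_ptens //.
by gtens [:: (a, e j)] [:: (e j, b)]; rewrite Geval_split Geval_id starZr star_ptens.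
Qed.

(** The cap contracts the e_j (x) e_j just inserted, and phi (e_j) = 0. *)
Lemma Geval_needle : Geval (split s ⨾ cap s) = Geval (Dzero R [:: s] [::]).
Proof.
apply: Gobj_ext => [[|[a b] [|? ?]]] // _.
rewrite Geval_comp Geval_split bhomZ Geval_cap zeK phi_e ?lab_le //.
by rewrite mulr0 mul0r !scaler0.
Qed.

Lemma Geval_unitl : Geval (startdot s ⊗ one [:: s] ⨾ merge s) = Geval (one [:: s]).
Proof.
apply: Gobj_ext => [[|[a b] [|? ?]]] // _.
rewrite !Geval_comp.
gtens (@nil (A * A)) [:: (a, b)]; rewrite Geval_startdot Geval_id star_suml bhom_sum
  -[RHS](dual_r n_ge2).
apply: eq_bigr => -[p q] _; rewrite star_ptens // Geval_merge ptens1.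
by rewrite u_phi.
Qed.

Lemma Geval_unitr : Geval (one [:: s] ⊗ startdot s ⨾ merge s) = Geval (one [:: s]).
Proof.
apply: Gobj_ext => [[|[a b] [|? ?]]] // _.
rewrite !Geval_comp.
gtens [:: (a, b)] (@nil (A * A)); rewrite Geval_startdot Geval_id star_sumr bhom_sum
  -[RHS](dual_l n_ge2).
by apply: eq_bigr => -[p q] _; rewrite star_ptens // Geval_merge.
Qed.

Lemma Geval_counitl : Geval (split s ⨾ enddot s ⊗ one [:: s]) = Geval (one [:: s]).
Proof.
apply: Gobj_ext => [[|[a b] [|? ?]]] // _.
rewrite !Geval_comp Geval_split bhomZ.
gtens [:: (a, e j)] [:: (e j, b)]; rewrite Geval_enddot Geval_id starZl star_nill bl_ptens.
by rewrite scalerA sgnK scale1r -!mulrA !zeK Geval_id !ptens1 u_er.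
Qed.

Lemma Geval_counitr : Geval (split s ⨾ one [:: s] ⊗ enddot s) = Geval (one [:: s]).
Proof.
apply: Gobj_ext => [[|[a b] [|? ?]]] // _.
rewrite !Geval_comp Geval_split bhomZ.
gtens [:: (a, e j)] [:: (e j, b)]; rewrite Geval_enddot Geval_id starZr star1r.
by rewrite scalerA sgnK scale1r br_u Geval_id !mulrA !zeK u_el.
Qed.

Lemma Geval_frobl : Geval (one [:: s] ⊗ split s ⨾ merge s ⊗ one [:: s])
  = Geval (merge s ⨾ split s).
Proof.
apply: Gobj_ext => [[|[a b] [|[c d] [|? ?]]]] // _.
rewrite !Geval_comp Geval_merge Geval_split.
gtens [:: (a, b)] [:: (c, d)]; rewrite Geval_split Geval_id starZr bhomZ star_ptens //.
by gtens [:: (a, b); (c, e j)] [:: (e j, d)]; rewrite Geval_merge Geval_id star_ptens.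
Qed.

Lemma Geval_frobr : Geval (split s ⊗ one [:: s] ⨾ one [:: s] ⊗ merge s)
  = Geval (merge s ⨾ split s).
Proof.
apply: Gobj_ext => [[|[a b] [|[c d] [|? ?]]]] // _.
rewrite !Geval_comp Geval_merge Geval_split.
gtens [:: (a, b)] [:: (c, d)]; rewrite Geval_split Geval_id starZl bhomZ star_ptens //.
gtens [:: (a, e j)] [:: (e j, b); (c, d)]; rewrite Geval_merge Geval_id star_ptens //.
(* The value of phi lies in F_j, so it may cross the tensor product of U_j before [Ualpha] is
   applied. *)
rewrite phiel [LHS](_ : _ = sg *: Ualpha R n j (u a (phi (b * c) * d))); last first.
  by rewrite UalphaE -u_phi phiel.
by rewrite -u_phi UalphaE.
Qed.

(** The cup inserts the dual bases and the cap contracts one half with [a], which is [dual_r]; the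
    two signs cancel. *)
Lemma Geval_zigzagl : Geval (cup s ⊗ one [:: s] ⨾ one [:: s] ⊗ cap s) = Geval (one [:: s]).
Proof.
apply: Gobj_ext => [[|[a b] [|? ?]]] // _.
rewrite !Geval_comp.
gtens (@nil (A * A)) [:: (a, b)]; rewrite Geval_cup Geval_id starZl star_suml bhomZ bhom_sum.
rewrite -[RHS](dual_r n_ge2) scaler_sumr; apply: eq_bigr => -[p q] _; rewrite star_ptens //.
gtens [:: (p, e j)] [:: (e j, q); (a, b)]; rewrite Geval_cap Geval_id starZr star1r.
by rewrite scalerA sgnK scale1r br_u phiel !mulrA phiel.
Qed.

Lemma Geval_zigzagr : Geval (one [:: s] ⊗ cup s ⨾ cap s ⊗ one [:: s]) = Geval (one [:: s]).
Proof.
apply: Gobj_ext => [[|[a b] [|? ?]]] // _.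
rewrite !Geval_comp.
gtens [:: (a, b)] (@nil (A * A)); rewrite Geval_cup Geval_id starZr star_sumr bhomZ bhom_sum.
rewrite -[RHS](dual_l n_ge2) scaler_sumr; apply: eq_bigr => -[p q] _; rewrite star_ptens //.
gtens [:: (a, b); (p, e j)] [:: (e j, q)]; rewrite Geval_cap Geval_id starZl star_nill.
by rewrite scalerA sgnK scale1r bl_u -mulrA zeK u_er.
Qed.

Lemma Geval_dotl : Geval (startdot s ⊗ one [:: s] ⨾ cap s) = Geval (enddot s).
Proof.
apply: Gobj_ext => [[|[a b] [|? ?]]] // _.
rewrite Geval_comp Geval_enddot.
gtens (@nil (A * A)) [:: (a, b)]; rewrite Geval_startdot Geval_id star_suml bhom_sum.
rewrite -UbetaE -(dual_r n_ge2) bhom_sum scaler_sumr; apply: eq_bigr => -[p q] _.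
by rewrite star_ptens // Geval_cap UbetaE !mulrA -(mulrA p (e j)) phiel.
Qed.

Lemma Geval_dotr : Geval (one [:: s] ⊗ startdot s ⨾ cap s) = Geval (enddot s).
Proof.
apply: Gobj_ext => [[|[a b] [|? ?]]] // _.
rewrite Geval_comp Geval_enddot.
gtens [:: (a, b)] (@nil (A * A)); rewrite Geval_startdot Geval_id star_sumr bhom_sum.
rewrite -UbetaE -(dual_l n_ge2) bhom_sum scaler_sumr; apply: eq_bigr => -[p q] _.
by rewrite star_ptens // Geval_cap UbetaE -(mulrA a _ (e j)) phi_er.
Qed.

Lemma Geval_trivl : Geval (cup s ⊗ one [:: s; s] ⨾ one [:: s] ⊗ merge s ⊗ one [:: s]
  ⨾ one [:: s] ⊗ cap s) = Geval (merge s).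
Proof.
apply: Gobj_ext => [[|[a b] [|[c d] [|? ?]]]] // _.
rewrite Geval_merge Geval_comp.
gtens (@nil (A * A)) [:: (a, b); (c, d)]; rewrite Geval_cup Geval_id starZl star_suml bhomZ
  bhom_sum.
rewrite ptens1 u_phi -(dual_r n_ge2) scaler_sumr; apply: eq_bigr => -[p q] _.
rewrite star_ptens // Geval_comp.
gtens [:: (p, e j)] [:: (e j, q); (a, b); (c, d)].
gtens [:: (e j, q); (a, b)] [:: (c, d)]; rewrite Geval_merge !Geval_id !star_ptens //.
gtens [:: (p, e j)] [:: (e j * phi (q * a), b); (c, d)];
  rewrite Geval_cap Geval_id starZr star1r.
by rewrite scalerA sgnK scale1r br_u phiel !mulrA phiel.
Qed.

Lemma Geval_trivr : Geval (one [:: s; s] ⊗ cup s ⨾ one [:: s] ⊗ merge s ⊗ one [:: s]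
  ⨾ cap s ⊗ one [:: s]) = Geval (merge s).
Proof.
apply: Gobj_ext => [[|[a b] [|[c d] [|? ?]]]] // _.
rewrite Geval_merge Geval_comp.
gtens [:: (a, b); (c, d)] (@nil (A * A)); rewrite Geval_cup Geval_id starZr star_sumr bhomZ
  bhom_sum.
rewrite ptens1 -(dual_l n_ge2) scaler_sumr; apply: eq_bigr => -[p q] _.
rewrite star_ptens // Geval_comp.
gtens [:: (a, b)] [:: (c, d); (p, e j); (e j, q)].
gtens [:: (c, d); (p, e j)] [:: (e j, q)]; rewrite Geval_merge !Geval_id !star_ptens //.
gtens [:: (a, b); (c * phi (d * p), e j)] [:: (e j, q)];
  rewrite Geval_cap Geval_id starZl star_nill.
by rewrite scalerA sgnK scale1r bl_u -mulrA zeK u_er mulrA phir !mulrA.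
Qed.

Lemma Geval_trivsl : Geval (cup s ⊗ one [:: s] ⨾ one [:: s] ⊗ merge s) = Geval (split s).
Proof.
apply: Gobj_ext => [[|[a b] [|? ?]]] // _.
rewrite Geval_split Geval_comp.
gtens (@nil (A * A)) [:: (a, b)]; rewrite Geval_cup Geval_id starZl star_suml bhomZ bhom_sum.
rewrite -(ptens_dual_r n_ge2); congr (_ *: _); apply: eq_bigr => -[p q] _.
rewrite star_ptens //.
by gtens [:: (p, e j)] [:: (e j, q); (a, b)]; rewrite Geval_merge Geval_id star_ptens // phiel.
Qed.

Lemma Geval_trivsr : Geval (one [:: s] ⊗ cup s ⨾ merge s ⊗ one [:: s]) = Geval (split s).
Proof.
apply: Gobj_ext => [[|[a b] [|? ?]]] // _.
rewrite Geval_split Geval_comp.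
gtens [:: (a, b)] (@nil (A * A)); rewrite Geval_cup Geval_id starZr star_sumr bhomZ bhom_sum.
rewrite -(ptens_dual_l n_ge2); congr (_ *: _); apply: eq_bigr => -[p q] _.
rewrite star_ptens //.
by gtens [:: (a, b); (p, e j)] [:: (e j, q)]; rewrite Geval_merge Geval_id star_ptens.
Qed.

(** Multiplying the dual pairs in B_n gives 2 X_j and a loop at each neighbour. For [j = 1] both
    arrow pairs give X_2, because - (ie_2) X_2 (ie_2) = X_2. *)
Lemma gamma_basis_barbell : sg *: (\sum_(p <- gamma_basis R n j) p.1 * e j * p.2)
  = zpoly (sroot R s).
Proof.
rewrite zpoly_root // /sgn; have jn := lab_le s; have j0 := lab_gt0 s;
  move: (lab s) jn j0 => k kn k0.
rewrite /gamma_basis; have [->|k1] := eqVneq k 1%N; rewrite !(big_cons, big_nil) addr0 /=.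
  have a12 : is_arrow n 1 2 by rewrite /is_arrow /is_vertex /=; lia.
  have a21 : is_arrow n 2 1 by rewrite is_arrowC.
  rewrite !zX_ze zeK ze_zX -(mulrA _ _ (e 1)) !za_ze (zX_arrow _ a21) mulrA -(mulrA (- _))
    (zX_arrow _ a21).
  rewrite !mulNr zi_zX -mulrA zi_sqr // mulrN opprK zX_ze exprS expr1 mulN1r opprK scale1r
    addrA.
  by rewrite !scaler_nat !mulr2n.
rewrite !zX_ze zeK ze_zX !za_ze.
have a1 : is_arrow n k.-1 k by rewrite /is_arrow /is_vertex; lia.
have e1 : za R n k.-1 k * za R n k k.-1 = zXl R n k.-1 by rewrite zX_arrow.
case: ifP => kn'.
  have a2 : is_arrow n k.+1 k by rewrite /is_arrow /is_vertex; lia.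
  by rewrite zX_arrow // zX_arrow // scaler_nat mulr2n !addrA.
rewrite zX_arrow // (@za_out _ _ k.+1) ?mul0r ?addr0; last by rewrite /is_arrow /is_vertex; lia.
by rewrite scaler_nat mulr2n !addrA.
Qed.

Lemma Geval_box f : Geval (Dbox f) (ptens [::] [::]) = zpoly f :> unit.
Proof. exact: (lact1 (blP unit)). Qed.

Lemma Geval_barbell : Geval (startdot s ⨾ enddot s) = Geval (Dbox (hroot R s)).
Proof.
apply: Gobj_ext => [[|? ?]] // _.
rewrite Geval_comp Geval_startdot bhom_sum Geval_box -gamma_basis_barbell scaler_sumr.
by apply: eq_bigr => -[p q] _; rewrite Geval_enddot.
Qed.

Lemma Geval_box_lin c (f g h : hpoly R n) : hpoly_val h = c *: hpoly_val f + hpoly_val g ->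
  Geval (Dbox h) = Geval (Dadd (Dscale c (Dbox f)) (Dbox g)).
Proof.
move=> E; apply: Gobj_ext => [[|? ?]] // _.
by rewrite Geval_add Geval_scale !Geval_box E zpoly_lin.
Qed.

Lemma Geval_box_mul (f g h : hpoly R n) : hpoly_val h = hpoly_val f * hpoly_val g ->
  Geval (Dbox h) = Geval (Dbox f ⊗ Dbox g).
Proof.
move=> E; apply: Gobj_ext => [[|? ?]] // _; rewrite Geval_box.
gtens (@nil (A * A)) (@nil (A * A)); rewrite !Geval_box star_nill E.
exact: zpolyM.
Qed.

Lemma Geval_box_one (h : hpoly R n) : hpoly_val h = 1 -> Geval (Dbox h) = Geval (one [::]).
Proof.
move=> E; apply: Gobj_ext => [[|? ?]] // _; rewrite Geval_box E Geval_id.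
exact: zpoly1.
Qed.

Lemma ze_zpoly (f : {mpoly R[n]}) : e j * zpoly f = f@_0 *: e j + (f@_(U_(s)) * sg)
  *: zXl R n j.
Proof.
rewrite /zpoly mulrDr zscaleAr mulr1; congr (_ + _);
  rewrite mulr_sumr (bigD1 s) //= big1 ?addr0.
  by rewrite /zweight !zscaleAr ze_zX scalerA.
move=> t ts; rewrite /zweight !zscaleAr ze_zX_ne ?scaler0 //.
by apply: contra ts => /eqP [E]; apply/eqP/val_inj.
Qed.

(** The arrow pairs start at neighbours of [j], so e_j kills them. *)
Lemma ze_gamma1 : bl (e j) (gamma1 R n j) = u (zXl R n j) (e j) + u (e j) (zXl R n j).
Proof.
rewrite gamma1_bl /gamma_basis; case: eqVneq => [->|j1]; rewrite !(big_cons, big_nil) addr0 /=.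
  by rewrite ze_zX zeK ze_za_ne // mulNr mulrN mulrA ze_zi_ne // mul0r oppr0 !u_0l !addr0.
by rewrite ze_zX zeK !ze_za_ne ?u_0l ?addr0 //; rewrite /lab; lia.
Qed.

(** Next to e_j a polynomial acts by its constant term plus a signed multiple of X_j, whose
    coefficient is that of ['X_s] and changes sign under the reflection. The broken strand adds this
    multiple of X_j on both sides of the tensor sign ([ze_gamma1]): it cancels the term on the right
    and supplies the one on the left. *)
Lemma Geval_forcing (f sf g : hpoly R n) :
  hpoly_val sf = refl s f -> hpoly_val f - hpoly_val sf = sroot R s * hpoly_val g ->
  Geval (Dbox f ⊗ one [:: s]) = Geval (Dadd (one [:: s] ⊗ Dbox sf)
    (enddot s ⨾ Dbox g ⨾ startdot s)).
Proof.
move=> Esf E; have := E; rewrite Esf => /demazure_low [g0 gs].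
have f0 : (hpoly_val sf)@_0 = (hpoly_val f)@_0.
  by have /eqP := congr1 (mcoeff 0) E; rewrite mcoeffB mcoeff0M mcoeff0_sroot mul0r subr_eq0
    => /eqP.
have fs : (hpoly_val sf)@_(U_(s)) = - (hpoly_val f)@_(U_(s)).
  have := congr1 (mcoeff U_(s)) E; rewrite mcoeffB mcoeffUM mcoeffU_sroot mcoeff0_sroot mul0r
    addr0.
  by rewrite /cartan eqxx g0 => /eqP; rewrite subr_eq addrC -subr_eq => /eqP <-; ring.
apply: Gobj_ext => [[|[a b] [|? ?]]] // _.
gtens (@nil (A * A)) [:: (a, b)]; rewrite Geval_box Geval_id star_nill.
rewrite Geval_add; gtens [:: (a, b)] (@nil (A * A)); rewrite Geval_box Geval_id star1r.
rewrite !Geval_comp Geval_enddot.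
have -> : Geval (Dbox g) (sg *: (a * e j * b) : unit) = sg *: (a * e j * b * zpoly g)
  by exact: zscaleAl.
(* [g] has no ['X_s] term, so it acts next to e_j by its constant term, the ['X_s] coefficient of
   [f]. *)
have -> : a * e j * b * zpoly g = (hpoly_val f)@_(U_(s)) *: (a * e j * b).
  rewrite -mulrA zpoly_central mulrA -(mulrA a) ze_zpoly gs mul0r scale0r addr0 g0.
  by rewrite zscaleAr zscaleAl.
rewrite !bhomZ [Geval _ _](_ : _ = u (a * zXl R n j) b + u a (zXl R n j * b)); last first.
  rewrite -[LHS]/(bl (a * e j * b) (gamma1 R n j)) (lactM (blP (U s))) (gamma1_central _ n_ge2).
  by rewrite -blr (lactM (blP (U s))) ze_gamma1 (lactDr (blP (U s))) (ractDl (brP (U s)))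
    !bl_u !br_u
    u_er u_el.
rewrite !ptens1 bl_u br_u -zpoly_central -[u (a * _) b]u_er -mulrA -zpoly_central ze_zpoly.
rewrite -[u a (b * _)]u_el zpoly_central mulrA ze_zpoly f0 fs.
rewrite mulrDr mulrDl !zscaleAr !zscaleAl u_Dl u_Dr !u_Zl !u_Zr u_er u_el.
rewrite -addrA; congr (_ + _).
by rewrite mulNr scaleNr scalerA (mulrC sg) scalerDr addrCA addNr addr0.
Qed.

End Frobenius.

(** * Two-colour relations *)

Section TwoColour.
Variables (R : realType) (n : nat).
Hypothesis n_ge2 : (2 <= n)%N.
Local Notation A := (zigzag R n).
Local Notation U s := (bU R n (lab s)).
Local Notation e j := (ze R n j).
Local Notation i_ j := (zi R n j).
Local Notation a_ j k := (za R n j k).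
Local Notation X j := (zXl R n j).
Local Notation phi j := (@phi R n j).
Local Notation Geval := (diag_eval n_ge2).
Local Notation "f ⨾ g" := (Dcomp g f) (at level 41, right associativity).
Local Notation "f ⊗ g" := (Dtens f g) (at level 31, right associativity).
Local Notation one x := (Did R x).
Local Notation enddot := (Denddot R).
Local Notation "u ◁ f ▷ w" := (@Dwhisker _ _ u _ _ w f)
  (at level 35, f at level 34, w at level 34).
Local Notation cupcap := (cupcap R).

Lemma bl1 (M : gbimod R n) (m : M) : bl 1 m = m. Proof. exact: lact1 (blP M) m. Qed.

Lemma bhom0 (M N : gbimod R n) (f : bhom M N) : f 0 = 0.
Proof. by rewrite -{1}(scale0r (0 : M)) bhomZ scale0r. Qed.
Lemma bhomN (M N : gbimod R n) (f : bhom M N) m : f (- m) = - f m.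
Proof. by rewrite -scaleN1r bhomZ scaleN1r. Qed.

Section Pair.
Variables s t : 'I_n.
Local Notation js := (lab s).
Local Notation jt := (lab t).

(** The value contains a factor in e_s B_n e_t, which is 0 for distant vertices. *)
Lemma Geval_dot2 : cox s t = 2%N -> Geval ([::] ◁ enddot s ▷ [:: t]) = 0.
Proof.
move=> st; apply: Gobj_ext => [[|[a b] [|[c d] [|? ?]]]] // _; rewrite /Dwhisker.
gtens (@nil (A * A)) [:: (a, b); (c, d)].
gtens [:: (a, b)] [:: (c, d)].
rewrite !Geval_id Geval_enddot starZl !star_nill bl1 bl_ptens ptens1 -u_er -!mulrA (mulrA b)
  (mulrA (e js)).
rewrite corner_far ?mulr0 ?u_0l ?scaler0 //.
  by move: st; rewrite /cox /lab eqSS; case: (eqVneq s t) => // st _.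
by move: st; rewrite /cox /zadj; case: ifP => // _; case: ifP => // _; rewrite orbC; case: ifP.
Qed.

(* Every pure tensor takes this form, by moving factors across the tensor       *)
(* products over B_n; b and c only matter in e_s B_n e_t and e_t B_n e_s.       *)
Definition mid3 a b c f : Gobj R [:: s; t; s] := ptens [:: s; t; s] [:: (a, b); (1, c); (1, f)].

Lemma mid3E a b c f : mid3 a b c f = tpure (tpure (@u_ R n js a b) (@u_ R n jt 1 c)
  : btens (U s) (U t)) (@u_ R n js 1 f).
Proof. by []. Qed.

Lemma u_bl1 j a b : bl a (@u_ R n j 1 b) = @u_ R n j a b :> bU R n j.
Proof. by rewrite bl_u mulr1. Qed.

Lemma ptens_N3 a b c d x y : ptens [:: s; t; s] [:: (a, b); (c, d);
  (x, y)] = mid3 a (b * c) (d * x) y.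
Proof.
rewrite [LHS](_ : _ = tpure (tpure (@u_ R n js a b) (@u_ R n jt c d) : btens (U s) (U t))
  (@u_ R n js x y)) //.
by rewrite -(u_bl1 _ c) -(u_bl1 _ x) -!tpure_bal !br_pure !br_u mid3E.
Qed.

Lemma mid3Db a b b' c f : mid3 a (b + b') c f = mid3 a b c f + mid3 a b' c f.
Proof. by rewrite !mid3E u_Dr !tpureDl. Qed.
Lemma mid3Dc a b c c' f : mid3 a b (c + c') f = mid3 a b c f + mid3 a b c' f.
Proof. by rewrite !mid3E u_Dr tpureDr tpureDl. Qed.
Lemma mid3Zb k a b c f : mid3 a (k *: b) c f = k *: mid3 a b c f.
Proof. by rewrite !mid3E u_Zr !tpureZl. Qed.
Lemma mid3Zc k a b c f : mid3 a b (k *: c) f = k *: mid3 a b c f.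
Proof. by rewrite !mid3E u_Zr tpureZr tpureZl. Qed.
Lemma mid3_ea a b c f : mid3 (a * e js) b c f = mid3 a b c f.
Proof. by rewrite !mid3E u_er. Qed.
Lemma mid3_eb a b c f : mid3 a (e js * b) c f = mid3 a b c f.
Proof. by rewrite !mid3E u_el. Qed.
Lemma mid3_ec a b c f : mid3 a b (e jt * c) f = mid3 a b c f.
Proof. by rewrite !mid3E u_el. Qed.
Lemma mid3_be a b c f : mid3 a (b * e jt) c f = mid3 a b c f.
Proof. by rewrite !mid3E -br_u tpure_bal u_bl1 !u_1l. Qed.
Lemma mid3_ce a b c f : mid3 a b (c * e js) f = mid3 a b c f.
Proof. by rewrite !mid3E -br_u -br_pure tpure_bal u_bl1 !u_1l. Qed.
Lemma mid3_ia a b c f : mid3 a (i_ js * b) c f = mid3 (a * i_ js) b c f.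
Proof. by rewrite !mid3E u_i. Qed.
Lemma mid3_ib a b c f : mid3 a (b * i_ jt) c f = mid3 a b (i_ jt * c) f.
Proof. by rewrite !mid3E -br_u tpure_bal u_bl1 -u_i mul1r. Qed.
Lemma mid3_ic a b c f : mid3 a b (c * i_ js) f = mid3 a b c (i_ js * f).
Proof. by rewrite !mid3E -br_u -br_pure tpure_bal u_bl1 -u_i mul1r. Qed.

Lemma Geval_cupcap a b c d x y :
  Geval (cupcap s t) (ptens [:: s; t; s] [:: (a, b); (c, d); (x, y)]) =
  (sgn R s * sgn R t) *: \sum_(p <- gamma_basis R n jt)
     ptens [:: s; t; s] [:: (a * phi js (b * c * e jt * d * x), e js); p; (e js, y)].
Proof.
rewrite !Geval_comp /Dwhisker.
gtens [:: (a, b)] [:: (c, d); (x, y)].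
gtens [:: (c, d)] [:: (x, y)].
rewrite !Geval_id Geval_enddot starZl star_nill bl_ptens starZr star_ptens //.
rewrite (bhomZ (Geval (Dmerge R s))) Geval_merge (bhomZ (Geval (Dsplit R s)))
  Geval_split scalerA mulrC.
rewrite (bhomZ (Geval _)); congr (_ *: _).
gtens [:: (a * phi js (b * (c * e jt * d * x)), e js)] [:: (e js, y)].
gtens (@nil (A * A)) [:: (e js, y)].
rewrite !Geval_id Geval_startdot star_suml star_sumr !mulrA.
by apply: eq_bigr => p _; rewrite !star_ptens.
Qed.

(** In normal form, cupcap replaces the two middle factors by the dual bases for [t] and keeps only
    a scalar of F_s from them. *)
Lemma Geval_cupcap3 a b c f :
  Geval (cupcap s t) (mid3 a b c f) = (sgn R s * sgn R t) *:
    \sum_(p <- gamma_basis R n jt) mid3 (a * phi js (b * e jt * c)) p.1 p.2 f.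
Proof.
rewrite /mid3 Geval_cupcap !mulr1; congr (_ *: _); apply: eq_bigr => -[p q] _.
by rewrite ptens_N3 mid3_eb mid3_ce.
Qed.

Lemma mid3_ext (N : gbimod R n) (g h : bhom (Gobj R [:: s; t; s]) N) :
  (forall a b c f, g (mid3 a b c f) = h (mid3 a b c f)) -> g = h.
Proof.
move=> gh; apply: Gobj_ext => [[|[a b] [|[c d] [|[x y] [|? ?]]]]] // _.
by rewrite ptens_N3.
Qed.

Definition mid4 a b c d f : Gobj R [:: s; t; s; t] :=
  ptens [:: s; t; s; t] [:: (a, b); (1, c); (1, d); (1, f)].

Lemma mid4E a b c d f : mid4 a b c d f = tpure (mid3 a b c d : btens (btens (U s) (U t))
  (U s)) (@u_ R n jt 1 f).
Proof. by []. Qed.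

Lemma br_N3 a b c f x : br (mid3 a b c f) x = mid3 a b c (f * x).
Proof. by rewrite !mid3E br_pure br_u. Qed.

Lemma ptens_N4 a b c d x y z w :
  ptens [:: s; t; s; t] [:: (a, b); (c, d); (x, y); (z, w)] = mid4 a (b * c) (d * x) (y * z) w.
Proof.
rewrite [LHS](_ : _ = tpure (ptens [:: s; t; s] [:: (a, b); (c, d);
  (x, y)] : btens (btens (U s) (U t)) (U s)) (@u_ R n jt z w)) //.
by rewrite -(u_bl1 _ z) -tpure_bal ptens_N3 [br _ _]br_N3 mid4E.
Qed.

Lemma mid3Df a b c f f' : mid3 a b c (f + f') = mid3 a b c f + mid3 a b c f'.
Proof. by rewrite !mid3E u_Dr tpureDr. Qed.
Lemma mid3Zf k a b c f : mid3 a b c (k *: f) = k *: mid3 a b c f.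
Proof. by rewrite !mid3E u_Zr tpureZr. Qed.
Lemma mid3_ef a b c f : mid3 a b c (e js * f) = mid3 a b c f.
Proof. by rewrite !mid3E u_el. Qed.

Lemma mid4Db a b b' c d f : mid4 a (b + b') c d f = mid4 a b c d f + mid4 a b' c d f.
Proof. by rewrite !mid4E mid3Db tpureDl. Qed.
Lemma mid4Dc a b c c' d f : mid4 a b (c + c') d f = mid4 a b c d f + mid4 a b c' d f.
Proof. by rewrite !mid4E mid3Dc tpureDl. Qed.
Lemma mid4Dd a b c d d' f : mid4 a b c (d + d') f = mid4 a b c d f + mid4 a b c d' f.
Proof. by rewrite !mid4E mid3Df tpureDl. Qed.
Lemma mid4Zb k a b c d f : mid4 a (k *: b) c d f = k *: mid4 a b c d f.
Proof. by rewrite !mid4E mid3Zb tpureZl. Qed.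
Lemma mid4Zc k a b c d f : mid4 a b (k *: c) d f = k *: mid4 a b c d f.
Proof. by rewrite !mid4E mid3Zc tpureZl. Qed.
Lemma mid4Zd k a b c d f : mid4 a b c (k *: d) f = k *: mid4 a b c d f.
Proof. by rewrite !mid4E mid3Zf tpureZl. Qed.
Lemma mid4_ea a b c d f : mid4 (a * e js) b c d f = mid4 a b c d f.
Proof. by rewrite !mid4E mid3_ea. Qed.
Lemma mid4_eb a b c d f : mid4 a (e js * b) c d f = mid4 a b c d f.
Proof. by rewrite !mid4E mid3_eb. Qed.
Lemma mid4_ec a b c d f : mid4 a b (e jt * c) d f = mid4 a b c d f.
Proof. by rewrite !mid4E mid3_ec. Qed.
Lemma mid4_ed a b c d f : mid4 a b c (e js * d) f = mid4 a b c d f.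
Proof. by rewrite !mid4E mid3_ef. Qed.
Lemma mid4_be a b c d f : mid4 a (b * e jt) c d f = mid4 a b c d f.
Proof. by rewrite !mid4E mid3_be. Qed.
Lemma mid4_ce a b c d f : mid4 a b (c * e js) d f = mid4 a b c d f.
Proof. by rewrite !mid4E mid3_ce. Qed.
Lemma mid4_de a b c d f : mid4 a b c (d * e jt) f = mid4 a b c d f.
Proof. by rewrite !mid4E -br_N3 tpure_bal u_bl1 !u_1l. Qed.
Lemma mid4_ia a b c d f : mid4 a (i_ js * b) c d f = mid4 (a * i_ js) b c d f.
Proof. by rewrite !mid4E mid3_ia. Qed.
Lemma mid4_ib a b c d f : mid4 a (b * i_ jt) c d f = mid4 a b (i_ jt * c) d f.
Proof. by rewrite !mid4E mid3_ib. Qed.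
Lemma mid4_ic a b c d f : mid4 a b (c * i_ js) d f = mid4 a b c (i_ js * d) f.
Proof. by rewrite !mid4E mid3_ic. Qed.
Lemma mid4_id a b c d f : mid4 a b c (d * i_ jt) f = mid4 a b c d (i_ jt * f).
Proof. by rewrite !mid4E -br_N3 tpure_bal u_bl1 -u_i mul1r. Qed.

Lemma mid4_ext (N : gbimod R n) (g h : bhom (Gobj R [:: s; t; s; t]) N) :
  (forall a b c d f, g (mid4 a b c d f) = h (mid4 a b c d f)) -> g = h.
Proof.
move=> gh; apply: Gobj_ext => [[|[a b] [|[c d] [|[x y] [|[z w] [|? ?]]]]]] // _.
by rewrite ptens_N4.
Qed.

Lemma mid3_0c a b f : mid3 a b 0 f = 0.
Proof. by rewrite -(scale0r (0 : A)) mid3Zc scale0r. Qed.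
Lemma mid3_0b a c f : mid3 a 0 c f = 0.
Proof. by rewrite -(scale0r (0 : A)) mid3Zb scale0r. Qed.
Lemma mid4_0b a c d f : mid4 a 0 c d f = 0.
Proof. by rewrite -(scale0r (0 : A)) mid4Zb scale0r. Qed.
Lemma mid4_0c a b d f : mid4 a b 0 d f = 0.
Proof. by rewrite -(scale0r (0 : A)) mid4Zc scale0r. Qed.
Lemma mid4_0d a b c f : mid4 a b c 0 f = 0.
Proof. by rewrite -(scale0r (0 : A)) mid4Zd scale0r. Qed.

Section Reduction.
Hypothesis st : zadj js jt.

Lemma neq_st : js != jt. Proof. by move: st; rewrite /zadj; lia. Qed.
Lemma arrow_st : is_arrow n js jt.
Proof. by rewrite /is_arrow /is_vertex !lab_bound. Qed.

(* The corner e_s B_n e_t is generated by the arrow over F_s and F_t, and the  *)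
(* scalars move out of it to the neighbouring factors.                        *)
Lemma mid3_zero (N : gbimod R n) (g : bhom (Gobj R [:: s; t; s]) N) :
  (forall a f, g (mid3 a (a_ js jt) (a_ jt js) f) = 0) ->
  (forall a f, g (mid3 a (a_ js jt) (i_ jt * a_ jt js) f) = 0) -> g = 0.
Proof.
have g0 := bhom0 g.
move=> h1 h2.
have hc a c f : g (mid3 a (a_ js jt) c f) = 0.
  rewrite -mid3_ec -mid3_ce; move: a f.
  apply: (@corner_sandwich R n (fun c => forall a f, g (mid3 a (a_ js jt) c f) = 0)) => //.
  - by move=> *; rewrite mid3_0c.
  - by move=> x y hx hy *; rewrite mid3Dc bhomD hx hy addr0.
  - by move=> k x hx *; rewrite mid3Zc bhomZ hx scaler0.
  - by rewrite eq_sym neq_st.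
  - by move=> a f; rewrite mid3_ic.
apply: mid3_ext => a b c f; rewrite -mid3_eb -mid3_be [RHS](_ : _ = 0) //; move: a c f.
apply: (@corner_sandwich R n (fun b => forall a c f, g (mid3 a b c f) = 0)) => //.
- by move=> *; rewrite mid3_0b.
- by move=> x y hx hy *; rewrite mid3Db bhomD hx hy addr0.
- by move=> k x hx *; rewrite mid3Zb bhomZ hx scaler0.
- exact: neq_st.
- by move=> a c f; rewrite mid3_ia.
- by move=> a c f; rewrite mid3_ib.
Qed.

(** The factors are reduced from the right. An i that leaves a factor on its right enters one for
    which the claim is already known in general; an i on the left of [c] or [d] stays, whence the
    four cases. *)
Lemma mid4_zero (N : gbimod R n) (g : bhom (Gobj R [:: s; t; s; t]) N) :
  (forall a f, g (mid4 a (a_ js jt) (a_ jt js) (a_ js jt) f) = 0) ->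
  (forall a f, g (mid4 a (a_ js jt) (i_ jt * a_ jt js) (a_ js jt) f) = 0) ->
  (forall a f, g (mid4 a (a_ js jt) (a_ jt js) (i_ js * a_ js jt) f) = 0) ->
  (forall a f, g (mid4 a (a_ js jt) (i_ jt * a_ jt js) (i_ js * a_ js jt) f) = 0) -> g = 0.
Proof.
have g0 := bhom0 g.
move=> h1 h2 h3 h4.
have hd c : (forall a f, g (mid4 a (a_ js jt) c (a_ js jt) f) = 0) ->
    (forall a f, g (mid4 a (a_ js jt) c (i_ js * a_ js jt) f) = 0) ->
    forall a d f, g (mid4 a (a_ js jt) c d f) = 0.
  move=> k1 k2 a d f; rewrite -mid4_ed -mid4_de; move: a f.
  apply: (@corner_sandwich R n (fun d => forall a f, g (mid4 a (a_ js jt) c d f) = 0)) => //.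
  - by move=> *; rewrite mid4_0d.
  - by move=> x y hx hy *; rewrite mid4Dd bhomD hx hy addr0.
  - by move=> k x hx *; rewrite mid4Zd bhomZ hx scaler0.
  - exact: neq_st.
  - by move=> a f; rewrite mid4_id.
have hc a c d f : g (mid4 a (a_ js jt) c d f) = 0.
  rewrite -mid4_ec -mid4_ce; move: a d f.
  apply: (@corner_sandwich R n (fun c => forall a d f, g (mid4 a (a_ js jt) c d f) = 0)) => //.
  - by move=> *; rewrite mid4_0c.
  - by move=> x y hx hy *; rewrite mid4Dc bhomD hx hy addr0.
  - by move=> k x hx *; rewrite mid4Zc bhomZ hx scaler0.
  - by rewrite eq_sym neq_st.
  - exact: hd.
  - exact: hd.
  - by move=> a d f; rewrite mid4_ic; apply: hd.
apply: mid4_ext => a b c d f; rewrite -mid4_eb -mid4_be [RHS](_ : _ = 0) //; move: a c d f.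
apply: (@corner_sandwich R n (fun b => forall a c d f, g (mid4 a b c d f) = 0)) => //.
- by move=> *; rewrite mid4_0b.
- by move=> x y hx hy *; rewrite mid4Db bhomD hx hy addr0.
- by move=> k x hx *; rewrite mid4Zb bhomZ hx scaler0.
- exact: neq_st.
- by move=> a c d f; rewrite mid4_ia.
- by move=> a c d f; rewrite mid4_ib.
Qed.

End Reduction.
End Pair.

(** Cutting by e_s leaves only the dual pair that starts at [s]. *)
Lemma gamma_basis_corner (V : zmodType) (F : A -> A -> V) js jt :
  (forall y, F 0 y = 0) -> (forall x y, F (e js * x) y = F x y) ->
  jt != 1%N -> zadj js jt ->
  \sum_(p <- gamma_basis R n jt) F p.1 p.2 = F (a_ js jt) (a_ jt js).
Proof.
move=> F0 Fe j1 adj; have ne : js != jt by move: adj; rewrite /zadj; lia.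
rewrite /gamma_basis (negbTE j1) !(big_cons, big_nil) /= addr0.
rewrite -(Fe (X jt)) ze_zX_ne // -(Fe (e jt)) ze_orth // !F0 !add0r.
rewrite -(Fe (a_ jt.-1 jt)) -(Fe (a_ jt.+1 jt)).
have [h|h] : js = jt.-1 \/ js = jt.+1 by move: adj; rewrite /zadj; lia.
  by rewrite -h ze_za ze_za_ne ?F0 ?addr0 //; move: adj; rewrite /zadj; lia.
by rewrite -h ze_za ze_za_ne ?F0 ?add0r //; move: adj; rewrite /zadj; lia.
Qed.

(** At the vertex 1 two dual pairs start at the vertex 2, and both survive. *)
Lemma gamma_basis_corner1 (V : zmodType) (F : A -> A -> V) js jt : js = 2%N -> jt = 1%N ->
  (forall y, F 0 y = 0) -> (forall x y, F (e js * x) y = F x y) ->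
  \sum_(p <- gamma_basis R n jt) F p.1 p.2 =
    F (a_ js jt) (a_ jt js) + F (- (i_ js * a_ js jt)) (a_ jt js * i_ js).
Proof.
move=> -> -> F0 Fe; rewrite /gamma_basis !(big_cons, big_nil) /= addr0.
by rewrite -(Fe (X 1)) ze_zX_ne // -(Fe (e 1)) ze_orth // !F0 !add0r mulNr.
Qed.

Lemma cox_zadj (s t : 'I_n) : (2 < cox s t)%N -> zadj (lab s) (lab t).
Proof.
rewrite /cox /zadj; case: ifP => // _; case: ifP => [/eqP h _|_]; first by move: h;
  rewrite /lab; lia.
by case: ifP => // h _; rewrite orbC.
Qed.

Lemma sgn_zadj (s t : 'I_n) : zadj (lab s) (lab t) -> sgn R s * sgn R t = - 1.
Proof.
rewrite /zadj /sgn => /orP[] /eqP ->; first by rewrite [Z in _ * Z]exprS mulN1r mulrN -expr2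
  sqrr_sign.
by rewrite [Z in Z * _]exprS mulN1r mulNr -expr2 sqrr_sign.
Qed.

(** Here neither colour is s_1 and the Cartan entry is -1, so JW_2 is the identity plus cupcap. On
    the test elements phi turns the loop X_s into e_s, and the sign -1 of adjacent colours makes
    cupcap minus the identity; an extra i is moved out of phi by linearity. *)
Lemma Geval_JW2 (s t : 'I_n) : cox s t = 3%N -> Geval (JW2 R s t) = 0.
Proof.
move=> m3; have adj : zadj (lab s) (lab t) by apply: cox_zadj; rewrite m3.
have [ne [h1 h2]] : s != t /\ (lab s + lab t != 3)%N /\ (lab s == (lab t).+1)
  || (lab t == (lab s).+1).
  by move: m3; rewrite /cox; case: ifP => // _; case: ifP => // _; case: ifP.
have s1 : lab s != 1%N by move: h1 h2; rewrite /lab; lia.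
have t1 : lab t != 1%N by move: h1 h2; rewrite /lab; lia.
have xE : cartan R s t = - 1.
  by rewrite /cartan (negbTE ne) ifF ?h2 //; move: t1; case: (lab t == 1%N); rewrite ?andbF.
have ls : is_loop n (lab s) by move: s1 (lab_bound s); rewrite /is_loop; lia.
have lt : is_loop n (lab t) by move: t1 (lab_bound t); rewrite /is_loop; lia.
have arr := arrow_st adj.
have E a k f : Geval (JW2 R s t) (mid3 s t a (a_ (lab s) (lab t)) (k * a_ (lab t) (lab s)) f) = 
   mid3 s t a (a_ (lab s) (lab t)) (k * a_ (lab t) (lab s)) f
   - mid3 s t (a * phi (lab s) (a_ (lab s) (lab t) * k * a_ (lab t) (lab s))) (a_ (lab s)
     (lab t)) (a_ (lab t) (lab s)) f.
  rewrite Geval_add Geval_scale Geval_id xE invrN invr1 opprK scale1r Geval_cupcap3 sgn_zadj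
    // scaleN1r.
  rewrite (@gamma_basis_corner _ (fun x y => mid3 s t (a * phi (lab s) (a_ (lab s) (lab t)
    * e (lab t) * (k * a_ (lab t) (lab s)))) x y f) (lab s)) //.
  - by rewrite za_ze mulrA.
  - by move=> y; rewrite mid3_0b.
  - by move=> x y; rewrite mid3_eb.
apply: (mid3_zero adj) => a f.
  rewrite -(mul1r (a_ (lab t) (lab s))) E mulr1 mul1r zX_arrow //.
  by rewrite phi_X ?lab_le // mid3_ea subrr.
rewrite E -zi_za // -mulrA zX_arrow // phiM_il ?lab_le // phi_X ?lab_le // zi_ze.
by rewrite -mid3_ia (zi_za R ls lt) mid3_ib subrr.
Qed.

(** * The Jones-Wenzl morphism JW_3 for the pair s_1, s_2 *)

Section JW3.
Variables s t : 'I_n.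
Local Notation js := (lab s).
Local Notation jt := (lab t).
Local Notation P4 := (mid4 s t).
Local Notation E1 := (Geval (cupcap s t ⊗ one [:: t])).
Local Notation E2 := (Geval (one [:: s] ⊗ cupcap t s)).
Local Notation ast := (a_ js jt).
Local Notation ats := (a_ jt js).

Lemma mid4_0a b c d f : P4 0 b c d f = 0.
Proof. by rewrite -{1}(scale0r (0 : A)) mid4E mid3E u_Zl !tpureZl scale0r. Qed.
Lemma mid4Nb a b c d f : P4 a (- b) c d f = - P4 a b c d f.
Proof. by rewrite -scaleN1r mid4Zb scaleN1r. Qed.
Lemma mid4Nc a b c d f : P4 a b (- c) d f = - P4 a b c d f.
Proof. by rewrite -scaleN1r mid4Zc scaleN1r. Qed.
Lemma mid4Nd a b c d f : P4 a b c (- d) f = - P4 a b c d f.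
Proof. by rewrite -scaleN1r mid4Zd scaleN1r. Qed.

Lemma Geval_cupcap4l a b c d f :
  E1 (P4 a b c d f) = (sgn R s * sgn R t) *:
    \sum_(p <- gamma_basis R n jt) P4 (a * phi js (b * e jt * c)) p.1 p.2 d f.
Proof.
rewrite /mid4; gtens [:: (a, b); (1 : A, c); (1 : A, d)] [:: (1 : A, f)].
rewrite Geval_id Geval_cupcap !mulr1 starZl; congr (_ *: _).
rewrite star_suml; apply: eq_bigr => -[p q] _.
by rewrite star_ptens // [LHS]ptens_N4 /= mid4_eb mid4_ce mulr1.
Qed.

Lemma Geval_cupcap4r a b c d f :
  E2 (P4 a b c d f) = (sgn R s * sgn R t) *:
    \sum_(p <- gamma_basis R n js) P4 a (b * phi jt (c * e js * d)) p.1 p.2 f.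
Proof.
rewrite /mid4; gtens [:: (a, b)] [:: (1 : A, c); (1 : A, d); (1 : A, f)].
rewrite Geval_id Geval_cupcap !mulr1 !mul1r starZr mulrC; congr (_ *: _).
rewrite star_sumr; apply: eq_bigr => -[p q] _.
by rewrite star_ptens // [LHS]ptens_N4 /= mid4_ec mid4_de.
Qed.

Hypothesis m4 : cox s t = 4%N.

Let adj : zadj js jt. Proof. by apply: cox_zadj; rewrite m4. Qed.
Let sgE : sgn R s * sgn R t = - 1. Proof. exact: sgn_zadj. Qed.
Let arr : is_arrow n js jt. Proof. exact: arrow_st. Qed.
Let arr' : is_arrow n jt js. Proof. by rewrite is_arrowC arr. Qed.
Let phis : phi js (ast * e jt * ats) = e js.
Proof. by rewrite za_ze zX_arrow // phi_X ?lab_le. Qed.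
Let phit : phi jt (ats * e js * ast) = e jt.
Proof. by rewrite za_ze zX_arrow // phi_X ?lab_le. Qed.

Lemma JW3_coefE z : Geval (JW3 R s t) z =
  z + (cartan R t s / (1 - cartan R s t * cartan R t s)) *: E1 z
    + (cartan R s t / (1 - cartan R s t * cartan R t s)) *: E2 z
    + (- (1 - cartan R s t * cartan R t s)^-1) *: (E2 (E1 z) + E1 (E2 z)).
Proof. by []. Qed.

Local Notation T a f := (P4 a ast ats ast f).

(** With Cartan entries -1 and -2, JW_3 is id + 2 E1 + E2 + E1 E2 + E2 E1. As ie_1 = 0, only T and
    its twist S by ie_2 are left to test. Up to moving ie_2 into the last factor, E1 T = - T, E1 S =
    0, E2 T = - T + S and E2 S = - S - T, and the combination kills both. *)
Lemma JW3_zero12 : js = 1%N -> jt = 2%N -> Geval (JW3 R s t) = 0.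
Proof.
move=> s1 t2; have is0 : i_ js = 0 by rewrite s1 zi_out.
have lt : is_loop n jt by rewrite t2.
have xE : cartan R s t = - 1.
  by rewrite /cartan s1 t2 /= ifF //; apply/eqP => h; move: s1; rewrite h t2.
have yE : cartan R t s = - 2.
  by rewrite /cartan s1 t2 /= ifF //; apply/eqP => h; move: s1; rewrite -h t2.
have JE z : Geval (JW3 R s t) z = z + 2 *: E1 z + E2 z + (E2 (E1 z) + E1 (E2 z)).
  rewrite JW3_coefE xE yE (_ : 1 - -1 * -2 = -1 :> R); last by ring.
  by rewrite invrN invr1 opprK !mulrN1 !opprK !scale1r.
have E1E a b c d f : E1 (P4 a b c d f) = - P4 (a * phi js (b * e jt * c)) ast ats d f.
  rewrite Geval_cupcap4l sgE scaleN1r; congr (- _).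
  rewrite (@gamma_basis_corner _ (fun x y => P4 (a * phi js (b * e jt * c)) x y d f) js) //.
  - by move=> y; rewrite mid4_0b.
  - by move=> x y; rewrite mid4_eb.
  - by rewrite t2.
have E2E a b c d f : E2 (P4 a b c d f) = - (P4 a (b * phi jt (c * e js * d)) ats ast f
    - P4 a (b * phi jt (c * e js * d)) (i_ jt * ats) (ast * i_ jt) f).
  rewrite Geval_cupcap4r sgE scaleN1r; congr (- _).
  rewrite (@gamma_basis_corner1 _ (fun x y => P4 a (b * phi jt (c * e js * d)) x y f) jt js) //.
  - by rewrite mid4Nc.
  - by move=> y; rewrite mid4_0c.
  - by move=> x y; rewrite mid4_ec.
pose S a f := P4 a ast (i_ jt * ats) ast f.
have E1T a f : E1 (T a f) = - T a f by rewrite E1E phis mid4_ea.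
have E2T a f : E2 (T a f) = - T a f + S a (i_ jt * f).
  by rewrite E2E phit mid4_be mid4_id mid4_be opprB addrC.
have E1S a f : E1 (S a f) = 0.
  rewrite E1E za_ze mulrA s1 t2 zi_one -s1 phi0 ?lab_le // mulr0.
  by rewrite -[P4 _ _ _ _ _]/(P4 _ _ _ _ _) mid4_0a oppr0.
have E2S a f : E2 (S a f) = - S a f - T a (i_ jt * f).
  rewrite E2E -mulrA ze_za -mulrA zX_arrow // phiM_il ?lab_le // phi_X ?lab_le // zi_ze.
  rewrite !mid4_ib mid4_id mulrA zi_sqr // mulNr ze_za mid4Nc opprK opprD.
  by [].
apply: (mid4_zero adj) => a f; rewrite ?is0 ?mul0r ?mid4_0d ?bhom0 //.
  rewrite JE E2T E1T !bhomD !bhomN E2T E1T E1S; move: (T a f) (S a _) => x y.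
  rewrite addr0 !opprD !opprK scalerN scaler_nat mulr2n opprD (addrA x (- x)) subrr sub0r.
  rewrite [LHS]addrA -(addrA (- x)).
  by rewrite addrACA addNr subrr !addr0 addNr.
rewrite -[P4 a ast _ ast f]/(S a f) JE E2S E1S !bhomD !bhomN bhom0 E1S E1T;
  move: (T a _) (S a f) => x y.
by rewrite scaler0 addr0 oppr0 !add0r opprK addrA subrr sub0r addNr.
Qed.

(** As in [JW3_zero12] with E1 and E2 exchanged; now ie_2 twists the third inner factor and is moved
    into the first factor. *)
Lemma JW3_zero21 : js = 2%N -> jt = 1%N -> Geval (JW3 R s t) = 0.
Proof.
move=> s2 t1; have it0 : i_ jt = 0 by rewrite t1 zi_out.
have ls : is_loop n js by rewrite s2.
have xE : cartan R s t = - 2.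
  by rewrite /cartan s2 t1 /= ifF //; apply/eqP => h; move: s2; rewrite h t1.
have yE : cartan R t s = - 1.
  by rewrite /cartan s2 t1 /= ifF //; apply/eqP => h; move: s2; rewrite -h t1.
have JE z : Geval (JW3 R s t) z = z + E1 z + 2 *: E2 z + (E2 (E1 z) + E1 (E2 z)).
  rewrite JW3_coefE xE yE (_ : 1 - -2 * -1 = -1 :> R); last by ring.
  by rewrite invrN invr1 opprK !mulrN1 !opprK !scale1r.
have E2E a b c d f : E2 (P4 a b c d f) = - P4 a (b * phi jt (c * e js * d)) ats ast f.
  rewrite Geval_cupcap4r sgE scaleN1r; congr (- _).
  rewrite (@gamma_basis_corner _ (fun x y => P4 a (b * phi jt (c * e js * d)) x y f) jt) //.
  - by move=> y; rewrite mid4_0c.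
  - by move=> x y; rewrite mid4_ec.
  - by rewrite s2.
  - by rewrite /zadj s2 t1.
have E1E a b c d f : E1 (P4 a b c d f) = - (P4 (a * phi js (b * e jt * c)) ast ats d f
    - P4 (a * phi js (b * e jt * c)) (i_ js * ast) (ats * i_ js) d f).
  rewrite Geval_cupcap4l sgE scaleN1r; congr (- _).
  rewrite (@gamma_basis_corner1 _ (fun x y => P4 (a * phi js (b * e jt * c)) x y d f) js jt) //.
  - by rewrite mid4Nb.
  - by move=> y; rewrite mid4_0b.
  - by move=> x y; rewrite mid4_eb.
pose S a f := P4 a ast ats (i_ js * ast) f.
have E1T a f : E1 (T a f) = - T a f + S (a * i_ js) f.
  by rewrite E1E phis !mid4_ea mid4_ia mid4_ic opprB addrC.
have E2T a f : E2 (T a f) = - T a f by rewrite E2E phit mid4_be.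
have E2S a f : E2 (S a f) = 0.
  rewrite E2E -(mulrA ats) (mulrA (e js)) ze_zi mulrA s2 t1 zi_one -t1 phi0 ?lab_le // mulr0.
  by rewrite mid4_0b oppr0.
have E1S a f : E1 (S a f) = - S a f - T (a * i_ js) f.
  rewrite E1E phis !mid4_ea mid4_ia mid4_ic mulrA zi_sqr // mulNr ze_za mid4Nd opprK opprD.
  by [].
apply: (mid4_zero adj) => a f; rewrite ?it0 ?mul0r ?mid4_0c ?bhom0 //.
  rewrite JE E2T E1T !bhomD !bhomN E2T E1T E2S; move: (T a f) (S _ f) => x y.
  rewrite addr0 !opprD !opprK scalerN scaler_nat mulr2n (addrA x) subrr add0r (addrA x).
  by rewrite addrA subrK subrr.
rewrite -[P4 a ast _ _ f]/(S a f) JE E2S E1S !bhomD !bhomN bhom0 E2S E2T;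
  move: (T _ f) (S a f) => x y.
by rewrite scaler0 !addr0 oppr0 !add0r opprK addrA subrr sub0r addNr.
Qed.

Lemma Geval_JW3 : Geval (JW3 R s t) = 0.
Proof.
have [[s1 t2]|[s2 t1]] : (js = 1%N /\ jt = 2%N) \/ (js = 2%N /\ jt = 1%N).
  by move: m4; rewrite /cox /lab; case: ifP => // _; case: ifP => [|_]; [lia|case: ifP].
- exact: JW3_zero12.
- exact: JW3_zero21.
Qed.

End JW3.
End TwoColour.

(** * The theorem *)

Section Soundness.
Variables (R : realType) (n : nat).
Hypothesis n_ge2 : (2 <= n)%N.
Local Notation word := (seq 'I_n).
Local Notation unit := (bregular R n).
Local Notation Geval := (diag_eval n_ge2).
Local Notation dterm := (@dterm R n).

Lemma star0l (x y : word) (q : Gobj R y) : star (0 : Gobj R x) q = 0.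
Proof. by rewrite -(scale0r (0 : Gobj R x)) starZl scale0r. Qed.
Lemma star0r (x y : word) (p : Gobj R x) : star p (0 : Gobj R y) = 0.
Proof. by rewrite -(scale0r (0 : Gobj R y)) starZr scale0r. Qed.

Lemma star_ext (x y : word) N (f g : bhom (Gobj R (x ++ y)) N) :
  (forall p q, f (star p q) = g (star p q)) -> f = g.
Proof.
move=> fg; apply: Gobj_ext => l /split_size [l1 [l2 [-> h1 h2]]].
by rewrite -star_ptens.
Qed.

Lemma star3_ext (x y z : word) N (f g : bhom (Gobj R (x ++ y ++ z)) N) :
  (forall p q r, f (star p (star q r)) = g (star p (star q r))) -> f = g.
Proof.
move=> fg; apply: Gobj_ext => l /split_size [l1 [l2 [-> h1 h2]]].
have [l3 [l4 [-> h3 h4]]] := split_size h2.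
by rewrite -star_ptens // -star_ptens.
Qed.

Lemma Geval_cast (x y : word) (E : x = y) : Geval (Dcast R E) = gcast R E.
Proof. by case: y / E. Qed.

Lemma Geval_comp0 (x y z : word) (g : dterm y z) (f : dterm x y) : Geval g = 0 ->
  Geval (Dcomp g f) = 0.
Proof. by move=> h; apply: bhom_ext => p; rewrite Geval_comp h. Qed.
Lemma Geval_comp0r (x y z : word) (g : dterm y z) (f : dterm x y) : Geval f = 0 ->
  Geval (Dcomp g f) = 0.
Proof. by move=> h; apply: bhom_ext => p; rewrite Geval_comp h bhom0. Qed.
Lemma Geval_whisker0 (u x y w : word) (f : dterm x y) : Geval f = 0 ->
  Geval (Dwhisker u w f) = 0.
Proof.
move=> h; apply: star3_ext => p q r; rewrite /Dwhisker !Geval_star h.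
have -> : (0 : bhom (Gobj R x) (Gobj R y)) q = 0 by [].
by rewrite star0l star0r.
Qed.

(** Finds a 2m-valent vertex among the layers of a composite. *)
Ltac geval0 :=
  lazymatch goal with
  | |- diag_eval _ (Dvert2 _ _) = 0 => reflexivity
  | |- diag_eval _ (Dvert3 _ _) = 0 => reflexivity
  | |- diag_eval _ (Dvert4 _ _) = 0 => reflexivity
  | |- diag_eval _ (@Dwhisker _ _ ?u ?x ?y ?w ?f) = 0 =>
      apply: (@Geval_whisker0 u x y w f); geval0
  | |- diag_eval _ (@Dcomp _ _ ?x ?y ?z ?g ?f) = 0 =>
      first [apply: (@Geval_comp0r x y z g f); geval0 | apply: (@Geval_comp0 x y z g f); geval0]
  end.

Lemma Geval_eq (x y : word) (f g : dterm x y) : deq f g -> Geval f = Geval g.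
Proof.
elim=> {x y f g} //.
- by move=> x y f g h _ -> _ ->.
- by move=> x y f f' g g' _ h _ h'; apply: bhom_ext => p; rewrite !Geval_add h h'.
- by move=> x y c f f' _ h; apply: bhom_ext => p; rewrite !Geval_scale h.
- by move=> x y z f f' g g' _ h _ h'; apply: bhom_ext => p; rewrite !Geval_comp h h'.
- by move=> x y x' y' f f' g g' _ h _ h'; apply: star_ext => p q; rewrite !Geval_star h h'.
- by move=> x y f g h; apply: bhom_ext => p; rewrite !Geval_add addrA.
- by move=> x y f g; apply: bhom_ext => p; rewrite !Geval_add addrC.
- by move=> x y f; apply: bhom_ext => p; rewrite !Geval_add add0r.
- by move=> x y a b f; apply: bhom_ext => p; rewrite !Geval_scale scalerA.
- by move=> x y f; apply: bhom_ext => p; rewrite !Geval_scale scale1r.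
- by move=> x y a f g; apply: bhom_ext => p; rewrite !(Geval_scale, Geval_add) scalerDr.
- by move=> x y a b f; apply: bhom_ext => p; rewrite !(Geval_scale, Geval_add) scalerDl.
- by move=> x y f; apply: bhom_ext => p; rewrite !Geval_scale scale0r.
- move=> x y z a f f' g; apply: bhom_ext => p.
  by rewrite !(Geval_comp, Geval_add, Geval_scale) bhomD bhomZ.
- by move=> x y z a f g g'; apply: bhom_ext => p.
- by move=> x y z t f g h; apply: bhom_ext => p.
- by move=> x y f; apply: bhom_ext => p.
- by move=> x y f; apply: bhom_ext => p.
- move=> x y x' y' a f f' g; apply: star_ext => p q.
  by rewrite !(Geval_star, Geval_add, Geval_scale) starDl starZl.
- move=> x y x' y' a f g g'; apply: star_ext => p q.
  by rewrite !(Geval_star, Geval_add, Geval_scale) starDr starZr.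
- by move=> x y; apply: star_ext => p q; rewrite Geval_star.
- by move=> x y z x' y' z' f g f' g'; apply: star_ext => p q; rewrite !(Geval_comp, Geval_star).
- move=> x y z x' y' z' f g h; apply: star3_ext => p q r.
  by rewrite !Geval_comp !Geval_cast !Geval_star !starA !Geval_star.
- move=> x y f; apply: (@star_ext [::] x) => p q; rewrite Geval_star !star_nill.
  exact/esym/(bil (bhom_bi _)).
- move=> x y f; apply: star_ext => p q; rewrite !Geval_comp !Geval_cast Geval_star !star_nilr.
  exact/esym/(bir (bhom_bi _)).
- exact: Geval_box_lin.
- exact: Geval_box_mul.
- exact: Geval_box_one.
- exact: Geval_barbell.
- exact: Geval_forcing.
- exact: Geval_needle.
- exact: Geval_assoc.
- exact: Geval_coassoc.
- exact: Geval_unitl.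
- exact: Geval_unitr.
- exact: Geval_counitl.
- exact: Geval_counitr.
- exact: Geval_frobl.
- exact: Geval_frobr.
- exact: Geval_zigzagl.
- exact: Geval_zigzagr.
- exact: Geval_dotl.
- exact: Geval_dotr.
- exact: Geval_trivl.
- exact: Geval_trivr.
- exact: Geval_trivsl.
- exact: Geval_trivsr.
(* Rotations and two-colour associativity: each side contains a 2m-valent vertex. *)
- by move=> *; rewrite [RHS](_ : _ = 0); geval0.
- by move=> *; rewrite [RHS](_ : _ = 0); geval0.
- by move=> *; rewrite [RHS](_ : _ = 0); geval0.
- by move=> *; rewrite [RHS](_ : _ = 0); geval0.
- by move=> *; rewrite [RHS](_ : _ = 0); geval0.
- by move=> *; rewrite [RHS](_ : _ = 0); geval0.
- by move=> *; rewrite [RHS](_ : _ = 0); geval0.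
- by move=> *; rewrite [RHS](_ : _ = 0); geval0.
- by move=> *; rewrite [RHS](_ : _ = 0); geval0.
(* The dot-crossing relations are the only ones here with a side free of 2m-valent vertices. *)
- by move=> s t m2; rewrite [RHS]Geval_dot2 //; geval0.
- move=> s t m3; rewrite [RHS](_ : _ = 0); first by geval0.
  by apply: Geval_comp0r; apply: Geval_JW2.
- move=> s t m4; rewrite [RHS](_ : _ = 0); first by geval0.
  by apply: Geval_comp0r; apply: Geval_JW3.
- by move=> *; rewrite [RHS](_ : _ = 0); geval0.
- by move=> *; rewrite [RHS](_ : _ = 0); geval0.
- by move=> *; rewrite [RHS](_ : _ = 0); geval0.
- by move=> *; rewrite [RHS](_ : _ = 0); geval0.
- by move=> *; rewrite [RHS](_ : _ = 0); geval0.
Qed.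

(** A representative of the class is evaluated; by [Geval_eq] its choice does not matter. *)
Definition Gmor (x y : heckecat R n) (f : mor x y) : mor (Gob x) (Gob y) :=
  Geval (lmrepr (P := dpres R x y) f).

Lemma Gmor_dcl (x y : word) (d : dterm x y) : @Gmor x y (dcl d) = Geval d.
Proof. exact/Geval_eq/(@lmreprK _ (dpres R x y)). Qed.

Lemma Gmor_cast (x y : word) (E : x = y) : @Gmor x y (dcast R E) = gcast R E.
Proof. by rewrite Gmor_dcl Geval_cast. Qed.

Lemma gcastK (x y : word) (E : x = y) p : gcast R (esym E) (gcast R E p) = p.
Proof. by case: y / E. Qed.

Lemma Gmor_star (x y x' y' : word) (f : dhom R x y) (g : dhom R x' y') p q :
  @Gmor (x ++ x') (y ++ y') (dtens f g) (star p q) = star (@Gmor x y f p) (@Gmor x' y' g q).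
Proof.
elim/dcl_ind: f => f; elim/dcl_ind: g => g.
by rewrite dtensE !Gmor_dcl Geval_star.
Qed.

Lemma Gmor_monoidal : is_monoidal_functor Gmor (Geps R n) (@Gmu R n).
Proof.
split.
- move=> x y a; elim/dcl_ind=> f; elim/dcl_ind=> g.
  by rewrite -dclZ -dclD !Gmor_dcl.
- by move=> x; rewrite [LHS]Gmor_dcl.
- move=> x y z; elim/dcl_ind=> g; elim/dcl_ind=> f.
  by rewrite [mcomp _ _]dcompE !Gmor_dcl.
- by exists (bid unit); split; apply: bhom_ext.
- by move=> x y; exists (gmui R x y); split; [apply: gmuK|apply: gmuiK].
- move=> x y x' y' f g; apply: bhom_tens_ext => p q.
  rewrite -[RHS]/(@Gmor (x ++ x') (y ++ y') (dtens f g) (star p q)) Gmor_star.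
  by rewrite -[LHS]/(gmu R y y' (btmap (Gmor f) (Gmor g) (tpure p q))) btmapE.
- move=> x y z; apply: bhom_tens3_ext => p q r.
  rewrite -[LHS]/(gmu R x (y ++ z) (btmap (bid _) (gmu R y z)
    (bassoc _ _ _ (tpure (tpure p q) r)))).
  rewrite bassocE btmapE.
  rewrite -[RHS]/(@Gmor ((x ++ y) ++ z) (x ++ y ++ z) (dcast R (esym (catA x y z)))
     (gmu R (x ++ y) z (btmap (gmu R x y) (bid _) (tpure (tpure p q) r)))).
  (* The associator of the strict source is a cast, so the hexagon becomes the associativity
     [starA]. *)
  rewrite btmapE Gmor_cast -[gmu R (x ++ y) z _]/(star (star p q) r) -starA gcastK.
  by [].
- move=> x; apply: bhom_tens_ext => a p.
  rewrite -[LHS]/(@Gmor ([::] ++ x) x (dcast R (cat0s x)) (gmu R [::] x (btmap (bid _)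
    (bid _) (tpure a p)))).
  by rewrite btmapE Gmor_cast gcast1.
- move=> x; apply: bhom_tens_ext => p a.
  rewrite -[LHS]/(@Gmor (x ++ [::]) x (dcast R (cats0 x)) (gmu R x [::] (btmap (bid _)
    (bid _) (tpure p a)))).
  by rewrite btmapE Gmor_cast [LHS]star_nilr [RHS]brunitE.
Qed.

End Soundness.

Theorem theorem2p7p2 (R : realType) (n : nat) (n_ge2 : (2 <= n)%N) :
  exists (alpha : forall s : 'I_n,
            bhom (bU R n (lab s)) (btens (bU R n (lab s)) (bU R n (lab s))))
         (beta : forall s : 'I_n, bhom (bU R n (lab s)) (bregular R n))
         (gamma : forall s : 'I_n, bhom (bregular R n) (bU R n (lab s)))
         (delta : forall s : 'I_n,
            bhom (btens (bU R n (lab s)) (bU R n (lab s))) (bU R n (lab s)))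
         (epsilon : 'I_n -> bhom (bregular R n) (bregular R n))
         (G : forall x y : heckecat R n, mor x y -> mor (Gob x) (Gob y)),
    [/\ forall s, is_alpha (alpha s),
        forall s, is_beta (beta s),
        forall s, is_gamma (gamma s),
        forall s, is_delta (delta s) &
        forall s, is_epsilon s (epsilon s)] /\
    is_monoidal_functor G (Geps R n) (@Gmu R n) /\
    [/\ forall s, G _ _ (dcl (Denddot R s)) = (-1) ^+ (lab s).+1 *: beta s,
        forall s, G _ _ (dcl (Dstartdot R s)) = gamma s,
        forall s, G _ _ (dcl (Dsplit R s)) = (-1) ^+ (lab s).+1 *: alpha s,
        forall s, G _ _ (dcl (Dmerge R s)) = delta s &
        forall s, G _ _ (dcl (Dbox (hroot R s))) = epsilon s] /\
    [/\ forall s t (m2 : cox s t = 2%N), G _ _ (dcl (Dvert2 R m2)) = 0,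
        forall s t (m3 : cox s t = 3%N), G _ _ (dcl (Dvert3 R m3)) = 0 &
        forall s t (m4 : cox s t = 4%N), G _ _ (dcl (Dvert4 R m4)) = 0].
Proof.
exists (fun s => Ualpha R n (lab s)), (fun s => Ubeta R n (lab s)),
  (fun s => Ugamma R n_ge2 (lab s)), (fun s => Udelta R (lab_gt0 s) (lab_le s) n_ge2),
  (fun s => Ubox (hroot R s)), (Gmor n_ge2).
split; [split=> s|split; [exact: Gmor_monoidal|split; split; try by move=> *; apply: Gmor_dcl]].
- by rewrite /is_alpha UalphaE.
- by rewrite /is_beta UbetaE !zeK.
- rewrite /is_gamma UgammaE [LHS](lact1 (blP _)) /gamma1 /gamma_basis.
  case: eqVneq => [->|s1]; rewrite !(big_cons, big_nil) addr0 /= -?zXlE ?addrA //.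
  case: ltnP => sn; rewrite ?addrA //.
  (* The pair through the vertex n + 1 is present in [gamma_basis] but zero. *)
  by rewrite (@za_out R n (lab s).+1) ?u_0l ?addr0 // /is_arrow /is_vertex; lia.
- rewrite /is_delta /eX /ee -zXlE !UdeltaE zX_ze zeK phi_X ?phi_e ?lab_le //.
  by rewrite zeK mulr0 u_0l.
- rewrite /is_epsilon -!zXlE [LHS](lact1 (blP (bregular R n))).
  exact: zpoly_root.
Qed.
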